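(* Let $X$ and $Y$ be Banach spaces. For every bounded operator $\phi : X \to Y$ we have \[ \lim_{k \to \infty} \left\| \phi^{\otimes k} \right\|_{\varepsilon \to \pi}^{1/k} = \gamma_2^*(\phi). \] In particular, the limit is finite if and only if $\phi$ is $2$-dominated.
   Context: All Banach spaces are over the same field, $\mathbf{R}$ or $\mathbf{C}$. $B_Z$ is the closed unit ball of $Z$. $\otimes$ is the algebraic tensor product. Tensor norms: for normed spaces $X,Y$ and $z \in X \otimes Y$, the projective norm is $\|z\|_\pi = \inf\{\sum_{i=1}^n \|x_i\|\|y_i\| : n \in \mathbf{N},\ z = \sum_{i=1}^n x_i \otimes y_i\}$ and the injective norm is $\|z\|_\varepsilon = \sup\{|\langle \alpha \otimes \beta, z\rangle| : \alpha \in B_{X^*}, \beta \in B_{Y^*}\}$. Write $X \otimes_\pi Y$, $X\otimes_\varepsilon Y$ for the resulting (not completed) normed spaces. These constructions are associative, and define inductively $X^{\otimes_\varepsilon 1} = X$, $X^{\otimes_\varepsilon (k+1)} = X^{\otimes_\varepsilon k} \otimes_\varepsilon X$, and similarly $Y^{\otimes_\pi k}$. For a bounded operator $\phi : X \to Y$ and $k \geq 1$, $\|\phi^{\otimes k}\|_{\varepsilon \to \pi}$ is the operator norm of $\phi^{\otimes k} : X^{\otimes_\varepsilon k} \to Y^{\otimes_\pi k}$, with the convention that the norm of an unbounded operator is $+\infty$; the limit is taken in $[0,+\infty]$. $2$-summing norm: for a bounded operator $\phi : X \to Y$, $\pi_2(\phi)$ is the smallest $C$ such that $(\sum_i \|\phi(x_i)\|^2)^{1/2}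 \leq C \sup_{f \in B_{X^*}} (\sum_i |f(x_i)|^2)^{1/2}$ for every finite family $(x_i)$ in $X$; $\phi$ is $2$-summing if such a finite $C$ exists, and otherwise $\pi_2(\phi)=+\infty$. $2$-dominated norm: a bounded operator $\phi : X \to Y$ is $2$-dominated if it factors as $\phi = \phi_2 \phi_1$ with $H$ a Hilbert space and $\phi_1 : X \to H$, $\phi_2 : H \to Y$ bounded such that $\phi_1$ and the adjoint $\phi_2^* : Y^* \to H^*$ are $2$-summing. Then $\gamma_2^*(\phi)$ is the infimum of $\pi_2(\phi_1)\pi_2(\phi_2^* )$ over all such factorizations; $\gamma_2^*(\phi) = +\infty$ if $\phi$ is not $2$-dominated. *)

(* Defs.v *)
From HB Require Import structures.
From mathcomp Require Import all_boot all_order all_algebra.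
From mathcomp Require Import all_classical all_reals all_analysis.
From mathcomp Require Import complex.

Set Implicit Arguments.
Unset Strict Implicit.
Unset Printing Implicit Defensive.

Import Order.TTheory GRing.Theory Num.Theory.
Import numFieldNormedType.Exports.

Local Open Scope classical_set_scope.
Local Open Scope ring_scope.

(* The scalar field is R or R[i]. Norms of R[i]-modules take their values in
   R[i]; [re] brings them back to R. *)
Variant base_field := Reals | Complexes.

Definition scalar_field (R : realType) (F : base_field) : numFieldType :=
  match F with Reals => R | Complexes => R[i] end.

Definition re (R : realType) (F : base_field) : scalar_field R F -> R :=
  match F with Reals => id | Complexes => @complex.Re R end.
Arguments re {R F}.

Definition conjs (R : realType) (F : base_field) : scalar_field R F -> scalar_field R F :=
  match F with Reals => id | Complexes => @conjc R end.
Arguments conjs {R F}.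

Section ScalarTheory.
Variables (R : realType) (F : base_field).
Implicit Types a b : scalar_field R F.

Lemma re0 : re (0 : scalar_field R F) = 0.
Proof. by case: F. Qed.

Lemma re1 : re (1 : scalar_field R F) = 1.
Proof. by case: F. Qed.

Lemma reD a b : re (a + b) = re a + re b.
Proof. by case: F a b => //= -[? ?] [? ?]. Qed.

Lemma reM a b : 0 <= a -> 0 <= b -> re (a * b) = re a * re b.
Proof.
case: F a b => //= -[x y] [x' y']; rewrite !lecE /=.
by move=> /andP[/eqP-> _] /andP[/eqP-> _]; rewrite mul0r subr0.
Qed.

Lemma ler_re a b : a <= b -> re a <= re b.
Proof. by case: F a b => //= -[x y] [x' y']; rewrite lecE => /andP[]. Qed.

End ScalarTheory.

Definition modulus (R : realType) (F : base_field) (a : scalar_field R F) : R :=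
  re `|a|.

Section ModulusTheory.
Variables (R : realType) (F : base_field).
Implicit Types a b : scalar_field R F.

Lemma modulus_ge0 a : 0 <= modulus a.
Proof. by rewrite -(re0 R F) ler_re. Qed.

Lemma modulus0 : modulus (0 : scalar_field R F) = 0.
Proof. by rewrite /modulus normr0 re0. Qed.

Lemma modulusM a b : modulus (a * b) = modulus a * modulus b.
Proof. by rewrite /modulus normrM reM. Qed.

Lemma modulusD a b : modulus (a + b) <= modulus a + modulus b.
Proof. by rewrite /modulus -reD ler_re// ler_normD. Qed.

Lemma modulus_sum (I : Type) (s : seq I) (f : I -> scalar_field R F) :
  modulus (\sum_(i <- s) f i) <= \sum_(i <- s) modulus (f i).
Proof.
elim: s => [|i s ih]; first by rewrite !big_nil modulus0.
by rewrite !big_cons (le_trans (modulusD _ _))// lerD2l.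
Qed.

Lemma modulus_surj r : 0 <= r -> exists a, modulus a = r.
Proof.
rewrite /modulus; case: F => r0; first by exists r; rewrite /= ger0_norm.
exists r%:C%C; have rC : 0 <= r%:C%C :> R[i] by rewrite lecE /= eqxx.
by rewrite (_ : `|_| = r%:C%C)//; exact: ger0_norm.
Qed.

End ModulusTheory.

(* Algebraic tensor product: formal sums of elementary tensors, two of them
   being identified when every bilinear map into every vector space gives them
   the same value. *)
Section Tensor.
Variables (K : numFieldType) (X Y : lmodType K).

Definition eval_sum (V : lmodType K) (f : X -> Y -> V) (s : seq (X * Y)) : V :=
  \sum_(p <- s) f p.1 p.2.

Definition tensor_eq (s t : seq (X * Y)) : bool :=
  `[< forall (V : lmodType K) (f : X -> Y -> V),
        bilinear_for *:%R *:%R f -> eval_sum f s = eval_sum f t >].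

Lemma tensor_eq_equiv : equiv_class_of tensor_eq.
Proof.
split=> [s|s t|t s u].
- by apply/asboolP.
- by apply/asboolP/asboolP => h V f bf; rewrite h.
- move=> /asboolP h1 /asboolP h2; apply/asboolP => V f bf.
  by rewrite h1// h2.
Qed.

Canonical tensor_equiv := EquivRelPack tensor_eq_equiv.

Definition tensor : Type := {eq_quot tensor_equiv}%qT.

HB.instance Definition _ := Choice.on tensor.
HB.instance Definition _ := EqQuotient.on tensor.

Definition tensor_of_sum (s : seq (X * Y)) : tensor := (\pi_tensor s)%qT.

Definition elem_tensor (x : X) (y : Y) : tensor := tensor_of_sum [:: (x, y)].

(* The linear map induced by [f]; meaningful when [f] is bilinear. *)
Definition tensor_lift (V : lmodType K) (f : X -> Y -> V) (z : tensor) : V :=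
  eval_sum f (repr z).

Lemma tensor_lift_sum (V : lmodType K) (f : X -> Y -> V) (s : seq (X * Y)) :
  bilinear_for *:%R *:%R f -> tensor_lift f (tensor_of_sum s) = eval_sum f s.
Proof.
move=> bf; rewrite /tensor_lift /tensor_of_sum.
have /eqmodP/asboolP : (\pi_tensor (repr (\pi_tensor s)) = \pi_tensor s)%qT.
  by rewrite reprK.
exact.
Qed.

Lemma tensor_extP (z w : tensor) :
  (forall (V : lmodType K) (f : X -> Y -> V),
     bilinear_for *:%R *:%R f -> tensor_lift f z = tensor_lift f w) -> z = w.
Proof.
move=> h; rewrite -[z]reprK -[w]reprK; apply/eqmodP/asboolP => V f bf.
exact: h.
Qed.

Definition tensor_zero : tensor := tensor_of_sum [::].
Definition tensor_add (z w : tensor) : tensor :=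
  tensor_of_sum (repr z ++ repr w).
Definition tensor_scale (a : K) (z : tensor) : tensor :=
  tensor_of_sum [seq (a *: p.1, p.2) | p <- repr z].
Definition tensor_opp (z : tensor) : tensor := tensor_scale (-1) z.

Section LiftOps.
Variables (V : lmodType K) (f : X -> Y -> V).
Hypothesis bf : bilinear_for *:%R *:%R f.

Lemma tensor_lift0 : tensor_lift f tensor_zero = 0.
Proof. by rewrite tensor_lift_sum// /eval_sum big_nil. Qed.

Lemma tensor_liftD z w :
  tensor_lift f (tensor_add z w) = tensor_lift f z + tensor_lift f w.
Proof. by rewrite tensor_lift_sum// /eval_sum big_cat. Qed.

Lemma tensor_liftZ a z :
  tensor_lift f (tensor_scale a z) = a *: tensor_lift f z.
Proof.
rewrite tensor_lift_sum// /tensor_lift /eval_sum big_map scaler_sumr.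
apply: eq_bigr => p _ /=.
by have := scalable_linear (bf.1 p.2) a p.1.
Qed.

Lemma tensor_liftN z : tensor_lift f (tensor_opp z) = - tensor_lift f z.
Proof. by rewrite tensor_liftZ scaleN1r. Qed.

End LiftOps.

Fact tensor_addA : associative tensor_add.
Proof. by move=> z w u; apply: tensor_extP => V f bf; rewrite !tensor_liftD// addrA. Qed.

Fact tensor_addC : commutative tensor_add.
Proof. by move=> z w; apply: tensor_extP => V f bf; rewrite !tensor_liftD// addrC. Qed.

Fact tensor_add0 : left_id tensor_zero tensor_add.
Proof.
by move=> z; apply: tensor_extP => V f bf; rewrite tensor_liftD// tensor_lift0// add0r.
Qed.

Fact tensor_addN : left_inverse tensor_zero tensor_opp tensor_add.
Proof.
move=> z; apply: tensor_extP => V f bf.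
by rewrite tensor_liftD// tensor_liftN// tensor_lift0// addNr.
Qed.

HB.instance Definition _ := GRing.isZmodule.Build tensor
  tensor_addA tensor_addC tensor_add0 tensor_addN.

Fact tensor_scaleA a b z :
  tensor_scale a (tensor_scale b z) = tensor_scale (a * b) z.
Proof. by apply: tensor_extP => V f bf; rewrite !tensor_liftZ// scalerA. Qed.

Fact tensor_scale1 : left_id 1 tensor_scale.
Proof. by move=> z; apply: tensor_extP => V f bf; rewrite tensor_liftZ// scale1r. Qed.

Fact tensor_scaleDr : right_distributive tensor_scale +%R.
Proof.
move=> a z w; apply: tensor_extP => V f bf.
by rewrite tensor_liftZ// !tensor_liftD// !tensor_liftZ// scalerDr.
Qed.

Fact tensor_scaleDl z : {morph tensor_scale^~ z : a b / a + b}.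
Proof.
move=> a b; apply: tensor_extP => V f bf.
by rewrite tensor_liftZ// tensor_liftD// !tensor_liftZ// scalerDl.
Qed.

HB.instance Definition _ := GRing.Zmodule_isLmodule.Build K tensor
  tensor_scaleA tensor_scale1 tensor_scaleDr tensor_scaleDl.

Lemma tensor_lift_linear (V : lmodType K) (f : X -> Y -> V) :
  bilinear_for *:%R *:%R f -> linear (tensor_lift f).
Proof.
by move=> bf a z w; rewrite [LHS]tensor_liftD// [X in X + _]tensor_liftZ.
Qed.

Lemma tensor_lift_elem (V : lmodType K) (f : X -> Y -> V) x y :
  bilinear_for *:%R *:%R f -> tensor_lift f (elem_tensor x y) = f x y.
Proof. by move=> bf; rewrite tensor_lift_sum// /eval_sum big_seq1. Qed.

Lemma elem_tensor_bilinear : bilinear_for *:%R *:%R elem_tensor.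
Proof.
split=> [y|x] a u v; apply: tensor_extP => V f bf;
  rewrite tensor_lift_linear// !tensor_lift_elem//.
- by have := bf.1 y a u v.
- by have := bf.2 x a u v.
Qed.

Lemma tensor_of_sumE s :
  tensor_of_sum s = \sum_(p <- s) elem_tensor p.1 p.2.
Proof.
elim: s => [|p s ih]; first by rewrite big_nil.
rewrite big_cons -ih; apply: tensor_extP => V f bf.
rewrite [RHS]tensor_liftD// tensor_lift_elem// !tensor_lift_sum//.
by rewrite /eval_sum big_cons.
Qed.

Lemma tensor_sum_elem (z : tensor) :
  exists s : seq (X * Y), z = \sum_(p <- s) elem_tensor p.1 p.2.
Proof.
by exists (repr z); rewrite -tensor_of_sumE /tensor_of_sum reprK.
Qed.

Lemma tensor_lift_unique (V : lmodType K) (f : X -> Y -> V)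
    (g : {linear tensor -> V}) :
  bilinear_for *:%R *:%R f ->
  (forall x y, g (elem_tensor x y) = f x y) -> g =1 tensor_lift f.
Proof.
move=> bf gf z; have [s ->] := tensor_sum_elem z.
rewrite -[in RHS]tensor_of_sumE tensor_lift_sum// linear_sum.
by apply: eq_bigr => p _; exact: gf.
Qed.

End Tensor.

(* A vector space with a real-valued (semi)norm. Only the seminorm axioms are
   recorded, so that the projective, injective and dual norms below can be
   formed without Hahn-Banach. *)
Record seminormed (R : realType) (F : base_field) := Seminormed {
  carrier :> lmodType (scalar_field R F);
  snorm : carrier -> R;
  snorm_ge0 : forall x, 0 <= snorm x;
  ler_snormD : forall x y, snorm (x + y) <= snorm x + snorm y;
  ler_snormZ : forall a x, snorm (a *: x) <= modulus a * snorm x }.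

Arguments snorm {R F s}.
Arguments snorm_ge0 {R F s}.

Section Seminormed.
Variables (R : realType) (F : base_field).
Local Notation K := (scalar_field R F).
Local Notation seminormed := (seminormed R F).

Lemma snormZ (X : seminormed) a (x : X) : snorm (a *: x) = modulus a * snorm x.
Proof.
have modV (b : K) : b != 0 -> modulus b * modulus b^-1 = 1.
  by move=> b0; rewrite -modulusM divff// /modulus normr1 re1.
apply/le_anti; rewrite ler_snormZ/=.
have [->|a0] := eqVneq a 0; first by rewrite modulus0 mul0r snorm_ge0.
rewrite -[X in modulus a * snorm X](scalerK a0).
rewrite (le_trans (ler_wpM2l (modulus_ge0 _) (ler_snormZ _ _)))//.
by rewrite mulrA modV// mul1r.
Qed.

Section OfNormed.
Variable X : normedModType K.

Definition normed_snorm (x : X) : R := re `|x|.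

Fact normed_snorm_ge0 x : 0 <= normed_snorm x.
Proof. by rewrite -(re0 R F) ler_re. Qed.

Fact normed_snormD x y :
  normed_snorm (x + y) <= normed_snorm x + normed_snorm y.
Proof. by rewrite -reD ler_re// ler_normD. Qed.

Fact normed_snormZ a x : normed_snorm (a *: x) <= modulus a * normed_snorm x.
Proof. by rewrite /normed_snorm normrZ reM. Qed.

Definition of_normed : seminormed :=
  Seminormed normed_snorm_ge0 normed_snormD normed_snormZ.

End OfNormed.

Definition unit_ball (X : seminormed) : set X := [set x | snorm x <= 1].

Definition bounded_op (X Y : seminormed) (f : X -> Y) : Prop :=
  exists M : R, forall x, snorm (f x) <= M * snorm x.

Definition opnorm (X Y : seminormed) (f : X -> Y) : \bar R :=
  ereal_sup [set (snorm (f x))%:E | x in @unit_ball X].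

Section Dual.
Variable X : seminormed.

Definition dual_pred : {pred X -> K^o} :=
  [pred f : X -> K^o | `[< linear f /\
    exists M : R, forall x, modulus (f x) <= M * snorm x >]].

Fact dual_submod : submod_closed dual_pred.
Proof.
split=> [|a f g /asboolP[lf [M fM]] /asboolP[lg [N gN]]].
  apply/asboolP; split; last first.
    by exists 0 => x; rewrite mul0r modulus0.
  by move=> a x y; rewrite /= scaler0 addr0.
apply/asboolP; split.
  move=> b x y; rewrite !fctE lf lg !scalerDr !scalerA addrACA.
  by rewrite [a * b]mulrC.
exists (modulus a * M + N) => x.
rewrite mulrDl (le_trans (modulusD _ _))// lerD// -mulrA modulusM.
by rewrite ler_wpM2l ?modulus_ge0.
Qed.

HB.instance Definition _ := GRing.isSubmodClosed.Build _ _ dual_pred dual_submod.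

Record dual_type := DualType {
  dual_fun :> X -> K^o;
  _ : dual_fun \in dual_pred }.

HB.instance Definition _ := [isSub for dual_fun].
HB.instance Definition _ := [Choice of dual_type by <:].
HB.instance Definition _ := [SubChoice_isSubLmodule of dual_type by <:].

Implicit Types f g : dual_type.

Lemma dual_linear f : linear (f : X -> K^o).
Proof. by case: f => f /= /asboolP[]. Qed.

Lemma dual_bounded f : exists M : R, forall x, modulus (f x) <= M * snorm x.
Proof. by case: f => f /= /asboolP[]. Qed.

Definition dual_norm f : R := sup [set modulus (f x) | x in @unit_ball X].

Lemma snorm0 (Y : seminormed) : snorm (0 : Y) = 0.
Proof. by rewrite -(scale0r 0) snormZ modulus0 mul0r. Qed.

Lemma dual_norm_has_sup f : has_sup [set modulus (f x) | x in @unit_ball X].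
Proof.
split; first by exists (modulus (f 0)), 0 => //=; rewrite /unit_ball/= snorm0.
have [M fM] := dual_bounded f; exists `|M| => _ [x x1 <-].
rewrite (le_trans (fM x))// (le_trans (ler_norm _))// normrM.
by rewrite (ger0_norm (snorm_ge0 _)) ler_piMr.
Qed.

Lemma ler_dual_norm f x : snorm x <= 1 -> modulus (f x) <= dual_norm f.
Proof. by move=> x1; apply: (sup_upper_bound (dual_norm_has_sup f)); exists x. Qed.

Fact dual_norm_le f M :
  (forall x, snorm x <= 1 -> modulus (f x) <= M) -> dual_norm f <= M.
Proof.
move=> fM; apply: sup_le_ub; first by have [] := dual_norm_has_sup f.
by move=> _ [x x1 <-]; exact: fM.
Qed.

Fact dual_norm_ge0 f : 0 <= dual_norm f.
Proof.
by rewrite (le_trans (modulus_ge0 (f 0)))// ler_dual_norm// snorm0.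
Qed.

Fact dual_normD f g : dual_norm (f + g) <= dual_norm f + dual_norm g.
Proof.
apply: dual_norm_le => x x1.
by rewrite (le_trans (modulusD _ _))// lerD// ler_dual_norm.
Qed.

Fact dual_normZ a f : dual_norm (a *: f) <= modulus a * dual_norm f.
Proof.
apply: dual_norm_le => x x1.
by rewrite modulusM ler_wpM2l ?modulus_ge0// ler_dual_norm.
Qed.

Definition dual : seminormed :=
  @Seminormed R F dual_type dual_norm dual_norm_ge0 dual_normD dual_normZ.

Lemma ler_dual (f : dual) x : modulus (f x) <= snorm f * snorm x.
Proof.
have := snorm_ge0 x; rewrite le_eqVlt => /predU1P[x0|x0].
  have [M fM] := dual_bounded f.
  by rewrite (le_trans (fM x))// -x0 !mulr0.
have [c cx] := modulus_surj F (ltW x0).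
have c0 : c != 0.
  by apply: contra_ltN x0 => /eqP c0; rewrite -cx c0 modulus0.
have mcV : modulus c^-1 = (snorm x)^-1.
  apply: (mulfI (lt0r_neq0 x0)); rewrite -{1}cx -modulusM divff//.
  by rewrite divff ?gt_eqF// /modulus normr1 re1.
have : modulus (f (c^-1 *: x)) <= dual_norm f.
  by rewrite ler_dual_norm// snormZ mcV mulVf ?gt_eqF.
have -> : f (c^-1 *: x) = c^-1 * f x :> K.
  exact: (scalable_linear (@dual_linear f)).
by rewrite modulusM mcV mulrC ler_pdivrMr.
Qed.

End Dual.

Section Adjoint.
Variables (X Y : seminormed) (f : {linear X -> Y}) (bf : bounded_op f).

Fact adjoint_subproof (g : dual Y) : (g \o f : X -> K^o) \in @dual_pred X.
Proof.
apply/asboolP; split.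
  by move=> a x y; rewrite /= linearP dual_linear.
have [M fM] := bf; exists (snorm g * M) => x /=.
by rewrite (le_trans (ler_dual g _))// -mulrA ler_wpM2l ?snorm_ge0.
Qed.

Definition adjoint (g : dual Y) : dual X := DualType (adjoint_subproof g).

End Adjoint.

Section TensorNorms.
Variables X Y : seminormed.
Local Notation T := (tensor X Y).

Definition proj_costs (z : T) : set R :=
  [set \sum_(p <- s) snorm p.1 * snorm p.2 |
     s in [set s : seq (X * Y) | z = \sum_(p <- s) elem_tensor p.1 p.2]].

Definition proj_norm (z : T) : R := inf (proj_costs z).

Fact proj_costs_inf z : has_inf (proj_costs z).
Proof.
split; first by have [s zs] := tensor_sum_elem z; eexists; exists s.
by exists 0 => _ [s _ <-]; apply: sumr_ge0 => p _; rewrite mulr_ge0 ?snorm_ge0.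
Qed.

Lemma proj_norm_le z (s : seq (X * Y)) :
  z = \sum_(p <- s) elem_tensor p.1 p.2 ->
  proj_norm z <= \sum_(p <- s) snorm p.1 * snorm p.2.
Proof.
move=> zs; apply: inf_lbound; first by have [] := proj_costs_inf z.
by exists s.
Qed.

Fact proj_norm_ge0 z : 0 <= proj_norm z.
Proof.
apply: lb_le_inf; first by have [] := proj_costs_inf z.
by move=> _ [s _ <-]; apply: sumr_ge0 => p _; rewrite mulr_ge0 ?snorm_ge0.
Qed.

Fact proj_normD z w : proj_norm (z + w) <= proj_norm z + proj_norm w.
Proof.
rewrite -lerBlDr; apply: lb_le_inf; first by have [] := proj_costs_inf z.
move=> _ [s zs <-]; rewrite lerBlDr -lerBlDl.
apply: lb_le_inf; first by have [] := proj_costs_inf w.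
move=> _ [t wt <-]; rewrite lerBlDl -big_cat; apply: proj_norm_le.
by rewrite big_cat /= -zs -wt.
Qed.

Fact proj_normZ a z : proj_norm (a *: z) <= modulus a * proj_norm z.
Proof.
have le s : z = \sum_(p <- s) elem_tensor p.1 p.2 ->
    proj_norm (a *: z) <= modulus a * \sum_(p <- s) snorm p.1 * snorm p.2.
  move=> zs; rewrite mulr_sumr.
  under eq_bigr do rewrite mulrA -snormZ.
  pose h (p : X * Y) := (a *: p.1, p.2).
  rewrite -[leRHS](big_map h predT (fun p => snorm p.1 * snorm p.2)).
  apply: proj_norm_le; rewrite zs scaler_sumr big_map; apply: eq_bigr => p _.
  exact/esym/(scalable_linear ((elem_tensor_bilinear X Y).1 p.2)).
have := modulus_ge0 a; rewrite le_eqVlt => /predU1P[a0|a0].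
  have [s zs] := tensor_sum_elem z.
  by rewrite (le_trans (le s zs))// -a0 !mul0r.
rewrite -ler_pdivrMl//; apply: lb_le_inf; first by have [] := proj_costs_inf z.
by move=> _ [s zs <-]; rewrite ler_pdivrMl// le.
Qed.

Definition tensor_proj : seminormed :=
  @Seminormed R F T proj_norm proj_norm_ge0 proj_normD proj_normZ.

(* The functional alpha (x) beta on the tensor product. *)
Definition tensor_pairing (alpha : dual X) (beta : dual Y) : T -> K :=
  tensor_lift (fun x y => alpha x * beta y : K^o).

Definition inj_values (z : T) : set R :=
  [set r | exists (alpha : dual X) (beta : dual Y),
     [/\ unit_ball alpha, unit_ball beta &
         r = modulus (tensor_pairing alpha beta z)]].

Definition inj_norm (z : T) : R := sup (inj_values z).

Lemma tensor_pairing_bilinear (alpha : dual X) (beta : dual Y) :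
  bilinear_for *:%R *:%R (fun x y => alpha x * beta y : K^o).
Proof.
split=> [y|x] a u v; rewrite dual_linear.
- by rewrite mulrDl -scalerAl.
- by rewrite mulrDr -scalerAr.
Qed.

Lemma tensor_pairing_linear (alpha : dual X) (beta : dual Y) :
  linear (tensor_pairing alpha beta : T -> K^o).
Proof. exact/tensor_lift_linear/tensor_pairing_bilinear. Qed.

Lemma unit_ball0 (Z : seminormed) : unit_ball (0 : Z).
Proof. by rewrite /unit_ball /= snorm0. Qed.

Fact inj_values_sup z : has_sup (inj_values z).
Proof.
split.
  by eexists; exists 0, 0; split; [exact: unit_ball0|exact: unit_ball0|].
have [s ->] := tensor_sum_elem z.
exists (\sum_(p <- s) snorm p.1 * snorm p.2) => _ [alpha [beta [a1 b1 ->]]].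
rewrite -tensor_of_sumE /tensor_pairing tensor_lift_sum; last first.
  exact: tensor_pairing_bilinear.
rewrite (le_trans (modulus_sum _ _))//; apply: ler_sum => p _.
rewrite modulusM ler_pM ?modulus_ge0//.
- by rewrite (le_trans (ler_dual _ _))// ler_piMl ?snorm_ge0.
- by rewrite (le_trans (ler_dual _ _))// ler_piMl ?snorm_ge0.
Qed.

Lemma inj_norm_ge z (alpha : dual X) (beta : dual Y) :
  unit_ball alpha -> unit_ball beta ->
  modulus (tensor_pairing alpha beta z) <= inj_norm z.
Proof.
move=> a1 b1; apply: (sup_upper_bound (inj_values_sup z)).
by exists alpha, beta.
Qed.

Lemma inj_norm_le z M :
  (forall (alpha : dual X) (beta : dual Y),
     unit_ball alpha -> unit_ball beta ->
     modulus (tensor_pairing alpha beta z) <= M) ->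
  inj_norm z <= M.
Proof.
move=> zM; apply: sup_le_ub; first by have [] := inj_values_sup z.
by move=> _ [alpha [beta [a1 b1 ->]]]; exact: zM.
Qed.

Fact inj_norm_ge0 z : 0 <= inj_norm z.
Proof.
apply: le_trans (modulus_ge0 (tensor_pairing 0 0 z)) _.
by apply: inj_norm_ge; exact: unit_ball0.
Qed.

Fact inj_normD z w : inj_norm (z + w) <= inj_norm z + inj_norm w.
Proof.
apply: inj_norm_le => alpha beta a1 b1.
rewrite -[z]scale1r tensor_pairing_linear scale1r.
by rewrite (le_trans (modulusD _ _))// scale1r lerD// inj_norm_ge.
Qed.

Fact inj_normZ a z : inj_norm (a *: z) <= modulus a * inj_norm z.
Proof.
apply: inj_norm_le => alpha beta a1 b1.
have -> : tensor_pairing alpha beta (a *: z) = a * tensor_pairing alpha beta z.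
  exact: (scalable_linear (@tensor_pairing_linear alpha beta)).
by rewrite modulusM ler_wpM2l ?modulus_ge0// inj_norm_ge.
Qed.

Definition tensor_inj : seminormed :=
  @Seminormed R F T inj_norm inj_norm_ge0 inj_normD inj_normZ.

End TensorNorms.

(* [inj_pow X n] and [proj_pow X n] are the (n+1)-fold tensor powers of X. *)
Fixpoint inj_pow (X : seminormed) (n : nat) : seminormed :=
  if n is m.+1 then tensor_inj (inj_pow X m) X else X.

Fixpoint proj_pow (X : seminormed) (n : nat) : seminormed :=
  if n is m.+1 then tensor_proj (proj_pow X m) X else X.

Definition tensor_map (X Y X' Y' : lmodType K) (f : X -> X') (g : Y -> Y') :
    tensor X Y -> tensor X' Y' :=
  tensor_lift (fun x y => elem_tensor (f x) (g y)).

(* The (n+1)-fold tensor power of f. *)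
Fixpoint op_pow (X Y : seminormed) (f : X -> Y) (n : nat) :
    inj_pow X n -> proj_pow Y n :=
  match n return inj_pow X n -> proj_pow Y n with
  | 0 => f
  | m.+1 => tensor_map (@op_pow X Y f m) f
  end.

Lemma tensor_map_bilinear (X Y X' Y' : lmodType K) (f : X -> X') (g : Y -> Y') :
  linear f -> linear g ->
  bilinear_for *:%R *:%R (fun x y => elem_tensor (f x) (g y)).
Proof.
move=> lf lg; split=> [y|x] a u v; rewrite ?lf ?lg.
- exact: ((elem_tensor_bilinear X' Y').1 (g y) a (f u) (f v)).
- exact: ((elem_tensor_bilinear X' Y').2 (f x) a (g u) (g v)).
Qed.

Lemma op_pow_linear (X Y : seminormed) (f : X -> Y) n :
  linear f -> linear (@op_pow X Y f n).
Proof.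
move=> lf; elim: n => [//|n ih].
exact/tensor_lift_linear/tensor_map_bilinear.
Qed.

Lemma op_powS_elem (X Y : seminormed) (f : X -> Y) n (z : inj_pow X n) x :
  linear f ->
  @op_pow X Y f n.+1 (elem_tensor z x) = elem_tensor (@op_pow X Y f n z) (f x).
Proof.
move=> lf; apply: tensor_lift_elem; apply: tensor_map_bilinear => //.
exact: op_pow_linear.
Qed.

Section TwoSumming.
Variables (X Y : seminormed) (f : X -> Y).

Definition weak_l2 (s : seq X) : R :=
  sup [set Num.sqrt (\sum_(x <- s) modulus (g x) ^+ 2) | g in @unit_ball (dual X)].

Definition strong_l2 (s : seq Y) : R :=
  Num.sqrt (\sum_(y <- s) snorm y ^+ 2).

Definition summing_bound (C : R) : Prop :=
  0 <= C /\ forall s : seq X, strong_l2 (map f s) <= C * weak_l2 s.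

Definition two_summing : Prop := exists C, summing_bound C.

Definition pi2 : \bar R := ereal_inf [set C%:E | C in summing_bound].

End TwoSumming.

End Seminormed.

Arguments of_normed {R F}.
Arguments dual {R F}.
Arguments inj_pow {R F}.
Arguments proj_pow {R F}.

Section TwoDominated.
Variables (R : realType) (F : base_field).
Local Notation K := (scalar_field R F).
Local Notation Banach := (completeNormedModType K).

Definition hilbert (H : Banach) : Prop :=
  exists ip : {dot H for @conjs R F}, forall x, `|x| ^+ 2 = ip x x.

(* The factorization phi = phi2 phi1 through H witnesses 2-dominatedness. *)
Definition dominated_factorization (X Y : Banach) (phi : X -> Y) (H : Banach)
    (phi1 : {linear of_normed X -> of_normed H})
    (phi2 : {linear of_normed H -> of_normed Y})
    (bphi2 : bounded_op phi2) : Prop :=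
  [/\ hilbert H, bounded_op phi1, (forall x, phi x = phi2 (phi1 x)),
      two_summing phi1 & two_summing (adjoint bphi2)].

Definition two_dominated (X Y : Banach) (phi : X -> Y) : Prop :=
  exists (H : Banach) (phi1 : {linear of_normed X -> of_normed H})
         (phi2 : {linear of_normed H -> of_normed Y}) (bphi2 : bounded_op phi2),
    dominated_factorization phi phi1 bphi2.

Definition gamma2_star (X Y : Banach) (phi : X -> Y) : \bar R :=
  ereal_inf [set t |
    exists (H : Banach) (phi1 : {linear of_normed X -> of_normed H})
           (phi2 : {linear of_normed H -> of_normed Y})
           (bphi2 : bounded_op phi2),
      dominated_factorization phi phi1 bphi2 /\
      t = (pi2 phi1 * pi2 (adjoint bphi2))%E].

(* The norm of the k-fold power, for k >= 1; the value at k = 0 is that at 1. *)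
Definition eps_pi_norm (X Y : Banach) (phi : X -> Y) (k : nat) : \bar R :=
  opnorm (@op_pow R F (of_normed X) (of_normed Y) phi k.-1).

End TwoDominated.

(* Main.v *)
From HB Require Import structures.
Require Import Defs.
From mathcomp Require Import all_boot all_order all_algebra.
From mathcomp Require Import all_classical all_reals all_analysis.
From mathcomp Require Import complex.
From mathcomp Require Import ring lra.

Set Implicit Arguments.
Unset Strict Implicit.
Unset Printing Implicit Defensive.

Import Order.TTheory GRing.Theory Num.Theory.
Import numFieldNormedType.Exports.

Local Open Scope classical_set_scope.
Local Open Scope ring_scope.

(** Upper bound. Let phi = phi2 phi1 factor through a Hilbert space H, with phi1
    and the adjoint of phi2 2-summing with constants C1 and C2. A tensor involves
    finitely many vectors, so H may be replaced by coordinates in an orthonormal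
    family, and the k-th power of phi goes from the injective norm to the l_2 norm
    of coordinates and on to the projective norm. A 2-summing map X -> H tensored
    with the identity of a Hilbert space H' is bounded by its 2-summing constant
    from the injective to the Hilbertian norm: on the orthonormal basis of H'
    this is the definition of 2-summing. Treating one factor at a time, the
    first half has norm at most C1^k ([inj_to_l2]); the second half is the dual
    statement, with norm at most C2^k ([l2_to_proj]). So every term of the
    sequence is at most gamma_2^* (phi), see [dominated_op_pow_le].

    Lower bound. Let x_j in X and y_j in Y^* be finite families with weak l_2
    norms W and V, and let t be the modulus of sum_j y_j (phi x_j). For random
    signs e indexed by multi-indices, pairing the image under the k-th power of
    phi of sum_I e_I x_I with sum_I e_I y_I gives on average the k-th power of
    the trace. The injective norm of sum_I e_I x_I is at most W^k times
    that of e as a tensor over l_2, and dually for y, V and the dual of the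
    projective norm. The square of the injective norm of e
    is at most c rho^k on average for every rho > 1: it is nearly attained on
    exponentially many elementary tensors, at each of which it is a Rademacher sum
    with subgaussian tails ([random_signs]). Hence t^k <= N (W V)^k c rho^k for
    the norm N of the k-th power of phi ([trace_le_op_pow]), and the lower limit
    of the sequence is at least t / (W V) whenever W V > 0.

    Duality. It remains to see that gamma_2^* (phi) <= C if t <= C W V for all
    such families. This is the argument of Pietsch and Kwapien. The inequality
    says that the functions C (sum |f x_j|^2 + sum |g y_j|^2) - 2 Re sum y_j (phi
    x_j) of functionals f and g in the dual unit balls have nonnegative suprema;
    they form a cone, so Hahn-Banach provides a finitely additive mean that is
    nonnegative on it ([mean_nonneg_on_cone]). The means of |f x|^2 and |g y|^2
    are squares of Hilbertian seminorms p and q, 2-summing with constant 1, and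
    |y (phi x)| <= C p(x) q(y) ([hilbertian_domination]). The map phi then factors
    through the Hilbert completion of X for p ([pietsch_factorization]). *)

(** * Real and complex scalars on the same footing *)

Section Scalars.
Variables (R : realType) (F : base_field).
Local Notation K := (scalar_field R F).
Implicit Types (a b : K) (r s : R).

Definition emb : R -> K :=
  match F return R -> scalar_field R F with
  | Reals => id | Complexes => fun r => r%:C%C end.

Definition im : K -> R :=
  match F return scalar_field R F -> R with
  | Reals => fun=> 0 | Complexes => @complex.Im R end.

(** The scalar with real part [r] and imaginary part [s]; the latter is lost over
    the reals, so statements about [im (mk r s)] assume that it vanishes there. *)
Definition mk (r s : R) : K :=
  match F return scalar_field R F with
  | Reals => r | Complexes => (r +i* s)%C end.

Lemma scalar_ext a b : re a = re b -> im a = im b -> a = b.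
Proof. by rewrite /im; case: F a b => [//|] [? ?] [? ?] /= -> ->. Qed.

Lemma re_mk r s : re (mk r s) = r. Proof. by rewrite /mk; case: F. Qed.

Lemma im_mk r s : (F = Reals -> s = 0) -> im (mk r s) = s.
Proof. by rewrite /mk /im; case: F => //= ->. Qed.

Lemma im_Reals a : F = Reals -> im a = 0.
Proof. by rewrite /im; case: F a. Qed.

Fact re_zmod_morphism : zmod_morphism (@re R F).
Proof. by case: F => //= -[? ?] [? ?]. Qed.
HB.instance Definition _ := GRing.isZmodMorphism.Build K R (@re R F) re_zmod_morphism.

Fact im_zmod_morphism : zmod_morphism im.
Proof. by rewrite /im; case: F => [a b|[? ?] [? ?]] //=; rewrite subr0. Qed.
HB.instance Definition _ := GRing.isZmodMorphism.Build K R im im_zmod_morphism.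

Fact emb_zmod_morphism : zmod_morphism emb.
Proof.
by rewrite /emb; case: F => //= r s; rewrite -raddfB.
Qed.
HB.instance Definition _ := GRing.isZmodMorphism.Build R K emb emb_zmod_morphism.
Fact emb_monoid_morphism : monoid_morphism emb.
Proof.
by rewrite /emb; case: F => //=; split=> // r s; rewrite rmorphM.
Qed.
HB.instance Definition _ := GRing.isMonoidMorphism.Build R K emb emb_monoid_morphism.

Lemma re_emb r : re (emb r) = r. Proof. by rewrite /emb; case: F. Qed.
Lemma im_emb r : im (emb r) = 0. Proof. by rewrite /emb /im; case: F. Qed.

Fact conjs_zmod_morphism : zmod_morphism (@conjs R F).
Proof. by rewrite /conjs; case: F => //= a b; rewrite rmorphB. Qed.
HB.instance Definition _ :=
  GRing.isZmodMorphism.Build K K (@conjs R F) conjs_zmod_morphism.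
Fact conjs_monoid_morphism : monoid_morphism (@conjs R F).
Proof.
by rewrite /conjs; case: F => //=; split=> // [|a b]; rewrite ?rmorph1 ?rmorphM.
Qed.
HB.instance Definition _ :=
  GRing.isMonoidMorphism.Build K K (@conjs R F) conjs_monoid_morphism.

Lemma re_conjs a : re (conjs a) = re a.
Proof. by case: F a => //= -[]. Qed.
Lemma im_conjs a : im (conjs a) = - im a.
Proof. by rewrite /im; case: F a => [|[]//] /= a; rewrite oppr0. Qed.
Lemma conjsK : involutive (@conjs R F).
Proof. by case: F => //= a; rewrite conjcK. Qed.
Lemma conjs_emb r : conjs (emb r) = emb r.
Proof. by apply: scalar_ext; rewrite ?re_conjs// im_conjs im_emb oppr0. Qed.

Lemma reMul a b : re (a * b) = re a * re b - im a * im b.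
Proof. by rewrite /im; case: F a b => [a b|[? ?] [? ?]] //=; rewrite mulr0 subr0. Qed.
Lemma imMul a b : im (a * b) = re a * im b + im a * re b.
Proof. by rewrite /im; case: F a b => [a b|[? ?] [? ?]] //=; rewrite mulr0 mul0r addr0. Qed.
Lemma re_embM r a : re (emb r * a) = r * re a.
Proof. by rewrite reMul re_emb im_emb mul0r subr0. Qed.
Lemma im_embM r a : im (emb r * a) = r * im a.
Proof. by rewrite imMul re_emb im_emb mul0r addr0. Qed.

Lemma modulus_emb r : modulus (emb r) = `|r|.
Proof.
rewrite /modulus /emb; case: F => //=.
by rewrite expr0n addr0 sqrtr_sqr.
Qed.

Lemma normE a : `|a| = emb (modulus a).
Proof.
by rewrite /modulus /emb; case: F a => //= a; exact: normc_def.
Qed.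

Lemma modulus_sqr a : modulus a ^+ 2 = re a ^+ 2 + im a ^+ 2.
Proof.
rewrite /modulus /im; case: F a => [a|[x y]] /=.
  by rewrite expr0n addr0 real_normK// num_real.
by rewrite sqr_sqrtr// addr_ge0// sqr_ge0.
Qed.

Lemma mul_conjs a : a * conjs a = emb (modulus a ^+ 2).
Proof.
apply: scalar_ext; rewrite ?reMul ?imMul ?re_conjs ?im_conjs ?re_emb ?im_emb.
  by rewrite modulus_sqr; ring.
by ring.
Qed.

Lemma modulus_eq a b : modulus a ^+ 2 = modulus b ^+ 2 -> modulus a = modulus b.
Proof. by move/eqP; rewrite eqrXn2 ?modulus_ge0// => /eqP. Qed.

Lemma modulus_conjs a : modulus (conjs a) = modulus a.
Proof. by apply: modulus_eq; rewrite !modulus_sqr re_conjs im_conjs sqrrN. Qed.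

Lemma modulus1 : modulus (1 : K) = 1.
Proof. by rewrite /modulus normr1 re1. Qed.

Lemma modulusN a : modulus (- a) = modulus a.
Proof. by rewrite /modulus normrN. Qed.

Lemma modulusB a b : modulus (a - b) = modulus (b - a).
Proof. by rewrite -opprB modulusN. Qed.

Lemma modulus0_eq0 a : modulus a = 0 -> a = 0.
Proof.
by move=> a0; apply/eqP; rewrite -normr_eq0 normE a0 raddf0.
Qed.

Lemma modulusX a n : modulus (a ^+ n) = modulus a ^+ n.
Proof.
by elim: n => [|n ih]; rewrite ?expr0 ?modulus1// !exprS modulusM ih.
Qed.

Lemma re_le_modulus a : `|re a| <= modulus a.
Proof.
by rewrite -ler_sqr ?nnegrE ?modulus_ge0// real_normK ?num_real// modulus_sqr lerDl sqr_ge0.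
Qed.

Lemma im_le_modulus a : `|im a| <= modulus a.
Proof.
by rewrite -ler_sqr ?nnegrE ?modulus_ge0// real_normK ?num_real// modulus_sqr lerDr sqr_ge0.
Qed.

Lemma modulus_le_reim a : modulus a <= `|re a| + `|im a|.
Proof.
rewrite -ler_sqr ?nnegrE ?modulus_ge0 ?addr_ge0// modulus_sqr sqrrD.
rewrite !real_normK ?num_real// lerD2r lerDl mulrn_wge0// mulr_ge0//.
Qed.

Lemma ge0_scalar a : (0 <= a) = (im a == 0) && (0 <= re a).
Proof.
by rewrite /im; case: F a => [a|[x y]] /=; rewrite ?eqxx// lecE/= eq_sym.
Qed.

Lemma ler_emb : {mono emb : r s / r <= s}.
Proof.
by move=> r s; rewrite -subr_ge0 -raddfB ge0_scalar re_emb im_emb eqxx subr_ge0.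
Qed.

Lemma phase a : exists2 u : K, modulus u = 1 & u * a = emb (modulus a).
Proof.
have [->|a0] := eqVneq a 0.
  by exists 1; rewrite ?modulus1// mulr0 modulus0 raddf0.
have m0 : modulus a != 0 by apply: contra_neq a0; exact: modulus0_eq0.
exists (emb (modulus a)^-1 * conjs a).
  rewrite modulusM modulus_conjs modulus_emb ger0_norm ?invr_ge0 ?modulus_ge0//.
  by rewrite mulVf.
by rewrite -mulrA [conjs a * a]mulrC mul_conjs -rmorphM expr2 mulKf.
Qed.

End Scalars.
Arguments emb {R F}.
Arguments im {R F}.
Arguments mk {R F}.
(** * The Hahn-Banach theorem *)

Section Sublinear.
Variables (R : realType) (V : lmodType R).
Implicit Types (p q s : V -> R) (x y : V).

Definition sublinear p :=
  (forall x y, p (x + y) <= p x + p y) /\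
  (forall t x, 0 < t -> p (t *: x) <= t * p x).

Lemma sublinear0 p : sublinear p -> p 0 = 0.
Proof.
move=> [_ pZ]; apply/le_anti/andP; split.
- by have := pZ 2^-1 0; rewrite scaler0 => /(_ ltac:(lra)); lra.
- by have := pZ 2 0; rewrite scaler0 => /(_ ltac:(lra)); lra.
Qed.

Lemma sublinearZ p t x : sublinear p -> 0 < t -> p (t *: x) = t * p x.
Proof.
move=> [_ pZ] t0; apply/le_anti; rewrite pZ//= -ler_pdivlMl//.
by have := pZ t^-1 (t *: x); rewrite scalerK ?gt_eqF//; apply; rewrite invr_gt0.
Qed.

Lemma sublinearN p x : sublinear p -> - p (- x) <= p x.
Proof.
move=> sp; have := sp.1 x (- x); rewrite subrr sublinear0//; lra.
Qed.

(** The infimum of a chain of sublinear functionals is sublinear, so Zorn's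
    lemma gives a minimal one below any given [s]. Minimal functionals turn out
    to be linear, which replaces the usual one-dimensional extension step. *)
Lemma minimal_sublinear s : sublinear s ->
  exists p, [/\ sublinear p, forall x, p x <= s x &
    forall q, sublinear q -> (forall x, q x <= p x) -> forall x, p x <= q x].
Proof.
move=> ss.
pose T := {p : V -> R | sublinear p /\ forall x, p x <= s x}.
pose r (p q : T) : bool := `[< forall x, sval q x <= sval p x >].
pose s0 : T := exist _ s (conj ss (fun x => lexx (s x))).
have [|p q t /asboolP pq /asboolP qt|A totA|[p [sp ps]] pmin] :=
    @ZL_preorder T s0 r.
- by move=> t; apply/asboolP => x.
- by apply/asboolP => x; exact: le_trans (qt x) (pq x).
- have [A0|/set0P[a Aa]] := eqVneq A set0.
    by exists s0; rewrite A0 => t [].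
  pose B x := [set sval t x | t in A].
  have iB x : has_inf (B x).
    split; first by exists (sval a x), a.
    exists (- s (- x)) => _ [[t [st ts]] At <-] /=.
    by have := sublinearN x st; have := ts (- x); lra.
  have leB t x : A t -> inf (B x) <= sval t x.
    by move=> At; apply: ge_inf; [case: (iB x)|exists t].
  have sB : sublinear (fun x => inf (B x)).
    split=> [x y|t x t0].
      rewrite -lerBlDr; apply: lb_le_inf; first by case: (iB x).
      move=> _ [t At <-]; rewrite lerBlDr -lerBlDl.
      apply: lb_le_inf; first by case: (iB y).
      move=> _ [u Au <-]; rewrite lerBlDl.
      have [v [Av vt vu]] : exists v, [/\ A v, forall x, sval v x <= sval t x
          & forall x, sval v x <= sval u x].
        have [/asboolP tu|/asboolP ut] := totA _ _ At Au.
          by exists u; split.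
        by exists t; split.
      rewrite (le_trans (leB v _ Av))// (le_trans ((svalP v).1.1 _ _))//.
      by rewrite lerD.
    rewrite -ler_pdivrMl//; apply: lb_le_inf; first by case: (iB x).
    move=> _ [u Au <-]; rewrite ler_pdivrMl// -(sublinearZ _ (svalP u).1)//.
    exact: leB.
  have Bs x : inf (B x) <= s x.
    by rewrite (le_trans (leB a x Aa))//; exact: (svalP a).2.
  exists (exist _ (fun x => inf (B x)) (conj sB Bs) : T) => t At; apply/asboolP => x /=; exact: leB.
- exists p; split=> // q sq qp.
  have qs x : q x <= s x by exact: le_trans (qp x) (ps x).
  have := pmin (exist _ q (conj sq qs) : T).
  by move=> /(_ _)/asboolP /=; apply; apply/asboolP.
Qed.

Definition slide p x0 x : R := inf [set p (x + t *: x0) - t * p x0 | t in [set t | 0 <= t]].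

(** Sliding along [x0] makes a sublinear functional odd at [x0]. A minimal
    functional is fixed by every slide, so it is odd, hence linear. *)
Lemma slide_sublinear p x0 : sublinear p ->
  [/\ sublinear (slide p x0), forall x, slide p x0 x <= p x &
      slide p x0 (- x0) <= - p x0].
Proof.
move=> sp.
have iS x : has_inf [set p (x + t *: x0) - t * p x0 | t in [set t | 0 <= t]].
  split; first by eexists; exists 0 => /=.
  exists (- p (- x)) => _ [t /= t0 <-].
  have -> : t * p x0 = p (t *: x0).
    move: t0; rewrite le_eqVlt => /predU1P[<-|t0]; last by rewrite sublinearZ.
    by rewrite mul0r scale0r sublinear0.
  by have := sp.1 (x + t *: x0) (- x); rewrite addrC addKr; lra.
have leS t x : 0 <= t -> slide p x0 x <= p (x + t *: x0) - t * p x0.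
  by move=> t0; apply: ge_inf; [case: (iS x)|exists t].
split=> [|x|].
- split=> [x y|c x c0].
    rewrite -lerBlDr; apply: lb_le_inf; first by case: (iS x).
    move=> _ [t t0 <-]; rewrite lerBlDr -lerBlDl.
    apply: lb_le_inf; first by case: (iS y).
    move=> _ [u u0 <-]; rewrite lerBlDl.
    rewrite (le_trans (leS (t + u) _ _)) ?addr_ge0//.
    rewrite scalerDl addrACA.
    by have := sp.1 (x + t *: x0) (y + u *: x0); lra.
  rewrite -ler_pdivrMl//; apply: lb_le_inf; first by case: (iS x).
  move=> _ [t /= t0 <-]; rewrite ler_pdivrMl//.
  apply: (le_trans (leS (c * t) _ _)); first by rewrite mulr_ge0// ltW.
  by rewrite -scalerA -scalerDr sublinearZ// mulrBr mulrA.
- by have := leS 0 x (lexx _); rewrite scale0r addr0 mul0r subr0.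
- by have := leS 1 (- x0) ler01; rewrite scale1r addNr sublinear0// mul1r sub0r.
Qed.

(** Starting from [slide s x0] rather than from [s] forces the linear functional
    to attain the value of [s] at [x0]. *)
Lemma hahn_banach s x0 : sublinear s ->
  exists l : {linear V -> R^o}, (forall x, l x <= s x) /\ l x0 = s x0.
Proof.
move=> ss; have [ss' s's s'x0] := slide_sublinear x0 ss.
have [p [sp ps' pmin]] := minimal_sublinear ss'.
have pN x : p (- x) = - p x.
  have [sq qp qx] := slide_sublinear x sp.
  apply/le_anti; rewrite (le_trans (pmin _ sq qp _))//=.
  by have := sublinearN x sp; lra.
have pD x y : p (x + y) = p x + p y.
  apply/le_anti; rewrite sp.1//=.
  by have := sp.1 (x + y) (- y); rewrite addrK pN; lra.
have pl : linear (p : V -> R^o).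
  move=> a x y; rewrite pD; congr (_ + _).
  have [a0|a0|->] := ltgtP a 0; last by rewrite !scale0r sublinear0.
  - rewrite -[a]opprK scaleNr pN sublinearZ ?oppr_gt0//.
    by rewrite -mulNr.
  - exact: sublinearZ.
pose l := GRing.isLinear.Build _ _ _ _ (p : V -> R^o) pl.
pose L : {linear V -> R^o} := HB.pack (p : V -> R^o) l.
exists L; split=> [x|] /=; first exact: le_trans (ps' x) (s's x).
apply/le_anti; rewrite (le_trans (ps' _) (s's _))/=.
by have := ps' (- x0); rewrite pN; lra.
Qed.

End Sublinear.

Definition realify (R : realType) (F : base_field)
  (V : lmodType (scalar_field R F)) : Type := V.

Section Realify.
Variables (R : realType) (F : base_field) (V : lmodType (scalar_field R F)).
HB.instance Definition _ := GRing.Zmodule.on (realify V).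
Let sc (r : R) (x : realify V) : realify V := emb r *: (x : V).
Fact realify_scaleA a b x : sc a (sc b x) = sc (a * b) x.
Proof. by rewrite /sc rmorphM scalerA. Qed.
Fact realify_scale1 : left_id 1 sc.
Proof. by move=> x; rewrite /sc rmorph1 scale1r. Qed.
Fact realify_scaleDr : right_distributive sc +%R.
Proof. by move=> a x y; rewrite /sc scalerDr. Qed.
Fact realify_scaleDl x : {morph sc^~ x : a b / a + b}.
Proof. by move=> a b; rewrite /sc raddfD scalerDl. Qed.
HB.instance Definition _ := GRing.Zmodule_isLmodule.Build R (realify V)
  realify_scaleA realify_scale1 realify_scaleDr realify_scaleDl.
Lemma realify_scaleE (r : R) (x : realify V) : r *: x = emb r *: (x : V).
Proof. by []. Qed.
End Realify.

Section Norming.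
Variables (R : realType) (F : base_field).
Local Notation K := (scalar_field R F).

(** The classical formula l x - i l (i x), written so that it also covers real
    scalars, where [mk 0 1] is zero. *)
Lemma complexify (V : lmodType K) (l : {linear realify V -> R^o}) :
  exists2 f : V -> K^o, linear f & forall x, re (f x) = l x.
Proof.
have lZ r (x : V) : l (emb r *: x) = r * l x by exact: (linearZ_LR l r x).
have lD (x y : V) : l (x + y) = l x + l y by exact: (raddfD l x y).
pose j : K := mk 0 1.
have aE (a : K) : a = emb (re a) + emb (im a) * j.
  apply: scalar_ext; first by rewrite reD re_emb re_embM re_mk mulr0 addr0.
  rewrite raddfD /= im_emb add0r im_embM /j.
  case: (pselect (F = Reals)) => [FR|FC]; first by rewrite im_Reals// mul0r.
  by rewrite im_mk ?mulr1.
have jj (a : K) x : im a * l (j *: (j *: x)) = - (im a * l x).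
  case: (pselect (F = Reals)) => [FR|FC]; first by rewrite im_Reals// !mul0r oppr0.
  suff -> : j *: (j *: x) = emb (-1) *: x by rewrite lZ mulN1r mulrN.
  rewrite scalerA; congr (_ *: _); apply: scalar_ext.
    by rewrite reMul re_emb re_mk im_mk//; ring.
  by rewrite imMul im_emb re_mk; ring.
have lj (a : K) x : l (a *: x) = re a * l x + im a * l (j *: x).
  by rewrite [X in X *: x]aE scalerDl lD lZ -scalerA lZ.
pose f (x : V) : K^o := mk (l x) (- l (j *: x)).
have ref x : re (f x) = l x by rewrite /f re_mk.
have imf x : im (f x) = - l (j *: x).
  rewrite /f im_mk// /j => FR.
  have -> : mk 0 1 = 0 :> K by move: FR; rewrite /mk; case: (F).
  by rewrite scale0r (raddf0 l) oppr0.
exists f => // a x y; apply: scalar_ext.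
  by rewrite [RHS]reD [in RHS]reMul !ref imf lD (lj a) mulrN opprK.
have -> : im (a *: f x + f y) = im (a * f x : K) + im (f y) by exact: raddfD.
rewrite imMul !imf ref scalerDr lD.
rewrite scalerA mulrC -scalerA (lj a) jj; ring.
Qed.

(** The modulus of the functional is controlled by its real part after a rotation
    of the argument, so the real Hahn-Banach theorem suffices. *)
Lemma norming_functional (X : seminormed R F) (x0 : X) :
  exists f : dual X, unit_ball f /\ re (f x0) = snorm x0.
Proof.
have [|l [lX lx0]] :=
    @hahn_banach R (realify X) (fun x : realify X => snorm (x : X)) x0.
  split=> [x y|t x t0]; first exact: ler_snormD.
  by rewrite realify_scaleE snormZ modulus_emb gtr0_norm.
have [f lf fl] := complexify l.
have fX x : modulus (f x) <= snorm x.
  have [u u1 uf] := phase (f x).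
  have fu : f (u *: x) = u * f x by exact: (scalable_linear lf).
  have := re_emb F (modulus (f x)); rewrite -uf -fu fl => <-.
  by rewrite (le_trans (lX _))// snormZ u1 mul1r.
have fd : f \in @dual_pred R F X.
  by apply/asboolP; split=> //; exists 1 => x; rewrite mul1r.
exists (DualType fd); split; last by rewrite -lx0 -fl.
by apply: dual_norm_le => x x1; rewrite (le_trans (fX x)).
Qed.

End Norming.
(** * Square-summable families and weak l_2 norms *)

Section AmGm.
Variable R : realType.

(** Optimizing over t gives twice the geometric mean. The degenerate cases A = 0
    and B = 0 are absorbed by testing t = (b + d) / (a + d) with d > 0 small. *)
Lemma amgm_le (m A B : R) : 0 <= A -> 0 <= B ->
  (forall t, 0 < t -> 2 * m <= t * A + t^-1 * B) ->
  m <= Num.sqrt A * Num.sqrt B.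
Proof.
move=> A0 B0 h; set a := Num.sqrt A; set b := Num.sqrt B.
have a0 : 0 <= a by exact: sqrtr_ge0.
have b0 : 0 <= b by exact: sqrtr_ge0.
have aA : A = a ^+ 2 by rewrite sqr_sqrtr.
have bB : B = b ^+ 2 by rewrite sqr_sqrtr.
apply/ler_addgt0Pr => e e0.
have [d [d0 de]] : exists d, 0 < d /\ d * (a + b + d) <= e.
  exists (Num.min 1 (e / (a + b + 1))).
  have ab1 : 0 < a + b + 1 by lra.
  have D0 : 0 < Num.min 1 (e / (a + b + 1)) by rewrite lt_min ltr01 divr_gt0.
  split=> //.
  apply: (@le_trans _ _ (e / (a + b + 1) * (a + b + 1))); last by rewrite divfK// gt_eqF.
  set d := Num.min _ _ in D0 *.
  have d1 : d <= 1 by rewrite /d ge_min lexx.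
  have de : d <= e / (a + b + 1) by rewrite /d ge_min lexx orbT.
  by apply: ler_pM; lra.
have ad0 : 0 < a + d by lra.
have bd0 : 0 < b + d by lra.
have t0 : 0 < (b + d) / (a + d) by rewrite divr_gt0.
have := h _ t0; rewrite invf_div aA bB => ht.
have h1 : (b + d) / (a + d) * a ^+ 2 <= (b + d) * (a + d).
  rewrite -mulrA ler_wpM2l ?(ltW bd0)// mulrC ler_pdivrMr//; nra.
have h2 : (a + d) / (b + d) * b ^+ 2 <= (b + d) * (a + d).
  rewrite -mulrA [leRHS]mulrC ler_wpM2l ?(ltW ad0)// mulrC ler_pdivrMr//; nra.
nra.
Qed.

End AmGm.

Section L2.
Variables (R : realType) (F : base_field).
Local Notation K := (scalar_field R F).

Definition l2 (I : finType) (c : I -> K) : R :=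
  Num.sqrt (\sum_i modulus (c i) ^+ 2).

Lemma l2_ge0 (I : finType) (c : I -> K) : 0 <= l2 c.
Proof. exact: sqrtr_ge0. Qed.

Lemma l2_sqr (I : finType) (c : I -> K) : l2 c ^+ 2 = \sum_i modulus (c i) ^+ 2.
Proof. by rewrite sqr_sqrtr// sumr_ge0// => i _; rewrite sqr_ge0. Qed.

Lemma l2_le (I : finType) (c : I -> K) M :
  0 <= M -> (l2 c <= M) = (\sum_i modulus (c i) ^+ 2 <= M ^+ 2).
Proof. by move=> M0; rewrite -l2_sqr ler_sqr ?nnegrE ?l2_ge0. Qed.

Lemma cauchy_schwarz_l2 (I : finType) (c d : I -> K) :
  modulus (\sum_i c i * d i) <= l2 c * l2 d.
Proof.
apply: (le_trans (modulus_sum _ _)).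
under eq_bigr do rewrite modulusM.
apply: amgm_le; try by apply: sumr_ge0 => i _; rewrite sqr_ge0.
move=> t t0; rewrite !mulr_sumr -big_split; apply: ler_sum => i _ /=.
set a := modulus _; set b := modulus _.
have : 0 <= t^-1 * (t * a - b) ^+ 2 by rewrite mulr_ge0 ?sqr_ge0// invr_ge0 ltW.
have -> : t^-1 * (t * a - b) ^+ 2 =
    (t^-1 * t) * (t * a ^+ 2) - 2 * (t^-1 * t) * (a * b) + t^-1 * b ^+ 2 by ring.
by rewrite mulVf ?gt_eqF//; lra.
Qed.

(** Take for d the conjugate of c. *)
Lemma l2_dual (I : finType) (c : I -> K) M : 0 <= M ->
  (forall d : I -> K, modulus (\sum_i d i * c i) <= M * l2 d) -> l2 c <= M.
Proof.
move=> M0 /(_ (fun i => conjs (c i))).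
under eq_bigr do rewrite mulrC mul_conjs.
rewrite -raddf_sum modulus_emb -l2_sqr ger0_norm ?sqr_ge0//.
have -> : l2 (fun i => conjs (c i)) = l2 c.
  by congr Num.sqrt; apply: eq_bigr => i _; rewrite modulus_conjs.
have [->//|c0 h] := eqVneq (l2 c) 0.
by rewrite -(@ler_pM2r _ (l2 c)) ?lt_def ?c0 ?l2_ge0// -expr2.
Qed.

End L2.

Section Weak.
Variables (R : realType) (F : base_field).
Local Notation K := (scalar_field R F).
Implicit Types X Y : seminormed R F.

Lemma weak_l2_has_sup X (s : seq X) :
  has_sup [set Num.sqrt (\sum_(x <- s) modulus (g x) ^+ 2) |
    g in @unit_ball _ _ (dual X)].
Proof.
split; first by eexists; exists 0 => //; exact: unit_ball0.
exists (Num.sqrt (\sum_(x <- s) snorm x ^+ 2)) => _ [g g1 <-].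
rewrite ler_wsqrtr//; apply: ler_sum => x _.
rewrite ler_sqr ?nnegrE ?modulus_ge0 ?snorm_ge0//.
by rewrite (le_trans (ler_dual g x))// ler_piMl ?snorm_ge0.
Qed.

Lemma weak_l2_ge X (s : seq X) (g : dual X) : unit_ball g ->
  Num.sqrt (\sum_(x <- s) modulus (g x) ^+ 2) <= weak_l2 s.
Proof.
by move=> g1; apply: (sup_upper_bound (weak_l2_has_sup s)); exists g.
Qed.

Lemma weak_l2_ge0 X (s : seq X) : 0 <= weak_l2 s.
Proof.
exact: le_trans (sqrtr_ge0 _) (weak_l2_ge s (unit_ball0 (dual X))).
Qed.

Lemma weak_l2_le X (s : seq X) M :
  (forall g : dual X, unit_ball g ->
     Num.sqrt (\sum_(x <- s) modulus (g x) ^+ 2) <= M) -> weak_l2 s <= M.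
Proof.
move=> h; apply: ge_sup; first by have [] := weak_l2_has_sup s.
by move=> _ [g g1 <-]; exact: h.
Qed.

(** Families indexed by finite types are used throughout, while the weak norm
    is defined on sequences. *)
Definition fam (T : Type) (I : finType) (x : I -> T) : seq T := [seq x i | i <- enum I].

Lemma big_fam (T : Type) (I : finType) (x : I -> T) (f : T -> R) :
  \sum_(y <- fam x) f y = \sum_i f (x i).
Proof. by rewrite big_map big_enum. Qed.

Lemma weak_fam_ge X (I : finType) (x : I -> X) (g : dual X) :
  unit_ball g -> l2 (fun i => g (x i)) <= weak_l2 (fam x).
Proof. by move=> g1; have := weak_l2_ge (fam x) g1; rewrite big_fam. Qed.

Lemma weak_fam_le X (I : finType) (x : I -> X) M :
  (forall g : dual X, unit_ball g -> l2 (fun i => g (x i)) <= M) ->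
  weak_l2 (fam x) <= M.
Proof. by move=> h; apply: weak_l2_le => g /h; rewrite big_fam. Qed.

Lemma summing_fam X Y (f : X -> Y) C (I : finType) (x : I -> X) M :
  summing_bound f C ->
  (forall g : dual X, unit_ball g -> l2 (fun i => g (x i)) <= M) ->
  \sum_i snorm (f (x i)) ^+ 2 <= (C * M) ^+ 2.
Proof.
move=> [C0 fC] h; have := fC (fam x).
have wM := weak_fam_le h.
have M0 : 0 <= M := le_trans (weak_l2_ge0 _) wM.
rewrite /strong_l2 big_map big_fam => le.
rewrite -ler_sqrt ?sqr_ge0// sqrtr_sqr ger0_norm ?mulr_ge0//.
by rewrite (le_trans le)// ler_wpM2l.
Qed.

(** The bounds of a 2-summing map form a closed half-line, so the norm [pi2]
    is itself a bound. *)
Lemma pi2_attained X Y (f : X -> Y) : two_summing f ->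
  exists2 C, summing_bound f C & pi2 f = C%:E.
Proof.
move=> [C1 fC1]; pose S := [set C : R | summing_bound f C].
have iS : has_inf S by split; [exists C1|exists 0 => C []].
exists (inf S); last first.
  by rewrite /pi2 ereal_inf_EFin//; case: iS.
split; first by apply: lb_le_inf => [|C []]//; case: iS.
move=> s; have := weak_l2_ge0 s; rewrite le_eqVlt => /predU1P[w0|w0].
  by have := fC1.2 s; rewrite -w0 !mulr0.
rewrite -ler_pdivrMr//; apply: lb_le_inf; first by case: iS.
by move=> C [_ /(_ s)]; rewrite ler_pdivrMr.
Qed.

Lemma pi2_le X Y (f : X -> Y) C : summing_bound f C -> (pi2 f <= C%:E)%E.
Proof. by move=> fC; apply: ereal_inf_lbound; exists C. Qed.

End Weak.

(** * Positive semidefinite Hermitian forms *)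

Section SemiInner.
Variables (R : realType) (F : base_field).
Local Notation K := (scalar_field R F).
Variables (X : lmodType K) (G : X -> X -> K).

Definition semi_inner :=
  [/\ forall y, linear (G^~ y : X -> K^o), forall x y, G y x = conjs (G x y)
    & forall x, 0 <= G x x].

Definition pn x : R := Num.sqrt (re (G x x)).

Hypothesis GP : semi_inner.

Lemma sipDl x x' y : G (x + x') y = G x y + G x' y.
Proof. by have [/(_ y 1 x x') + _ _] := GP; rewrite !scale1r. Qed.
Lemma sipC x y : G y x = conjs (G x y).
Proof. by case: GP. Qed.
Lemma sipDr x y y' : G x (y + y') = G x y + G x y'.
Proof. by rewrite sipC sipDl rmorphD /= -!sipC. Qed.
Lemma sip0l y : G 0 y = 0.
Proof. by apply: (addrI (G 0 y)); rewrite -sipDl !addr0. Qed.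
Lemma sip0r y : G y 0 = 0.
Proof. by rewrite sipC sip0l rmorph0. Qed.
Lemma sipZl a x y : G (a *: x) y = a * G x y.
Proof. by have [/(_ y a x 0) + _ _] := GP; rewrite !addr0 sip0l addr0. Qed.
Lemma sipZr a x y : G x (a *: y) = conjs a * G x y.
Proof. by rewrite sipC sipZl rmorphM /= -sipC. Qed.
Lemma sipNl x y : G (- x) y = - G x y.
Proof. by rewrite -scaleN1r sipZl mulN1r. Qed.
Lemma sipNr x y : G x (- y) = - G x y.
Proof. by rewrite sipC sipNl rmorphN /= -sipC. Qed.
Lemma sipBl x x' y : G (x - x') y = G x y - G x' y.
Proof. by rewrite sipDl sipNl. Qed.
Lemma sipBr x y y' : G x (y - y') = G x y - G x y'.
Proof. by rewrite sipDr sipNr. Qed.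
Lemma sip_suml (I : finType) (f : I -> X) y :
  G (\sum_i f i) y = \sum_i G (f i) y.
Proof. by apply: (big_morph (G^~ y)) => [u v|]; rewrite ?sipDl ?sip0l. Qed.
Lemma sip_sumr (I : finType) (f : I -> X) y :
  G y (\sum_i f i) = \sum_i G y (f i).
Proof. by apply: (big_morph (G y)) => [u v|]; rewrite ?sipDr ?sip0r. Qed.

Lemma pn_ge0 x : 0 <= pn x. Proof. exact: sqrtr_ge0. Qed.
Lemma re_sip_ge0 x : 0 <= re (G x x).
Proof. by have [_ _ /(_ x)] := GP; rewrite ge0_scalar => /andP[]. Qed.
Lemma pn_sqr x : pn x ^+ 2 = re (G x x).
Proof. by rewrite sqr_sqrtr ?re_sip_ge0. Qed.
Lemma sip_pn x : G x x = emb (pn x ^+ 2).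
Proof.
apply: scalar_ext; rewrite ?re_emb ?pn_sqr// im_emb.
by have [_ _ /(_ x)] := GP; rewrite ge0_scalar => /andP[/eqP].
Qed.

Lemma pnZ a x : pn (a *: x) = modulus a * pn x.
Proof.
rewrite /pn sipZl sipZr mulrA mul_conjs re_embM sqrtrM ?sqr_ge0//.
by rewrite sqrtr_sqr ger0_norm ?modulus_ge0.
Qed.

Lemma pnN x : pn (- x) = pn x.
Proof. by rewrite -scaleN1r pnZ modulusN modulus1 mul1r. Qed.
Lemma pnBC x y : pn (x - y) = pn (y - x).
Proof. by rewrite -pnN opprB. Qed.

Lemma pnD_sqr x y : pn (x + y) ^+ 2 = pn x ^+ 2 + pn y ^+ 2 + 2 * re (G x y).
Proof.
rewrite !pn_sqr sipDl !sipDr !reD.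
by rewrite (sipC x y) re_conjs; ring.
Qed.

Lemma sip_cauchy x y : modulus (G x y) <= pn x * pn y.
Proof.
rewrite /pn; apply: amgm_le; rewrite ?re_sip_ge0// => t t0.
have [u u1 uG] := phase (G x y).
have := sqr_ge0 (pn ((- (emb t * u)) *: x + y)).
rewrite pnD_sqr pnZ modulusN modulusM u1 mulr1 modulus_emb gtr0_norm//.
rewrite sipZl mulNr -mulrA uG raddfN /= re_embM re_emb exprMn !pn_sqr.
set a := re (G x x); set b := re (G y y); set m := modulus _.
move=> h; have : 0 <= t^-1 * (t ^+ 2 * a + b + 2 * - (t * m)).
  by rewrite mulr_ge0// invr_ge0 ltW.
have -> : t^-1 * (t ^+ 2 * a + b + 2 * - (t * m)) =
    (t^-1 * t) * (t * a) + t^-1 * b - 2 * (t^-1 * t) * m by ring.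
by rewrite mulVf ?gt_eqF//; lra.
Qed.

Lemma pnD x y : pn (x + y) <= pn x + pn y.
Proof.
rewrite -ler_sqr ?nnegrE ?addr_ge0 ?pn_ge0// pnD_sqr.
have := sip_cauchy x y; have := re_le_modulus (G x y); have := ler_norm (re (G x y)).
by rewrite sqrrD; lra.
Qed.

Lemma pn_dist x y : `|pn x - pn y| <= pn (x - y).
Proof.
rewrite ler_norml; apply/andP; split.
  by have := pnD (y - x) x; rewrite subrK pnBC; lra.
by have := pnD (x - y) y; rewrite subrK; lra.
Qed.

Definition orthonormal_fam (I : finType) (e : I -> X) :=
  forall i j, G (e i) (e j) = (i == j)%:R.

Lemma pn_sum_orthonormal (I : finType) (e : I -> X) (c : I -> K) :
  orthonormal_fam e -> pn (\sum_i c i *: e i) = l2 c.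
Proof.
move=> eo; rewrite /pn /l2 sip_suml raddf_sum; congr Num.sqrt.
apply: eq_bigr => i _; rewrite sip_sumr (bigD1 i)//= big1 ?addr0 => [|j ji].
  by rewrite sipZl sipZr eo eqxx mulr1 mul_conjs re_emb.
by rewrite sipZl sipZr eo eq_sym (negbTE ji) !mulr0.
Qed.

Lemma sip_sum_orthonormal (I : finType) (e : I -> X) (c : I -> K) j :
  orthonormal_fam e -> G (\sum_i c i *: e i) (e j) = c j.
Proof.
move=> eo; rewrite sip_suml (bigD1 j)//= big1 ?addr0 => [|i ij].
  by rewrite sipZl eo eqxx mulr1.
by rewrite sipZl eo (negbTE ij) mulr0.
Qed.

(** The l_2 norm is tested against d, which moves the sum inside the form. *)
Lemma bessel (I : finType) (e : I -> X) x :
  orthonormal_fam e -> l2 (fun i => G x (e i)) <= pn x.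
Proof.
move=> eo; apply: l2_dual => [|d]; first exact: pn_ge0.
have -> : \sum_i d i * G x (e i) = G x (\sum_i conjs (d i) *: e i).
  by rewrite sip_sumr; apply: eq_bigr => i _; rewrite sipZr conjsK.
rewrite (le_trans (sip_cauchy _ _))// pn_sum_orthonormal//.
rewrite le_eqVlt; apply/orP; left; apply/eqP; congr (_ * Num.sqrt _).
by apply: eq_bigr => i _; rewrite modulus_conjs.
Qed.

Hypothesis G_def : forall x, G x x = 0 -> x = 0.

(** Only finitely many vectors of the Hilbert space occur in a given tensor, so
    its tensor powers can be handled in coordinates. *)
Lemma gram_schmidt (s : seq X) : exists n (e : 'I_n -> X),
  orthonormal_fam e /\
  forall x, x \in s -> x = \sum_i G x (e i) *: e i.
Proof.
elim: s => [|v s [n [e [eo es]]]].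
  by exists 0, (fun=> 0); split=> // -[].
pose r := v - \sum_i G v (e i) *: e i.
have rG j : G r (e j) = 0.
  by rewrite sipBl (sip_sum_orthonormal (fun i => G v (e i)))// subrr.
have [r0|r0] := eqVneq r 0.
  exists n, e; split=> // x; rewrite inE => /predU1P[->|/es//].
  by apply/eqP; rewrite -subr_eq0 -/r r0.
have pr : pn r != 0.
  by apply: contra_neq r0 => pr; apply: G_def; rewrite sip_pn pr expr0n raddf0.
pose f := emb (pn r)^-1 *: r.
have ff : G f f = 1.
  rewrite sip_pn pnZ modulus_emb ger0_norm ?invr_ge0 ?pn_ge0// mulVf//.
  by rewrite expr1n rmorph1.
have fe j : G f (e j) = 0 by rewrite sipZl rG mulr0.
pose e' (i : 'I_n.+1) := if unlift ord_max i is Some j then e j else f.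
have sumE x : \sum_i G x (e' i) *: e' i = \sum_i G x (e i) *: e i + G x f *: f.
  rewrite big_ord_recr /=; congr (_ + _); last first.
    by rewrite /e' unlift_none.
  apply: eq_bigr => i _; rewrite /e'.
  have -> : widen_ord (leqnSn n) i = lift ord_max i.
    by apply: val_inj; rewrite /= /bump leqNgt ltn_ord.
  by rewrite liftK.
exists n.+1, e'; split=> [i j|x].
  rewrite /e'; case: unliftP => [i' ->|->]; case: unliftP => [j' ->|->].
  - by rewrite eo (inj_eq lift_inj).
  - by rewrite sipC fe rmorph0 eq_sym (negbTE (neq_lift _ _)).
  - by rewrite fe (negbTE (neq_lift _ _)).
  - by rewrite ff eqxx.
rewrite inE sumE => /predU1P[->|xs].
  have vE : v = \sum_i G v (e i) *: e i + r by rewrite addrC subrK.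
  have -> : G v f *: f = r.
    have -> : G v f = G r f.
      rewrite {1}vE sipDl sip_suml big1 ?add0r// => i _.
      by rewrite sipZl (sipC f) fe rmorph0 mulr0.
    rewrite {1}/f sipZr conjs_emb sip_pn -rmorphM /f scalerA -rmorphM.
    by rewrite expr2 mulKf// mulfV// rmorph1 scale1r.
  exact: vE.
have -> : G x f = 0.
  rewrite (es x xs) sip_suml big1// => i _.
  by rewrite sipZl (sipC f) fe rmorph0 mulr0.
by rewrite scale0r addr0 -es.
Qed.

End SemiInner.
(** * Tensor powers: from the injective to the Hilbertian to the projective norm *)

Section LinearHelpers.
Variables (K : numFieldType) (V W : lmodType K) (f : V -> W).
Hypothesis lf : linear f.
Lemma lin0 : f 0 = 0.
Proof. by have := lf (-1) 0 0; rewrite scaler0 addr0 scaleN1r addNr. Qed.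
Lemma linD x y : f (x + y) = f x + f y.
Proof. by have := lf 1 x y; rewrite !scale1r. Qed.
Lemma linZ a x : f (a *: x) = a *: f x.
Proof. by have := lf a x 0; rewrite !addr0 lin0 addr0. Qed.
Lemma linN x : f (- x) = - f x.
Proof. by rewrite -[in LHS]scaleN1r linZ scaleN1r. Qed.
Lemma linB x y : f (x - y) = f x - f y.
Proof. by rewrite linD linN. Qed.
Lemma lin_sum (I : Type) (s : seq I) (x : I -> V) :
  f (\sum_(i <- s) x i) = \sum_(i <- s) f (x i).
Proof. exact: (big_morph f linD lin0). Qed.
Lemma lin_comb (I : Type) (s : seq I) (c : I -> K) (x : I -> V) :
  f (\sum_(i <- s) c i *: x i) = \sum_(i <- s) c i *: f (x i).
Proof. by rewrite lin_sum; apply: eq_bigr => i _; exact: linZ. Qed.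
End LinearHelpers.

Lemma scaleoE (K : numFieldType) (a : K) (b : K^o) : a *: b = a * b.
Proof. by []. Qed.

Section MultiIndex.
Variable J : finType.

(** Multi-indices of length m.+1, following the indexing of the tensor powers. *)
Fixpoint idx (m : nat) : finType :=
  if m is m'.+1 then (idx m' * J)%type : finType else J.

Lemma sum_idxS (V : nmodType) m (f : idx m.+1 -> V) :
  \sum_(I : idx m.+1) f I = \sum_(I : idx m) \sum_j f (I, j).
Proof. by rewrite pair_bigA /=; apply: eq_bigr => -[]. Qed.

End MultiIndex.

Section TensorPowers.
Variables (R : realType) (F : base_field).
Local Notation K := (scalar_field R F).
Implicit Types X Y : seminormed R F.

Lemma elem_lin_l (X Y : lmodType K) (y : Y) :
  linear (fun x : X => elem_tensor x y).
Proof. exact: (elem_tensor_bilinear X Y).1 y. Qed.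
Lemma elem_lin_r (X Y : lmodType K) (x : X) :
  linear (fun y : Y => elem_tensor x y).
Proof. exact: (elem_tensor_bilinear X Y).2 x. Qed.

Lemma proj_elem_le X Y (x : X) (y : Y) :
  snorm (elem_tensor x y : tensor_proj X Y) <= snorm x * snorm y.
Proof.
have := @proj_norm_le _ _ X Y (elem_tensor x y) [:: (x, y)].
by rewrite !big_seq1; apply.
Qed.

(** The functional f_{i_0} (x) ... (x) f_{i_m} on the injective power. *)
Fixpoint pow_fun X (J : finType) (f : J -> X -> K^o) (m : nat) :
    idx J m -> inj_pow X m -> K^o :=
  match m return idx J m -> inj_pow X m -> K^o with
  | 0 => f
  | m'.+1 => fun I => tensor_lift (fun u x => pow_fun f I.1 u * f I.2 x : K^o)
  end.

(** The elementary tensor y_{i_0} (x) ... (x) y_{i_m} of the projective power. *)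
Fixpoint pow_vec Y (J : finType) (y : J -> Y) (m : nat) :
    idx J m -> proj_pow Y m :=
  match m return idx J m -> proj_pow Y m with
  | 0 => y
  | m'.+1 => fun I => elem_tensor (pow_vec y I.1) (y I.2)
  end.

Lemma mul_bilinear (U V : lmodType K) (f : U -> K^o) (g : V -> K^o) :
  linear f -> linear g ->
  bilinear_for *:%R *:%R (fun u v => f u * g v : K^o).
Proof.
move=> lf lg; split=> [v|u] a x y /=.
- by rewrite lf mulrDl -scalerAl.
- by rewrite lg mulrDr -scalerAr.
Qed.

Lemma scale_bilinear (U V : lmodType K) (f : U -> K^o) :
  linear f -> bilinear_for *:%R *:%R (fun u (v : V) => f u *: v).
Proof.
move=> lf; split=> [v|u] a x y /=.
- by rewrite lf scalerDl scaleoE scalerA.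
- by rewrite scalerDr !scalerA mulrC.
Qed.

Lemma scale_bilinear_r (U V : lmodType K) (g : V -> K^o) :
  linear g -> bilinear_for *:%R *:%R (fun (u : U) v => g v *: u).
Proof.
move=> lg; split=> [v|u] a x y /=.
- by rewrite scalerDr !scalerA mulrC.
- by rewrite lg scalerDl scaleoE scalerA.
Qed.

Section PowFun.
Variables (X : seminormed R F) (J : finType) (f : J -> X -> K^o).
Hypothesis lf : forall j, linear (f j).

Lemma pow_fun_linear m (I : idx J m) : linear (pow_fun f I).
Proof.
elim: m I => [|m ih] I; first exact: lf.
exact/tensor_lift_linear/mul_bilinear.
Qed.

(** The vector (F_I (x) id) z, where F_I is the functional [pow_fun f I]. *)
Definition slice m (I : idx J m) (z : inj_pow X m.+1) : X :=
  tensor_lift (fun u (x : X) => pow_fun f I u *: x) z.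

(** The tensor (id (x) g) z. *)
Definition contract_last m (g : dual X) (z : inj_pow X m.+1) : inj_pow X m :=
  tensor_lift (fun (u : inj_pow X m) x => g x *: u) z.

Lemma slice_sum m (I : idx J m) (s : seq (inj_pow X m * X)) :
  slice I (\sum_(p <- s) elem_tensor p.1 p.2 : tensor _ _) =
  \sum_(p <- s) pow_fun f I p.1 *: p.2.
Proof.
rewrite -tensor_of_sumE /slice tensor_lift_sum//.
exact/scale_bilinear/pow_fun_linear.
Qed.

Lemma contract_last_sum m (g : dual X) (s : seq (inj_pow X m * X)) :
  contract_last g (\sum_(p <- s) elem_tensor p.1 p.2 : tensor _ _) =
  \sum_(p <- s) g p.2 *: p.1.
Proof.
rewrite -tensor_of_sumE /contract_last tensor_lift_sum//.
exact/scale_bilinear_r/dual_linear.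
Qed.

Lemma pow_fun_sum m (I : idx J m) j (s : seq (inj_pow X m * X)) :
  @pow_fun X J f m.+1 (I, j) (\sum_(p <- s) elem_tensor p.1 p.2 : tensor _ _) =
  \sum_(p <- s) pow_fun f I p.1 * f j p.2.
Proof.
rewrite -tensor_of_sumE /= tensor_lift_sum//.
by apply: mul_bilinear => //; exact: pow_fun_linear.
Qed.

(** Contracting by a functional of norm at most 1 decreases the injective norm,
    because h (id (x) g) = h (x) g for every h in the dual unit ball. *)
Lemma contract_last_le m (g : dual X) (z : inj_pow X m.+1) :
  unit_ball g -> snorm (contract_last g z) <= snorm z.
Proof.
move=> g1; have [h [h1 <-]] := norming_functional (contract_last g z).
have -> : h (contract_last g z) = tensor_pairing h g z.
  have [s ->] := tensor_sum_elem z.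
  rewrite contract_last_sum (lin_comb (@dual_linear _ _ _ h)).
  rewrite -[in RHS]tensor_of_sumE /tensor_pairing tensor_lift_sum.
    by apply: eq_bigr => p _; rewrite scaleoE mulrC.
  exact: tensor_pairing_bilinear.
apply: le_trans (inj_norm_ge _ h1 g1).
exact: le_trans (ler_norm _) (re_le_modulus _).
Qed.

(** Induction on the number of factors. The 2-summing estimate for the last
    factor, applied to the slices of z, reduces the claim to functionals g on X;
    applying g to all slices is the same as contracting z by g, and the
    contracted tensor has one factor less and no larger injective norm. *)
Lemma inj_to_l2 (C : R) : 0 <= C ->
  (forall (I : finType) (x : I -> X) M,
     (forall g : dual X, unit_ball g -> l2 (fun i => g (x i)) <= M) ->
     \sum_i \sum_j modulus (f j (x i)) ^+ 2 <= (C * M) ^+ 2) ->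
  forall m (z : inj_pow X m), l2 (fun I => pow_fun f I z) <= C ^+ m.+1 * snorm z.
Proof.
move=> C0 fC; elim=> [|m ih] z.
  rewrite l2_le ?mulr_ge0 ?exprn_ge0 ?snorm_ge0// expr1.
  have := fC unit (fun=> z) (snorm z).
  rewrite big_const card_unit /= addr0; apply=> g g1.
  rewrite l2_le ?snorm_ge0// big_const card_unit /= addr0.
  rewrite ler_sqr ?nnegrE ?modulus_ge0 ?snorm_ge0//.
  by rewrite (le_trans (ler_dual g z))// ler_piMl ?snorm_ge0.
have M0 : 0 <= C ^+ m.+2 * snorm z.
  by apply: mulr_ge0; [exact: exprn_ge0|exact: snorm_ge0].
rewrite l2_le//.
rewrite (sum_idxS (fun I : idx J m.+1 => modulus (pow_fun f I z) ^+ 2)).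
rewrite [C ^+ m.+2]exprS -mulrA.
rewrite (eq_bigr (fun I => \sum_j modulus (f j (slice I z)) ^+ 2)); last first.
  move=> I _; apply: eq_bigr => j _; have [s ->] := tensor_sum_elem z.
  by rewrite pow_fun_sum slice_sum (lin_comb (lf j)).
apply: (fC _ (fun I => slice I z) (C ^+ m.+1 * snorm z)) => g g1.
have -> : l2 (fun I => g (slice I z)) = l2 (fun I => pow_fun f I (contract_last g z)).
  congr Num.sqrt; apply: eq_bigr => I _; have [s ->] := tensor_sum_elem z.
  rewrite slice_sum contract_last_sum (lin_comb (@dual_linear _ _ _ g)).
  rewrite (lin_comb (pow_fun_linear I)); congr (modulus _ ^+ 2).
  by apply: eq_bigr => p _; rewrite !scaleoE mulrC.
by rewrite (le_trans (ih _))// ler_wpM2l ?exprn_ge0 ?contract_last_le.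
Qed.

End PowFun.

Section PowVec.
Variables (Y : seminormed R F) (J : finType) (y : J -> Y).

(** The dual induction. A norming functional L for the projective norm splits
    off, for each multi-index I, a functional T_I on the last factor; the
    2-summing estimate is applied to the T_I, and their weak norm is
    controlled by the projective norms of one order less. *)
Lemma l2_to_proj (C : R) : 0 <= C ->
  (forall (I : finType) (T : I -> dual Y) M,
     (forall g : dual (dual Y), unit_ball g -> l2 (fun i => g (T i)) <= M) ->
     \sum_i \sum_j modulus (T i (y j)) ^+ 2 <= (C * M) ^+ 2) ->
  forall m (c : idx J m -> K),
    snorm (\sum_I c I *: pow_vec y I) <= C ^+ m.+1 * l2 c.
Proof.
move=> C0 yC; elim=> [|m ih] c.
  have [g [g1 <-]] := norming_functional (\sum_j c j *: y j).
  rewrite (le_trans (ler_norm _))// (le_trans (re_le_modulus _))//.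
  rewrite (lin_comb (@dual_linear _ _ _ g)) mulrC.
  rewrite (le_trans (cauchy_schwarz_l2 _ _))// ler_wpM2l ?l2_ge0//.
  rewrite l2_le// expr1 -[C in leRHS]mulr1.
  have := yC unit (fun=> g) 1.
  rewrite big_const card_unit /= addr0; apply=> h h1.
  rewrite l2_le// big_const card_unit /= addr0 expr1n.
  by rewrite expr_le1 ?modulus_ge0// (le_trans (ler_dual h g))// mulr_ile1 ?snorm_ge0.
have [L [L1 <-]] := norming_functional (\sum_I c I *: pow_vec y I : proj_pow Y m.+1).
rewrite (le_trans (ler_norm _))// (le_trans (re_le_modulus _))//.
rewrite (lin_comb (@dual_linear _ _ _ L)) mulrC.
rewrite (le_trans (cauchy_schwarz_l2 _ _))// ler_wpM2l ?l2_ge0//.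
rewrite l2_le ?exprn_ge0//.
rewrite (sum_idxS (fun I : idx J m.+1 => modulus (L (pow_vec y I)) ^+ 2)).
have Lle (z : proj_pow Y m.+1) : modulus (L z) <= snorm z.
  by rewrite (le_trans (ler_dual L z))// ler_piMl ?snorm_ge0.
have Tlin (u : proj_pow Y m) : linear (fun v : Y => L (elem_tensor u v) : K^o).
  by move=> a v v'; rewrite elem_lin_r dual_linear.
have Tle u v : modulus (L (elem_tensor u v)) <= snorm u * snorm v.
  by rewrite (le_trans (Lle _))// proj_elem_le.
have Td u : (fun v : Y => L (elem_tensor u v) : K^o) \in @dual_pred R F Y.
  by apply/asboolP; split; [exact: Tlin|exists (snorm u) => v; exact: Tle].
pose T (I : idx J m) : dual Y := DualType (Td (pow_vec y I)).
rewrite [C ^+ m.+2]exprS.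
apply: (yC _ T) => g g1; apply: l2_dual => [|d]; first exact: exprn_ge0.
rewrite -[X in modulus X](lin_comb (@dual_linear _ _ _ g)).
rewrite (le_trans (ler_dual g _))// (le_trans _ (ih d))//.
rewrite (le_trans (ler_piMl (snorm_ge0 _) g1))//.
apply: dual_norm_le => v v1.
have -> : (\sum_I d I *: T I : dual Y) v = L (elem_tensor (\sum_I d I *: pow_vec y I) v).
  rewrite (lin_comb (elem_lin_l v)) (lin_comb (@dual_linear _ _ _ L)).
  by apply: (big_morph (fun h : dual Y => h v)).
by rewrite (le_trans (Tle _ _))// ler_piMr ?snorm_ge0.
Qed.

End PowVec.

(** Once [phi] is written in coordinates on the finitely many vectors that occur
    in z, its tensor power is the sum over multi-indices. *)
Lemma op_pow_expand X Y (phi : X -> Y) m (z : inj_pow X m) : linear phi ->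
  exists s : seq X, forall (J : finType) (f : J -> X -> K^o) (y : J -> Y),
    (forall j, linear (f j)) ->
    (forall x, x \in s -> phi x = \sum_j f j x *: y j) ->
    op_pow phi z = \sum_I pow_fun f I z *: pow_vec y I.
Proof.
move=> lphi; elim: m z => [|m ih] z.
  by exists [:: z] => J f y lf /(_ z); rewrite inE eqxx; apply.
have [t ->] := tensor_sum_elem z.
pose S u := sval (cid (ih u)).
exists (flatten [seq p.2 :: S p.1 | p <- t]) => J f y lf fy.
rewrite (lin_sum (op_pow_linear (n := m.+1) lphi)).
rewrite [RHS](eq_bigr (fun I => \sum_(p <- t)
   (pow_fun f I.1 p.1 * f I.2 p.2) *: @pow_vec Y J y m.+1 I)); last first.
  by move=> [I j] _; rewrite pow_fun_sum// scaler_suml.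
rewrite exchange_big /=; apply: eq_big_seq => p pt.
rewrite [LHS](op_powS_elem p.1 p.2 lphi).
have -> : phi p.2 = \sum_j f j p.2 *: y j.
  by apply: fy; apply/flattenP; exists (p.2 :: S p.1); rewrite ?inE ?eqxx//; apply/mapP; exists p.
have -> : op_pow phi p.1 = \sum_I pow_fun f I p.1 *: pow_vec y I.
  apply: (svalP (cid (ih p.1))) => // x xS; apply: fy; apply/flattenP.
  by exists (p.2 :: S p.1); [apply/mapP; exists p|rewrite inE xS orbT].
rewrite (lin_comb (elem_lin_l _)) [RHS](@sum_idxS J (tensor _ _) m).
apply: eq_bigr => I _; rewrite (lin_comb (elem_lin_r _)) scaler_sumr.
by apply: eq_bigr => j _; rewrite scalerA.
Qed.

End TensorPowers.
(** * The upper bound *)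

Section UpperBound.
Variables (R : realType) (F : base_field).
Local Notation K := (scalar_field R F).
Local Notation Banach := (completeNormedModType K).

Lemma hilbert_semi_inner (H : Banach) : hilbert H ->
  exists G : H -> H -> K, [/\ semi_inner G, forall x, G x x = 0 -> x = 0
    & forall x : of_normed H, snorm x = pn G x].
Proof.
move=> [ip ipE]; exists ip; split.
- have ipB x x' y : ip (x - x') y = ip x y - ip x' y.
    exact: (@zmod_morphisml_subproof _ _ _ _ _ _ ip).
  have ip0 y : ip 0 y = 0 by rewrite -[0 in LHS](subrr 0) ipB subrr.
  have ipN y v : ip (- v) y = - ip v y by rewrite -sub0r ipB ip0 sub0r.
  split=> [y a u v|x y|x].
  + rewrite -[v in LHS]opprK ipB ipN opprK; congr (_ + _).
    exact: (@linearl_subproof _ _ _ _ _ _ ip).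
  + by rewrite [LHS](@hermitian_subproof _ _ _ _ ip) expr0 mul1r.
  + by rewrite -ipE exprn_ge0.
- move=> x /eqP; rewrite -ipE expf_eq0 normr_eq0 => /andP[_ /eqP//].
- move=> x; rewrite /pn -ipE /= /normed_snorm.
  have : 0 <= `|x : H| by [].
  rewrite ge0_scalar => /andP[/eqP i0 r0].
  by rewrite expr2 reMul i0 mul0r subr0 -expr2 sqrtr_sqr ger0_norm.
Qed.

(** The tensor power factors through the coordinate space l_2 of an orthonormal
    family spanning the relevant part of H: [inj_to_l2] bounds the first half by
    the 2-summing constant of phi1, [l2_to_proj] the second half by that of the
    adjoint of phi2. *)
Lemma dominated_op_pow_le (X Y : Banach) (phi : {linear X -> Y}) (H : Banach)
    (phi1 : {linear of_normed X -> of_normed H})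
    (phi2 : {linear of_normed H -> of_normed Y})
    (bphi2 : bounded_op phi2) (C1 C2 : R) m (z : inj_pow (of_normed X) m) :
  dominated_factorization phi phi1 bphi2 ->
  summing_bound phi1 C1 -> summing_bound (adjoint bphi2) C2 ->
  snorm (op_pow (phi : of_normed X -> of_normed Y) z) <=
    (C1 * C2) ^+ m.+1 * snorm z.
Proof.
move=> [hH _ phiE _ _] s1 s2.
have [G [GP Gd GN]] := hilbert_semi_inner hH.
have lphi : linear (phi : of_normed X -> of_normed Y) by exact: linearP.
have [s sE] := op_pow_expand z lphi.
have [n [e [eo es]]] := gram_schmidt GP Gd [seq phi1 x : H | x <- s].
pose f j (x : of_normed X) : K^o := G (phi1 x) (e j).
pose y j : of_normed Y := phi2 (e j).
have lf j : linear (f j).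
  by move=> a u v; rewrite /f linearP (sipDl GP) (sipZl GP).
rewrite (sE _ f y lf); last first.
  move=> x xs; rewrite [LHS]phiE.
  have -> : phi1 x = \sum_j f j x *: e j by apply: es; apply/mapP; exists x.
  by rewrite (lin_comb (linearP phi2)).
have C10 := s1.1; have C20 := s2.1.
rewrite exprMn [leRHS]mulrAC [leRHS]mulrC.
have fb (I : finType) (x : I -> of_normed X) M :
    (forall g : dual (of_normed X), unit_ball g -> l2 (fun i => g (x i)) <= M) ->
    \sum_i \sum_j modulus (f j (x i)) ^+ 2 <= (C1 * M) ^+ 2.
  move=> xM; apply: le_trans (summing_fam s1 xM); apply: ler_sum => i _.
  rewrite -l2_sqr ler_sqr ?nnegrE ?l2_ge0 ?snorm_ge0// [leRHS]GN.
  exact: bessel.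
have yb (I : finType) (T : I -> dual (of_normed Y)) M :
    (forall g : dual (dual (of_normed Y)), unit_ball g -> l2 (fun i => g (T i)) <= M) ->
    \sum_i \sum_j modulus (T i (y j)) ^+ 2 <= (C2 * M) ^+ 2.
  move=> TM; apply: le_trans (summing_fam s2 TM); apply: ler_sum => i _.
  rewrite -l2_sqr ler_sqr ?nnegrE ?l2_ge0 ?snorm_ge0//.
  apply: l2_dual => [|d]; first exact: snorm_ge0.
  pose g := adjoint bphi2 (T i).
  have -> : \sum_j d j * T i (y j) = g (\sum_j d j *: e j).
    by rewrite [RHS](lin_comb (@dual_linear _ _ _ g)).
  by rewrite (le_trans (ler_dual g _))// GN (pn_sum_orthonormal GP)// lexx.
rewrite (le_trans (l2_to_proj C20 yb _))//.
rewrite ler_wpM2l ?exprn_ge0//.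
exact: inj_to_l2.
Qed.

End UpperBound.
(** * Rademacher sums *)

Section Signs.
Variables (R : realType).

(** Independence turns the sum into a product of hyperbolic cosines, each at most
    exp(2 u_i^2) for small u_i, so the mean is at most exp(1/2) <= 2. *)
Lemma rademacher_exp (I : finType) (u : I -> R) : \sum_i u i ^+ 2 <= 4^-1 ->
  \sum_(e : {ffun I -> bool}) expR (\sum_i (-1) ^+ e i * u i)
    <= 2 * #|{ffun I -> bool}|%:R.
Proof.
move=> u4.
have ui i : u i ^+ 2 <= 4^-1.
  apply: le_trans u4; rewrite (bigD1 i)//= lerDl sumr_ge0// => j _.
  exact: sqr_ge0.
under eq_bigr do rewrite expR_sum.
rewrite -(bigA_distr_bigA (fun i (b : bool) => expR ((-1) ^+ b * u i))).
have step i : \sum_(b : bool) expR ((-1) ^+ b * u i) <= 2 * expR (2 * u i ^+ 2).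
  (* exp x <= 1 / (1 - x) on both sides gives 2 / (1 - x^2) <= 2 (1 + 2 x^2). *)
  rewrite big_bool /= expr1 expr0 mulN1r mul1r.
  set x := u i; have x4 : x ^+ 2 <= 4^-1 by exact: ui.
  have bd : -1 < x < 1 by apply/andP; split; nra.
  have inv y : y < 1 -> expR y <= (1 - y)^-1.
    move=> y1; rewrite -[y in expR y]opprK expRN lef_pV2 ?posrE ?expR_gt0//; last by lra.
    exact: expR_ge1Dx.
  have h1 : expR x <= (1 - x)^-1 by apply: inv; lra.
  have h2 : expR (- x) <= (1 + x)^-1.
    by rewrite -[X in (1 + X)^-1]opprK; apply: inv; lra.
  have h3 := expR_ge1Dx (2 * x ^+ 2).
  apply: (le_trans (lerD h2 h1)); apply: (@le_trans _ _ (2 * (1 + 2 * x ^+ 2))).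
    have -> : (1 + x)^-1 + (1 - x)^-1 = 2 * (1 - x ^+ 2)^-1.
      by field; apply/andP; split; [|apply/andP; split]; apply: lt0r_neq0; nra.
    rewrite ler_pM2l// -[leLHS]mul1r ler_pdivrMr; nra.
  by rewrite ler_pM2l.
apply: (@le_trans _ _ (\prod_i (2 * expR (2 * u i ^+ 2)))).
  by apply: ler_prod => i _; rewrite step andbT sumr_ge0// => b _; exact: expR_ge0.
rewrite big_split /= prodr_const -expR_sum -mulr_sumr.
rewrite card_ffun card_bool natrX [leRHS]mulrC ler_wpM2l ?exprn_ge0//.
have h : expR (2 * \sum_i u i ^+ 2) <= expR (2^-1) by rewrite ler_expR; lra.
apply: (le_trans h).
have := expR_ge1Dx (- 2^-1 : R); rewrite expRN => h'.
have := expR_gt0 (2^-1 : R); set z := expR _ in h' *; move=> z0.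
have : (1 + - 2^-1) * z <= z^-1 * z by rewrite ler_wpM2r// ltW.
by rewrite mulVf ?gt_eqF//; lra.
Qed.

(** Flipping the sign at i is an involution that negates the summand if i <> j. *)
Lemma sum_sign_orth (K : numFieldType) (I : finType) (i j : I) :
  \sum_(e : {ffun I -> bool}) (-1) ^+ e i * (-1) ^+ e j =
    (i == j)%:R * #|{ffun I -> bool}|%:R :> K.
Proof.
have [->|ij] := eqVneq i j.
  rewrite mul1r (eq_bigr (fun=> 1)); last by move=> e _; rewrite -expr2 sqrr_sign.
  by rewrite sumr_const.
rewrite mul0r; set S := LHS.
pose flip (e : {ffun I -> bool}) := [ffun k => if k == i then ~~ e k else e k].
have flipK : involutive flip.
  by move=> e; apply/ffunP => k; rewrite !ffunE; case: (k == i); rewrite ?negbK.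
have : S = - S.
  rewrite {1}/S (reindex_inj (inv_inj flipK)) /= /S -sumrN.
  apply: eq_bigr => e _; rewrite !ffunE eqxx eq_sym (negbTE ij).
  by rewrite signrN mulNr.
by move/eqP; rewrite -subr_eq0 opprK -mulr2n mulrn_eq0 /= => /eqP.
Qed.

End Signs.

(** * The injective norm of a tensor of scalars *)

Section InjLe.
Variables (R : realType) (F : base_field) (J : finType).
Local Notation K := (scalar_field R F).
Local Notation vec := {ffun J -> K}.

(** [inj_le c M] means that the tensor with coefficients c in a power of l_2^J has
    injective norm at most M; one vector of the unit ball is contracted at a
    time, which is the order in which the inductive tensor norms unfold. *)
Fixpoint inj_le (m : nat) : (idx J m -> K) -> R -> Prop :=
  match m return (idx J m -> K) -> R -> Prop with
  | 0 => fun c M => forall b : J -> K, l2 b <= 1 -> modulus (\sum_j c j * b j) <= M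
  | m'.+1 => fun c M => forall b : J -> K, l2 b <= 1 ->
      @inj_le m' (fun I => \sum_j c (I, j) * b j) M
  end.

Definition is_net (d : R) (N : seq vec) :=
  (forall b, b \in N -> l2 b <= 1) /\
  forall b : J -> K, l2 b <= 1 ->
    exists2 b', b' \in N & l2 (fun j => b j - b' j) <= d.

(** Rounding towards 0 keeps the approximant below x in modulus, so that a
    rounded vector of the unit ball stays in the unit ball. *)
Lemma real_truncation (n : nat) (x : R) : `|x| <= 1 ->
  exists2 d, d \in [seq k%:R / n.+1%:R | k <- iota 0 n.+2] ++
                   [seq - (k%:R / n.+1%:R) | k <- iota 0 n.+2] &
    `|d| <= `|x| /\ `|x - d| <= n.+1%:R^-1.
Proof.
move=> x1; set N : R := n.+1%:R.
have N0 : 0 < N by rewrite ltr0n.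
have xN0 : 0 <= `|x| * N by rewrite mulr_ge0// ltW.
pose k := Num.truncn (`|x| * N).
have [kl ku] := andP (truncn_itv xN0).
have kn : k \in iota 0 n.+2.
  rewrite mem_iota /= add0n ltnS -(ler_nat R).
  by apply: (le_trans kl); rewrite ler_piMl// ltW.
have d0 : 0 <= k%:R / N by rewrite divr_ge0// ltW.
have dl : k%:R / N <= `|x| by rewrite ler_pdivrMr.
have du : `|x| - k%:R / N <= N^-1.
  rewrite lerBlDr -[X in X + _]mul1r -mulrDl ler_pdivlMr// addrC.
  by rewrite natr1 ltW.
have [x0|x0] := leP 0 x.
  exists (k%:R / N); first by rewrite mem_cat; apply/orP; left; apply/mapP; exists k.
  rewrite (ger0_norm d0); split=> //.
  by move: dl du; rewrite (ger0_norm x0) => dl du; rewrite ger0_norm// subr_ge0.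
exists (- (k%:R / N)).
  by rewrite mem_cat; apply/orP; right; apply/mapP; exists k.
rewrite normrN (ger0_norm d0); split=> //.
move: dl du; rewrite (ltr0_norm x0) => dl du.
set q := k%:R / N in dl du *; clearbody q; set r := N^-1 in du *; clearbody r.
by rewrite ler0_norm; lra.
Qed.

(** Both coordinates are rounded to multiples of 1/(n+1), with 2/(n+1) <= d. *)
Lemma scalar_net (d : R) : 0 < d -> exists D : seq K, forall a : K,
  modulus a <= 1 -> exists2 b, b \in D & modulus b <= modulus a /\ modulus (a - b) <= d.
Proof.
move=> d0; pose n := Num.truncn (2 * d^-1).
have nd : 2 * n.+1%:R^-1 <= d.
  have n0 : 0 < n.+1%:R :> R by rewrite ltr0n.
  rewrite ler_pdivrMr// -ler_pdivrMl// mulrC ltW//.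
  by apply: truncnS_gt.
pose D1 : seq R := [seq k%:R / n.+1%:R | k <- iota 0 n.+2] ++
                   [seq - (k%:R / n.+1%:R) | k <- iota 0 n.+2].
exists [seq mk r s | r <- D1, s <- D1] => a a1.
have [r rD [ra rd]] := real_truncation n (le_trans (re_le_modulus a) a1).
have [s sD [sa sd]] := real_truncation n (le_trans (im_le_modulus a) a1).
have s0 : F = Reals -> s = 0.
  by move=> FR; apply/eqP; rewrite -normr_le0 (le_trans sa)// im_Reals// normr0.
exists (mk r s); first by apply/allpairsP; exists (r, s).
split.
  rewrite -ler_sqr ?nnegrE ?modulus_ge0// !modulus_sqr re_mk im_mk//.
  by rewrite -(real_normK (num_real r)) -(real_normK (num_real s))
    -(real_normK (num_real (re a))) -(real_normK (num_real (im a))) lerD// lerXn2r.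
rewrite (le_trans (modulus_le_reim _))// [re _]raddfB [im _]raddfB /= re_mk im_mk//.
by rewrite (le_trans _ nd)// mulr_natl mulr2n lerD.
Qed.

Lemma vec_net (d : R) : 0 < d -> exists N : seq vec, is_net d N.
Proof.
move=> d0.
pose eta := d / #|J|.+1%:R.
have e0 : 0 < eta by rewrite divr_gt0.
have [D DP] := scalar_net e0.
pose v (g : {ffun J -> 'I_(size D)}) : vec := [ffun j => D`_(g j)].
exists [seq b : vec <- [seq v g | g <- enum {: {ffun J -> 'I_(size D)}}] | l2 b <= 1].
split=> [b|b b1]; first by rewrite mem_filter => /andP[].
have bj j : modulus (b j) <= 1.
  rewrite -[leRHS](expr1n _ 2) -ler_sqr ?nnegrE ?modulus_ge0// expr1n.
  move: b1; rewrite l2_le// expr1n; apply: le_trans.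
  by rewrite (bigD1 j)//= lerDl sumr_ge0// => i _; rewrite sqr_ge0.
have hc j : exists i : 'I_(size D), modulus D`_i <= modulus (b j) /\
    modulus (b j - D`_i) <= eta.
  have [x /(nthP 0)[i iD <-] h] := DP _ (bj j).
  by exists (Ordinal iD).
pose g : {ffun J -> 'I_(size D)} := [ffun j => sval (cid (hc j))].
have gP j : modulus (v g j) <= modulus (b j) /\ modulus (b j - v g j) <= eta.
  by rewrite !ffunE; exact: (svalP (cid (hc j))).
exists (v g).
  rewrite mem_filter; apply/andP; split; last by rewrite map_f// mem_enum.
  rewrite (le_trans _ b1)// ler_wsqrtr//; apply: ler_sum => j _.
  by rewrite lerXn2r ?nnegrE ?modulus_ge0//; case: (gP j).
rewrite l2_le; last exact: ltW.
apply: (@le_trans _ _ (\sum_(j : J) eta ^+ 2)).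
  apply: ler_sum => j _; rewrite lerXn2r ?nnegrE ?modulus_ge0 ?(ltW e0)//.
  by case: (gP j).
rewrite sumr_const -mulr_natl /eta expr_div_n mulrA ler_pdivrMr ?exprn_gt0//.
rewrite mulrC ler_wpM2l ?sqr_ge0// -natrX ler_nat.
by rewrite (leq_trans (leqnSn _))// expnS expn1 leq_pmulr.
Qed.

(** The usual net argument: the norm of a functional is the l_2 norm of its
    coefficients, and it is at most M plus d times itself. *)
Lemma net_functional (d : R) (N : seq vec) (c : J -> K) (M : R) :
  0 <= d < 1 -> is_net d N -> 0 <= M ->
  (forall b, b \in N -> modulus (\sum_j c j * b j) <= M) ->
  l2 c <= (1 - d)^-1 * M.
Proof.
move=> /andP[d0 d1] [_ N2] M0 cM.
have l0 := l2_ge0 c.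
suff : l2 c <= M + d * l2 c.
  by move=> h; rewrite mulrC ler_pdivlMr; lra.
apply: l2_dual => [|b]; first by rewrite addr_ge0// mulr_ge0.
have [b0|b0] := eqVneq (l2 b) 0.
  rewrite (le_trans (cauchy_schwarz_l2 _ _))// b0 mul0r mulr0 lexx//.
have bp : 0 < l2 b by rewrite lt_def b0 l2_ge0.
pose b1 j := emb (l2 b)^-1 * b j.
have b11 : l2 b1 <= 1.
  rewrite l2_le// /b1 expr1n.
  under eq_bigr do rewrite modulusM modulus_emb ger0_norm ?invr_ge0 ?l2_ge0// exprMn.
  by rewrite -mulr_sumr -l2_sqr -exprMn mulVf// expr1n.
have [b' b'N bb'] := N2 _ b11.
have h : modulus (\sum_j b1 j * c j) <= M + d * l2 c.
  have -> : \sum_j b1 j * c j = \sum_j c j * b' j + \sum_j c j * (b1 j - b' j).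
    by rewrite -big_split; apply: eq_bigr => j _ /=; ring.
  rewrite (le_trans (modulusD _ _))// lerD ?cM//.
  rewrite (le_trans (cauchy_schwarz_l2 _ _))// mulrC.
  by rewrite ler_wpM2r.
have -> : \sum_j b j * c j = emb (l2 b) * \sum_j b1 j * c j.
  rewrite mulr_sumr; apply: eq_bigr => j _.
  by rewrite /b1 !mulrA -rmorphM mulfV// rmorph1 mul1r.
by rewrite modulusM modulus_emb gtr0_norm// mulrC ler_wpM2r// ltW.
Qed.

(** Coefficients of the elementary tensors of points of a net. *)
Fixpoint net_mono (N : seq vec) (m : nat) : seq {ffun idx J m -> K} :=
  match m return seq {ffun idx J m -> K} with
  | 0 => N
  | m'.+1 => [seq [ffun I : idx J m'.+1 => (a : {ffun idx J m' -> K}) I.1 * (b : vec) I.2] |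
                a <- net_mono N m', b <- N]
  end.

Lemma size_net_mono N m : size (net_mono N m) = (size N ^ m.+1)%N.
Proof.
by elim: m => [|m ih]; rewrite ?expn1// size_allpairs ih [RHS]expnSr.
Qed.

Lemma net_mono_le1 (N : seq vec) m (a : {ffun idx J m -> K}) :
  (forall b, b \in N -> l2 b <= 1) -> a \in net_mono N m -> l2 a <= 1.
Proof.
move=> N1; elim: m a => [|m ih] a; first exact: N1.
case/allpairsP => -[a' b] /= [/ih a'1 /N1 b1 ->].
rewrite l2_le// (sum_idxS (fun I : idx J m.+1 =>
  modulus ([ffun I0 : idx J m.+1 => a' I0.1 * b I0.2] I) ^+ 2)).
rewrite (eq_bigr (fun i => modulus (a' i) ^+ 2 * l2 b ^+ 2)); last first.
  move=> I _; rewrite l2_sqr mulr_sumr; apply: eq_bigr => j _.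
  by rewrite ffunE modulusM exprMn.
by rewrite -mulr_suml -l2_sqr expr1n mulr_ile1 ?sqr_ge0// expr_le1 ?l2_ge0.
Qed.

(** The net argument in each of the m.+1 variables costs a factor 1/(1-d) each. *)
Lemma net_inj_le (d : R) N m (c : idx J m -> K) M :
  0 <= d < 1 -> is_net d N -> 0 <= M ->
  (forall a, a \in net_mono N m -> modulus (\sum_I c I * a I) <= M) ->
  inj_le c ((1 - d)^-1 ^+ m.+1 * M).
Proof.
move=> d01 NN; have dV : 0 <= (1 - d)^-1.
  by case/andP: d01 => d0 d1; rewrite invr_ge0; lra.
elim: m c M => [|m ih] c M M0 cM b b1.
  rewrite (le_trans (cauchy_schwarz_l2 _ _))// expr1.
  rewrite (le_trans (ler_piMr (l2_ge0 _) b1))//.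
  exact: net_functional NN M0 cM.
rewrite exprSr -mulrA; apply: ih => [|a aN]; first by rewrite mulr_ge0.
pose c' j := \sum_I c (I, j) * a I.
have -> : \sum_I (\sum_j c (I, j) * b j) * a I = \sum_j c' j * b j.
  under eq_bigr do rewrite mulr_suml.
  rewrite exchange_big; apply: eq_bigr => j _; rewrite /c' mulr_suml.
  by apply: eq_bigr => I _; rewrite mulrAC.
rewrite (le_trans (cauchy_schwarz_l2 _ _))//.
rewrite (le_trans (ler_piMr (l2_ge0 _) b1))//.
apply: net_functional NN M0 _ => // b' b'N.
have := cM [ffun I : idx J m.+1 => a I.1 * b' I.2]; rewrite allpairs_f// => /(_ isT).
rewrite (sum_idxS (fun I : idx J m.+1 =>
  c I * [ffun I0 : idx J m.+1 => a I0.1 * b' I0.2] I)).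
rewrite exchange_big; congr (modulus _ <= M); apply: eq_bigr => j _.
by rewrite /c' mulr_suml; apply: eq_bigr => I _; rewrite ffunE mulrA.
Qed.

End InjLe.
(** Bernoulli's inequality. *)
Lemma power_unbounded (R : realType) (M r : R) : 1 < r ->
  exists n0, forall n, (n0 <= n)%N -> M <= r ^+ n.
Proof.
move=> r1; have r0 : 0 < r - 1 by lra.
have bern n : 1 + (r - 1) * n%:R <= r ^+ n.
  elim: n => [|n ih]; first by rewrite mulr0 addr0 expr0.
  rewrite exprS -natr1; have : 0 <= (n%:R : R) by rewrite ler0n.
  set x : R := n%:R in ih *; move=> x0; have := mulr_ge0 (sqr_ge0 (r - 1)) x0.
  by move=> ?; apply: (@le_trans _ _ (r * (1 + (r - 1) * x))); [nra|rewrite ler_wpM2l//; lra].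
exists (Num.truncn (M / (r - 1))).+1 => n nM.
apply: le_trans (bern n).
have : M / (r - 1) <= n%:R.
  by rewrite (le_trans (ltW (truncnS_gt _)))// ler_nat.
by rewrite ler_pdivrMr//; lra.
Qed.

Section RandomSigns.
Variables (R : realType) (F : base_field).
Local Notation K := (scalar_field R F).

(** The exponential of the modulus is at most the sum of the four exponentials
    of plus and minus half the real and imaginary parts. *)
Lemma rademacher_scalar (I : finType) (a : I -> K) : l2 a <= 1 ->
  \sum_(e : {ffun I -> bool})
     expR (modulus (\sum_i (-1) ^+ e i * a i) / 4) <= 8 * #|{ffun I -> bool}|%:R.
Proof.
rewrite l2_le// expr1n => a1.
pose S (u : I -> R) := \sum_(e : {ffun I -> bool}) expR (\sum_i (-1) ^+ e i * u i).
have SB (u : I -> R) (s : R) : s ^+ 2 = 4^-1 -> (forall i, `|u i| <= modulus (a i)) ->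
    S (fun i => s * u i) <= 2 * #|{ffun I -> bool}|%:R.
  move=> s4 ua; apply: rademacher_exp.
  under eq_bigr do rewrite exprMn s4.
  rewrite -mulr_sumr -[leRHS]mulr1 ler_wpM2l ?invr_ge0//.
  apply: le_trans a1; apply: ler_sum => i _.
  by rewrite -(real_normK (num_real (u i))) lerXn2r ?nnegrE ?modulus_ge0.
have h4 : (2^-1 : R) ^+ 2 = 4^-1 by rewrite exprVn; congr (_^-1); ring.
have h4' : (- 2^-1 : R) ^+ 2 = 4^-1 by rewrite sqrrN.
have B1 := SB (fun i => re (a i)) _ h4 (fun i => re_le_modulus (a i)).
have B2 := SB (fun i => re (a i)) _ h4' (fun i => re_le_modulus (a i)).
have B3 := SB (fun i => im (a i)) _ h4 (fun i => im_le_modulus (a i)).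
have B4 := SB (fun i => im (a i)) _ h4' (fun i => im_le_modulus (a i)).
have := lerD (lerD B1 B2) (lerD B3 B4).
rewrite /S -!big_split /= => le8.
have -> : 8 * #|{ffun I -> bool}|%:R =
  2 * #|{ffun I -> bool}|%:R + 2 * #|{ffun I -> bool}|%:R +
  (2 * #|{ffun I -> bool}|%:R + 2 * #|{ffun I -> bool}|%:R) :> R by ring.
apply: le_trans le8; apply: ler_sum => e _.
set z := \sum_i _.
have lin (s : R) (p : {additive K -> R}) :
    \sum_i (-1) ^+ e i * (s * p (a i)) = s * p z.
  rewrite raddf_sum mulr_sumr; apply: eq_bigr => i _ /=.
  by rewrite !mulr_sign; case: (e i); rewrite ?raddfN ?mulrN.
rewrite !(lin _ (@re R F)) !(lin _ (@im R F)) !mulNr.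
have ez (x : R) : expR (`|x|) <= expR x + expR (- x).
  have [x0|x0] := leP 0 x; first by rewrite (ger0_norm x0) lerDl expR_ge0.
  by rewrite (ltr0_norm x0) lerDr expR_ge0.
have half (x y : R) : 0 <= x -> 0 <= y ->
    expR ((x + y) / 4) <= expR (2^-1 * x) + expR (2^-1 * y).
  move=> x0 y0; have [xy|/ltW yx] := leP x y.
    apply: (@le_trans _ _ (expR (2^-1 * y))); first by rewrite ler_expR; lra.
    by rewrite lerDr expR_ge0.
  apply: (@le_trans _ _ (expR (2^-1 * x))); first by rewrite ler_expR; lra.
  by rewrite lerDl expR_ge0.
apply: (@le_trans _ _ (expR ((`|re z| + `|im z|) / 4))).
  by rewrite ler_expR ler_wpM2r// modulus_le_reim.
apply: (le_trans (half _ _ (normr_ge0 _) (normr_ge0 _))).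
have hn (x : R) : 2^-1 * `|x| = `|2^-1 * x| by rewrite normrM ger0_norm.
by rewrite !hn lerD.
Qed.

(** Taking means bounds the mean of y by A plus a multiple of that of a high power
    of y. *)
Lemma le_power_split (y A : R) q : 0 <= y -> 0 < A -> y <= A + y ^+ q.+1 / A ^+ q.
Proof.
move=> y0 A0; have Aq : 0 < A ^+ q by rewrite exprn_gt0.
have [yA|/ltW Ay] := leP y A.
  by rewrite (le_trans yA)// lerDl divr_ge0 ?exprn_ge0// ltW.
rewrite (@le_trans _ _ (y ^+ q.+1 / A ^+ q))//; last by rewrite lerDr ltW.
by rewrite ler_pdivlMr// exprS ler_wpM2l// lerXn2r// nnegrE ltW.
Qed.

Lemma sqr_le_exp (t : R) q : 0 <= t ->
  t ^+ 2 <= 64 * q.+1%:R ^+ 2 * expR (t / (4 * q.+1%:R)).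
Proof.
move=> t0; set n : R := q.+1%:R; have n0 : 0 < n by rewrite ltr0n.
have h : t / (8 * n) <= expR (t / (8 * n)).
  by rewrite (le_trans _ (expR_ge1Dx _))// lerDr.
have -> : t / (4 * n) = 2%:R * (t / (8 * n)) by field; rewrite gt_eqF.
rewrite expRM_natl.
have -> : t = 8 * n * (t / (8 * n)) by field; rewrite gt_eqF.
set s := t / _ in h *.
have -> : 8 * n * s / (8 * n) = s by field; rewrite gt_eqF.
have -> : (8 * n * s) ^+ 2 = 64 * n ^+ 2 * s ^+ 2 by ring.
have s0 : 0 <= s by rewrite divr_ge0// mulr_ge0// ltW.
rewrite ler_wpM2l ?mulr_ge0 ?sqr_ge0//.
by rewrite lerXn2r ?nnegrE ?expR_ge0.
Qed.

(** Random signs have, in mean square, an injective norm that grows slower than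
    any exponential rho^k, although their Hilbertian norm is #|J|^(k/2).
    The number of elementary tensors over a fixed net is exponential in k, but
    passing to a high enough moment reduces its contribution to r^k for any
    given r > 1, and the loss of the net argument is also r^k if the net is fine
    enough. Here r is the square root of rho, and V e bounds the square of the
    injective norm of e. *)
Lemma random_signs (J : finType) (rho : R) : 1 < rho ->
  exists2 c : R, 0 < c & forall m, exists V : {ffun idx J m -> bool} -> R,
    [/\ forall e, 0 <= V e,
        forall e : {ffun idx J m -> bool}, inj_le (fun I : idx J m => (-1) ^+ e I : K) (Num.sqrt (V e)) &
        \sum_e V e <= #|{ffun idx J m -> bool}|%:R * (c * rho ^+ m.+1)].
Proof.
move=> rho1; set r := Num.sqrt rho.
have rho0 : 0 < rho by lra.
have rr : r ^+ 2 = rho by rewrite sqr_sqrtr// ltW.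
have r0 : 0 < r by rewrite sqrtr_gt0.
have r1 : 1 < r by rewrite -(@ltr_pXn2r _ 2) ?nnegrE ?ltW// rr expr1n.
pose d := (1 - r^-1) / 2.
have rV : r^-1 < 1 by rewrite invf_lt1.
have rV0 : 0 < r^-1 by rewrite invr_gt0.
have d01 : 0 <= d < 1 by rewrite /d; apply/andP; split; lra.
have d0 : 0 < d by rewrite /d; lra.
set th := (1 - d)^-1.
have th0 : 0 < th by rewrite invr_gt0 /d; lra.
have thr : th ^+ 2 <= r.
  rewrite /th exprVn -[r]invrK lef_pV2 ?posrE ?exprn_gt0//; last by rewrite /d; lra.
  have -> : (1 - d) ^+ 2 = r^-1 + ((1 - r^-1) / 2) ^+ 2 by rewrite /d; field; exact: lt0r_neq0.
  by rewrite lerDl sqr_ge0.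
have [N NN] := vec_net F J d0.
(* The q+1-st moment is high enough: its root brings size N below r. *)
have [q qN] : exists q, (size N)%:R <= r ^+ q.+1.
  by have [q qN] := power_unbounded (size N)%:R r1; exists q; exact: qN.
set n : R := q.+1%:R; have n0 : 0 < n by rewrite ltr0n.
exists (9 * (64 * n ^+ 2)) => [|m].
  by apply: mulr_gt0; last apply: mulr_gt0; rewrite ?ltr0n// exprn_gt0.
pose A := r ^+ m.+1; have A0 : 0 < A by rewrite exprn_gt0.
pose x (e : {ffun idx J m -> bool}) (a : {ffun idx J m -> K}) : R :=
  modulus (\sum_I (-1) ^+ e I * a I).
pose W e : R := 64 * n ^+ 2 *
  (A + (\sum_(a <- net_mono N m) expR (x e a / 4)) / A ^+ q).
have c0 : 0 <= 64 * n ^+ 2 by rewrite mulr_ge0 ?sqr_ge0.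
have W0 e : 0 <= W e.
  apply: mulr_ge0 => //; apply: addr_ge0; first exact: ltW.
  by apply: divr_ge0; [apply: sumr_ge0 => a _; exact: expR_ge0|apply: exprn_ge0; exact: ltW].
have Wx e a : a \in net_mono N m -> x e a ^+ 2 <= W e.
  move=> aN; apply: (le_trans (sqr_le_exp q (modulus_ge0 _))).
  rewrite ler_wpM2l//; set y := expR _.
  have y0 : 0 <= y by exact: expR_ge0.
  apply: (le_trans (le_power_split q y0 A0)); rewrite lerD2l.
  apply: ler_wpM2r; first by rewrite invr_ge0; apply: exprn_ge0; exact: ltW.
  have -> : y ^+ q.+1 = expR (x e a / 4).
    rewrite /y -expRM_natl; congr expR; rewrite -/n; field; rewrite gt_eqF//.
  rewrite (big_rem a)//= lerDl sumr_ge0// => b _; exact: expR_ge0.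
exists (fun e => th ^+ m.+1 ^+ 2 * W e); split=> [e|e|].
- by rewrite mulr_ge0 ?sqr_ge0.
- rewrite sqrtrM ?sqr_ge0// sqrtr_sqr ger0_norm ?exprn_ge0 ?ltW//.
  apply: (net_inj_le d01 NN (sqrtr_ge0 _)).
  move=> a /(Wx e) xW.
  rewrite -ler_sqr ?nnegrE ?modulus_ge0 ?sqrtr_ge0// sqr_sqrtr//.
- set E : R := #|_|%:R.
  have E0 : 0 <= E by rewrite ler0n.
  rewrite -mulr_sumr -mulr_sumr big_split /= sumr_const -mulr_suml exchange_big /=.
  have sN : \sum_(a <- net_mono N m) \sum_e expR (x e a / 4) <=
      (size N)%:R ^+ m.+1 * (8 * E).
    rewrite -natrX -size_net_mono -sum1_size natr_sum mulr_suml.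
    rewrite big_seq [leRHS]big_seq; apply: ler_sum => a aN; rewrite mul1r.
    apply: rademacher_scalar; apply: net_mono_le1 aN; exact: NN.1.
  have h : (\sum_(a <- net_mono N m) \sum_e expR (x e a / 4)) / A ^+ q <= 8 * E * A.
    rewrite ler_pdivrMr ?exprn_gt0//; apply: (le_trans sN).
    rewrite -[leRHS]mulrA -exprS [leLHS]mulrC; apply: ler_wpM2l; first by rewrite mulr_ge0.
    by rewrite /A -exprM mulnC exprM lerXn2r ?nnegrE ?exprn_ge0 ?(ltW r0).
  have tA : th ^+ m.+1 ^+ 2 <= A.
    by rewrite -exprM mulnC exprM lerXn2r ?nnegrE ?sqr_ge0 ?(ltW r0).
  have -> : E * (9 * (64 * n ^+ 2) * rho ^+ m.+1) = A * (64 * n ^+ 2 * (A * E + 8 * E * A)).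
    by rewrite -rr -exprM mulnC exprM -/A; ring.
  apply: ler_pM => //; first by rewrite sqr_ge0.
    apply: mulr_ge0 => //; apply: addr_ge0; first by apply: mulrn_wge0; exact: ltW.
    apply: divr_ge0; last by apply: exprn_ge0; exact: ltW.
    by apply: sumr_ge0 => a _; apply: sumr_ge0 => e _; exact: expR_ge0.
  by rewrite ler_wpM2l// lerD// -mulr_natr.
Qed.

End RandomSigns.
(** * The lower bound by random tensors *)

Section InjLeTheory.
Variables (R : realType) (F : base_field) (J : finType).
Local Notation K := (scalar_field R F).

Lemma inj_leZ m (c : idx J m -> K) r M :
  inj_le c M -> inj_le (fun I => r * c I) (modulus r * M).
Proof.
elim: m c M => [|m ih] c M cM b b1.
  under eq_bigr do rewrite -mulrA.
  by rewrite -mulr_sumr modulusM ler_wpM2l ?modulus_ge0// cM.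
have := ih _ _ (cM b b1); congr inj_le; apply/funext => I.
by rewrite mulr_sumr; apply: eq_bigr => j _; rewrite mulrA.
Qed.

Lemma l2_normalize (b : J -> K) : exists2 b1 : J -> K, l2 b1 <= 1 &
  forall j, b j = emb (l2 b) * b1 j.
Proof.
have [b0|b0] := eqVneq (l2 b) 0.
  exists (fun=> 0) => [|j].
    by rewrite l2_le// big1 ?expr1n// => j _; rewrite modulus0 expr0n.
  rewrite b0 rmorph0 mul0r; apply: modulus0_eq0.
  have := l2_sqr b; rewrite b0 expr0n /= (bigD1 j)//= => /esym/eqP.
  rewrite paddr_eq0 ?sqr_ge0//; last by apply: sumr_ge0 => i _; exact: sqr_ge0.
  by rewrite sqrf_eq0 => /andP[/eqP].
exists (fun j => emb (l2 b)^-1 * b j) => [|j]; last first.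
  by rewrite mulrA -rmorphM mulfV// rmorph1 mul1r.
rewrite l2_le// expr1n.
under eq_bigr do rewrite modulusM modulus_emb ger0_norm ?invr_ge0 ?l2_ge0// exprMn.
by rewrite -mulr_sumr -l2_sqr -exprMn mulVf// expr1n.
Qed.

Lemma inj_le0 (c : idx J 0 -> K) M (b : J -> K) :
  inj_le c M -> modulus (\sum_j c j * b j) <= l2 b * M.
Proof.
move=> cM; have [b1 b11 bE] := l2_normalize b.
have -> : \sum_j c j * b j = emb (l2 b) * \sum_j c j * b1 j.
  by rewrite mulr_sumr; apply: eq_bigr => j _; rewrite bE mulrCA.
by rewrite modulusM modulus_emb ger0_norm ?l2_ge0// ler_wpM2l ?l2_ge0// cM.
Qed.

Lemma inj_leS m (c : idx J m.+1 -> K) M (b : J -> K) :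
  inj_le c M -> inj_le (fun I : idx J m => \sum_j c (I, j) * b j) (l2 b * M).
Proof.
move=> cM; have [b1 b11 bE] := l2_normalize b.
have := inj_leZ (emb (l2 b)) (cM b1 b11).
rewrite modulus_emb ger0_norm ?l2_ge0//; congr inj_le; apply/funext => I.
by rewrite mulr_sumr; apply: eq_bigr => j _; rewrite bE mulrCA.
Qed.

End InjLeTheory.

Lemma inj_le_ge0 (R : realType) (F : base_field) (J : finType) m
  (c : idx J m -> scalar_field R F) M : inj_le c M -> 0 <= M.
Proof.
have l0 : l2 ((fun=> 0) : J -> scalar_field R F) <= 1.
  by rewrite l2_le// big1 ?expr1n// => j _; rewrite modulus0 expr0n.
elim: m c => [|m ih] c /(_ _ l0); last exact: ih.
exact: le_trans (modulus_ge0 _).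
Qed.

Section LowerBound.
Variables (R : realType) (F : base_field) (J : finType).
Local Notation K := (scalar_field R F).
Implicit Types X Y : seminormed R F.

Lemma comb_le_weak X (x : J -> X) (d : J -> K) :
  snorm (\sum_j d j *: x j) <= weak_l2 (fam x) * l2 d.
Proof.
have [g [g1 <-]] := norming_functional (\sum_j d j *: x j).
rewrite (le_trans (ler_norm _))// (le_trans (re_le_modulus _))//.
rewrite (lin_comb (@dual_linear _ _ _ g)) mulrC.
rewrite (le_trans (cauchy_schwarz_l2 _ _))// ler_wpM2l ?l2_ge0//.
exact: weak_fam_ge.
Qed.

Lemma weak_eval_le Y (y : J -> dual Y) (v : Y) :
  l2 (fun j => y j v) <= weak_l2 (fam y) * snorm v.
Proof.
apply: l2_dual => [|d]; first by rewrite mulr_ge0 ?weak_l2_ge0 ?snorm_ge0.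
have -> : \sum_j d j * y j v = (\sum_j d j *: y j : dual Y) v.
  by symmetry; apply: (big_morph (fun h : dual Y => h v)).
rewrite (le_trans (ler_dual _ _))// mulrAC.
by rewrite ler_wpM2r ?snorm_ge0// comb_le_weak.
Qed.

Fixpoint inj_vec X (x : J -> X) (m : nat) : idx J m -> inj_pow X m :=
  match m return idx J m -> inj_pow X m with
  | 0 => x
  | m'.+1 => fun I => elem_tensor (inj_vec x I.1) (x I.2)
  end.

Fixpoint proj_fun Y (y : J -> Y -> K^o) (m : nat) : idx J m -> proj_pow Y m -> K^o :=
  match m return idx J m -> proj_pow Y m -> K^o with
  | 0 => y
  | m'.+1 => fun I => tensor_lift (fun u v => proj_fun y I.1 u * y I.2 v : K^o)
  end.

(** A linear image of a tensor of scalars; each variable contributes the norm of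
    the map from l_2^J that sends the basis to x, i.e. the weak norm of x. *)
Lemma inj_vec_le X (x : J -> X) m (c : idx J m -> K) M : inj_le c M ->
  snorm (\sum_I c I *: inj_vec x I) <= weak_l2 (fam x) ^+ m.+1 * M.
Proof.
elim: m c M => [|m ih] c M cM.
  have [g [g1 <-]] := norming_functional (\sum_j c j *: x j).
  rewrite (le_trans (ler_norm _))// (le_trans (re_le_modulus _))//.
  rewrite (lin_comb (@dual_linear _ _ _ g)).
  rewrite (le_trans (inj_le0 _ cM))// expr1.
  rewrite ler_wpM2r ?(inj_le_ge0 cM)//; exact: weak_fam_ge.
apply: inj_norm_le => al be al1 be1.
have bil := tensor_pairing_linear al be.
rewrite (lin_comb bil).
pose b j := be (x j).
have -> : \sum_I c I *: tensor_pairing al be (@inj_vec X x m.+1 I) =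
    al (\sum_I (\sum_j c (I, j) * b j) *: inj_vec x I).
  rewrite (lin_comb (@dual_linear _ _ _ al)) (@sum_idxS J K m).
  apply: eq_bigr => I _; rewrite scaler_suml; apply: eq_bigr => j _.
  rewrite /tensor_pairing tensor_lift_elem; last exact: tensor_pairing_bilinear.
  by rewrite !scaleoE -mulrA [al _ * _]mulrC.
rewrite (le_trans (ler_dual al _))// (le_trans (ler_piMl (snorm_ge0 _) al1))//.
apply: (le_trans (ih _ _ (inj_leS b cM))).
rewrite [X in _ <= X * _]exprSr -mulrA ler_wpM2l ?exprn_ge0 ?weak_l2_ge0//.
rewrite ler_wpM2r ?(inj_le_ge0 cM)//; exact: weak_fam_ge.
Qed.

Section ProjFun.
Variables (Y : seminormed R F) (y : J -> dual Y).
Let y' j : Y -> K^o := y j.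

Lemma proj_fun_linear m (I : idx J m) : linear (proj_fun y' I).
Proof.
elim: m I => [|m ih] I; first exact: dual_linear.
by apply/tensor_lift_linear/mul_bilinear => //; exact: dual_linear.
Qed.

Lemma proj_funS_elem m (I : idx J m) j u v :
  @proj_fun Y y' m.+1 (I, j) (elem_tensor u v) = proj_fun y' I u * y j v.
Proof.
apply: tensor_lift_elem; apply: mul_bilinear; last exact: dual_linear.
exact: proj_fun_linear.
Qed.

(** The same bound for functionals: evaluating on an elementary tensor contracts
    the last variable, and the projective norm is an infimum over sums of
    elementary tensors. *)
Lemma proj_fun_le m (c : idx J m -> K) M (v : proj_pow Y m) : inj_le c M ->
  modulus (\sum_I c I * proj_fun y' I v) <= weak_l2 (fam y) ^+ m.+1 * M * snorm v.
Proof.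
elim: m c M v => [|m ih] c M v cM.
  rewrite (le_trans (inj_le0 _ cM))// expr1 mulrAC.
  by rewrite ler_wpM2r ?(inj_le_ge0 cM)// weak_eval_le.
have M0 := inj_le_ge0 cM.
have W0 := weak_l2_ge0 (fam y).
have wM0 : 0 <= weak_l2 (fam y) ^+ m.+2 * M.
  by apply: mulr_ge0 => //; exact: exprn_ge0.
have key (s : seq (proj_pow Y m * Y)) : v = \sum_(p <- s) elem_tensor p.1 p.2 ->
    modulus (\sum_I c I * proj_fun y' I v) <=
    weak_l2 (fam y) ^+ m.+2 * M * \sum_(p <- s) snorm p.1 * snorm p.2.
  move=> vs.
  have -> : \sum_I c I * proj_fun y' I v = \sum_(p <- s) \sum_(I : idx J m)
      (\sum_j c (I, j) * y j p.2) * proj_fun y' I p.1.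
    transitivity (\sum_(p <- s) \sum_I c I * @proj_fun Y y' m.+1 I (elem_tensor p.1 p.2)).
      rewrite exchange_big; apply: eq_bigr => I _; rewrite -mulr_sumr.
      by rewrite vs (lin_sum (@proj_fun_linear m.+1 I)).
    apply: eq_bigr => p _; rewrite (@sum_idxS J K m); apply: eq_bigr => I _.
    rewrite mulr_suml; apply: eq_bigr => j _.
    by rewrite proj_funS_elem mulrAC mulrA.
  rewrite (le_trans (modulus_sum _ _))// mulr_sumr; apply: ler_sum => p _.
  apply: (le_trans (ih _ _ _ (inj_leS (fun j => y j p.2) cM))).
  rewrite [leRHS]mulrCA [leRHS]mulrC ler_wpM2r ?snorm_ge0//.
  rewrite [X in _ <= X * _ * _]exprSr -!mulrA ler_wpM2l ?exprn_ge0//.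
  rewrite [M * _]mulrC mulrA ler_wpM2r//.
  exact: weak_eval_le.
have [w0|w0] := eqVneq (weak_l2 (fam y) ^+ m.+2 * M) 0.
  have [s vs] := tensor_sum_elem v.
  by have := key s vs; rewrite w0 !mul0r.
have wp : 0 < weak_l2 (fam y) ^+ m.+2 * M by rewrite lt_def w0.
rewrite -ler_pdivrMl//; apply: lb_le_inf; first by have [] := proj_costs_inf v.
by move=> _ [s vs <-]; rewrite ler_pdivrMl// key.
Qed.

Lemma proj_fun_diag (u : J -> Y) m :
  \sum_(I : idx J m) proj_fun y' I (pow_vec u I) = (\sum_j y j (u j)) ^+ m.+1.
Proof.
elim: m => [|m ih]; first by rewrite expr1.
rewrite exprSr -ih mulr_suml (@sum_idxS J K m); apply: eq_bigr => I _.
by rewrite mulr_sumr; apply: eq_bigr => j _; rewrite proj_funS_elem.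
Qed.

End ProjFun.

Lemma op_pow_inj_vec X Y (phi : X -> Y) (x : J -> X) m (I : idx J m) : linear phi ->
  op_pow phi (inj_vec x I) = pow_vec (fun j => phi (x j)) I.
Proof.
move=> lphi; elim: m I => [//|m ih] I.
by rewrite [LHS](op_powS_elem _ _ lphi) ih.
Qed.

(** For signs e, pair the image of sum_I e_I x_I with the functional
    sum_I e_I y_I. On average over e only the diagonal terms survive, and they
    add up to the power of the trace sum_j y_j (phi x_j). On the other hand each
    pairing is at most the norm of the tensor power times the square of the
    injective norm of e, which is subexponential on average. *)
Lemma trace_le_op_pow X Y (phi : X -> Y) (rho : R) : linear phi -> 1 < rho ->
  exists2 c : R, 0 < c & forall (x : J -> X) (y : J -> dual Y) m N, 0 <= N ->
    (forall z : inj_pow X m, snorm (op_pow phi z) <= N * snorm z) ->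
    modulus (\sum_j y j (phi (x j))) ^+ m.+1 <=
      N * (weak_l2 (fam x) * weak_l2 (fam y)) ^+ m.+1 * (c * rho ^+ m.+1).
Proof.
move=> lphi rho1; have [c c0 cP] := random_signs F J rho1.
exists c => // x y m N N0 phiN; have [V [V0 VM VS]] := cP m.
pose E := {ffun idx J m -> bool}.
pose y' j : Y -> K^o := y j.
pose z (e : E) : inj_pow X m := \sum_I (-1) ^+ e I *: inj_vec x I.
pose P (e : E) : K := \sum_I (-1) ^+ e I * proj_fun y' I (op_pow phi (z e)).
have PV e : modulus (P e) <= N * (weak_l2 (fam x) * weak_l2 (fam y)) ^+ m.+1 * V e.
  apply: (le_trans (proj_fun_le _ _ (VM e))).
  have zle := inj_vec_le x (VM e).
  have s0 : 0 <= weak_l2 (fam y) ^+ m.+1 * Num.sqrt (V e).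
    by rewrite mulr_ge0 ?exprn_ge0 ?weak_l2_ge0 ?sqrtr_ge0.
  apply: (le_trans (ler_wpM2l s0 (phiN _))).
  apply: (le_trans (ler_wpM2l s0 (ler_wpM2l N0 zle))).
  rewrite -[V e in leRHS]sqr_sqrtr// exprMn le_eqVlt; apply/orP; left.
  by apply/eqP; ring.
have PE : \sum_e P e = #|E|%:R * (\sum_j y j (phi (x j))) ^+ m.+1.
  pose A (I I' : idx J m) := proj_fun y' I (pow_vec (fun j => phi (x j)) I').
  have PA e : P e = \sum_I \sum_I' ((-1) ^+ e I * (-1) ^+ e I') * A I I'.
    apply: eq_bigr => I _; rewrite /z (lin_comb (op_pow_linear lphi)).
    rewrite (lin_comb (proj_fun_linear y I)) mulr_sumr; apply: eq_bigr => I' _.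
    by rewrite scaleoE mulrA op_pow_inj_vec.
  under eq_bigr do rewrite PA.
  rewrite exchange_big -proj_fun_diag mulr_sumr; apply: eq_bigr => I _.
  rewrite exchange_big (bigD1 I)//= [X in _ + X]big1 ?addr0.
    by rewrite -mulr_suml sum_sign_orth eqxx mul1r.
  move=> I' II'; rewrite -mulr_suml sum_sign_orth eq_sym (negbTE II').
  by rewrite !mul0r.
have E0 : 0 < #|E|%:R :> R.
  by rewrite ltr0n card_ffun card_bool expn_gt0.
rewrite -(ler_pM2l E0).
have -> : #|E|%:R * modulus (\sum_j y j (phi (x j))) ^+ m.+1 = modulus (\sum_e P e).
  rewrite PE modulusM modulusX; congr (_ * _).
  by rewrite -[#|E|%:R in RHS](rmorph_nat (@emb R F)) modulus_emb ger0_norm.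
rewrite (le_trans (modulus_sum _ _))// (le_trans (ler_sum _ (fun e _ => PV e)))//.
rewrite -mulr_sumr mulrCA ler_wpM2l//.
by rewrite mulr_ge0// exprn_ge0// mulr_ge0// weak_l2_ge0.
Qed.

End LowerBound.
(** * Hilbert completion of a semi-inner product space *)

Section SequentialCompleteness.
Variables (R : realType) (F : base_field).
Local Notation K := (scalar_field R F).

Definition invS (n : nat) : R := n.+1%:R^-1.

Lemma invS_gt0 n : 0 < invS n.
Proof. by rewrite invr_gt0 ltr0n. Qed.

Lemma invS_le (d : R) : 0 < d -> exists n, invS n <= d.
Proof.
move=> d0; exists (Num.truncn d^-1).
rewrite -[leRHS]invrK lef_pV2 ?posrE ?invr_gt0 ?ltr0n//.
by rewrite ltW// truncnS_gt.
Qed.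

(** All limits below are taken through explicit rates of the form C d. *)
Lemma le0_of_small (x C : R) : (forall d, 0 < d -> x <= C * d) -> x <= 0.
Proof.
move=> h; rewrite leNgt; apply/negP => x0.
have C0 : 0 < C by have := h 1 ltr01; lra.
have := h (x / (2 * C)) ltac:(by rewrite divr_gt0// mulr_gt0).
have -> : C * (x / (2 * C)) = x / 2 by field; rewrite gt_eqF.
lra.
Qed.

(** Completeness in a form that keeps track of the rate of convergence. *)
Definition seq_complete (Y : seminormed R F) :=
  forall (a : nat -> Y) (B : R), 0 <= B ->
    (forall n m, snorm (a n - a m) <= B * (invS n + invS m)) ->
    exists l, forall n, snorm (a n - l) <= 2 * B * invS n.

Definition separated (Y : seminormed R F) := forall y : Y, snorm y = 0 -> y = 0.

Lemma snormN (Y : seminormed R F) (y : Y) : snorm (- y) = snorm y.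
Proof. by rewrite -scaleN1r snormZ modulusN modulus1 mul1r. Qed.

Lemma snormB (Y : seminormed R F) (y y' : Y) : snorm (y - y') = snorm (y' - y).
Proof. by rewrite -opprB snormN. Qed.

Lemma separated_eq (Y : seminormed R F) (y y' : Y) C : separated Y ->
  (forall d, 0 < d -> snorm (y - y') <= C * d) -> y = y'.
Proof.
move=> sY /le0_of_small h; apply/eqP; rewrite -subr_eq0; apply/eqP/sY.
by apply/le_anti; rewrite h snorm_ge0.
Qed.

(** The intervals of radius B / (n+1) around a_n meet pairwise, hence have a
    common point. *)
Lemma real_seq_complete (a : nat -> R) (B : R) :
  (forall n m, `|a n - a m| <= B * (invS n + invS m)) ->
  exists l, forall n, `|a n - l| <= B * invS n.
Proof.
move=> aB; pose S := [set a n - B * invS n | n in setT].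
have le n m : a n - B * invS n <= a m + B * invS m.
  by have := aB n m; rewrite mulrDr ler_norml => /andP[_]; lra.
have hS : has_sup S.
  split; first by exists (a 0%N - B * invS 0), 0%N.
  by exists (a 0%N + B * invS 0) => _ [n _ <-].
exists (sup S) => n; rewrite ler_norml; apply/andP; split.
  have : sup S <= a n + B * invS n.
    by apply: ge_sup; [case: hS|move=> _ [m _ <-]].
  lra.
have : a n - B * invS n <= sup S by apply: sup_upper_bound => //; exists n.
lra.
Qed.

Fact scalar_snormZ (a : K) (b : K^o) : modulus (a *: b : K) <= modulus a * modulus (b : K).
Proof. by rewrite modulusM. Qed.

Definition scalar_seminormed : seminormed R F :=
  @Seminormed R F K^o (@modulus R F) (@modulus_ge0 R F) (@modulusD R F) scalar_snormZ.

Lemma scalar_separated : separated scalar_seminormed.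
Proof. exact: modulus0_eq0. Qed.

Lemma scalar_seq_complete : seq_complete scalar_seminormed.
Proof.
move=> a B B0 aB.
have [|r rP] := @real_seq_complete (fun n => re (a n : K)) B.
  by move=> n m; rewrite -raddfB (le_trans (re_le_modulus _))// aB.
have [|s sP] := @real_seq_complete (fun n => im (a n : K)) B.
  by move=> n m; rewrite -raddfB (le_trans (im_le_modulus _))// aB.
have s0 : F = Reals -> s = 0.
  move=> FR; apply: normr0_eq0; apply/le_anti; rewrite normr_ge0 andbT.
  apply: (@le0_of_small _ B) => d d0; have [n nd] := invS_le d0.
  have := sP n; rewrite im_Reals// sub0r normrN => /le_trans; apply.
  by rewrite ler_wpM2l.
exists (mk r s) => n; rewrite [snorm _](_ : _ = modulus (a n - mk r s : K))//.
rewrite (le_trans (modulus_le_reim _))// [re _]raddfB [im _]raddfB /= re_mk im_mk//.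
have := rP n; have := sP n; lra.
Qed.

Lemma banach_separated (Y : completeNormedModType K) : separated (of_normed Y).
Proof.
move=> y /= y0; apply: normr0_eq0; apply: scalar_ext; first by rewrite re0.
have : 0 <= `|y : Y| by []. 
by rewrite ge0_scalar => /andP[/eqP-> _]; rewrite raddf0.
Qed.

Lemma normE_banach (Y : completeNormedModType K) (y : of_normed Y) :
  `|y : Y| = emb (snorm y).
Proof.
apply: scalar_ext; first by rewrite re_emb.
have : 0 <= `|y : Y| by [].
by rewrite ge0_scalar im_emb => /andP[/eqP].
Qed.

Lemma banach_seq_complete (Y : completeNormedModType K) : seq_complete (of_normed Y).
Proof.
move=> a B B0 aB; pose u : nat -> Y := a.
have ltE (e : K) : 0 < e -> exists2 d : R, 0 < d & e = emb d.
  move=> e0; have := ltW e0; rewrite ge0_scalar => /andP[/eqP i0 r0].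
  have eE : e = emb (re e) by apply: scalar_ext; rewrite ?re_emb ?im_emb.
  exists (re e) => //; rewrite lt_def r0 andbT.
  by apply: contra_ltN e0 => /eqP r00; rewrite eE r00 rmorph0.
have lt_emb (x y : R) : (emb x < emb y :> K) = (x < y).
  by rewrite !lt_neqAle ler_emb (inj_eq (fmorph_inj (@emb R F))).
have small d : 0 < d -> exists n, forall m, (n <= m)%N -> B * invS m < d.
  move=> d0; have [n nd] := invS_le (divr_gt0 d0 (ltr_wpDl B0 ltr01)).
  exists n => m nm; apply: (@le_lt_trans _ _ (B * invS n)).
    by rewrite ler_wpM2l// lef_pV2 ?posrE ?ltr0n// ler_nat ltnS.
  have B1 : 0 < B + 1 by lra.
  move: nd; rewrite ler_pdivlMr//; have := invS_gt0 n; nra.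
have cu : cauchy (u @ \oo).
  apply/cauchyP => e /ltE[d d0 ->].
  have [n nP] := small (d / 2) ltac:(lra).
  exists (u n); exists n => // m /= nm.
  rewrite -ball_normE /ball_ /= normE_banach lt_emb.
  apply: le_lt_trans (aB n m) _; rewrite mulrDr.
  by have := nP n (leqnn _); have := nP m nm; lra.
have /cvg_ex[l ul] : cvg (u @ \oo) by apply: cauchy_cvg.
exists l => n; apply/ler_addgt0Pr => d d0.
have e0 : 0 < emb d :> K by rewrite -(rmorph0 (@emb R F)) lt_emb.
have /cvgrPdist_lt/(_ _ e0)[N _ NP] := ul.
pose m := maxn N n.
have := NP m (leq_maxl _ _); rewrite /= normE_banach lt_emb => lm.
have := ler_snormD (a n - a m) (a m - (l : of_normed Y)).
rewrite addrA subrK => /le_trans; apply.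
apply: lerD; last by rewrite snormB ltW.
apply: (le_trans (aB n m)); rewrite -mulrA mulrCA ler_wpM2l//.
have : invS m <= invS n.
  by rewrite lef_pV2 ?posrE ?ltr0n// ler_nat ltnS leq_max leqnn orbT.
lra.
Qed.

End SequentialCompleteness.

(** Bundling the form with its axioms lets the completion, a type that depends
    on them, carry canonical algebraic structures. *)
Record ipspace (R : realType) (F : base_field) := IPSpace {
  ipcarrier :> lmodType (scalar_field R F);
  ipform : ipcarrier -> ipcarrier -> scalar_field R F;
  ipformP : semi_inner ipform }.

Section Completion.
Variables (R : realType) (F : base_field).
Local Notation K := (scalar_field R F).
Variable X : ipspace R F.
Local Notation G := (@ipform R F X).
Local Notation px := (pn G).
Let GP : semi_inner G := ipformP X.

(** Elements of the completion are realized as the antilinear forms on X that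
    are limits, uniformly on the unit ball, of forms [G x]. *)
Definition approx (h : X -> K^o) (x : X) (d : R) :=
  forall y, modulus (h y - G x y) <= d * px y.

Definition compl_pred : {pred X -> K^o} :=
  [pred h : X -> K^o | `[< forall d, 0 < d -> exists x, approx h x d >]].

Lemma approx_comb a h h' x x' d d' : approx h x d -> approx h' x' d' ->
  approx (a *: h + h') (a *: x + x') (modulus a * d + d').
Proof.
move=> hx hx' y; rewrite !fctE (sipDl GP) (sipZl GP).
have -> : a * h y + h' y - (a * G x y + G x' y) =
  a * (h y - G x y) + (h' y - G x' y) by ring.
rewrite (le_trans (modulusD _ _))// mulrDl lerD// modulusM -mulrA.
by rewrite ler_wpM2l ?modulus_ge0.
Qed.

Lemma approx_le h x d d' : d <= d' -> approx h x d -> approx h x d'.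
Proof.
by move=> dd hx y; rewrite (le_trans (hx y))// ler_wpM2r ?pn_ge0.
Qed.

Fact compl_submod : submod_closed compl_pred.
Proof.
split=> [|a h h' /asboolP hP /asboolP h'P]; apply/asboolP => d d0.
  exists 0 => y; rewrite (sip0l GP) subr0 /= modulus0.
  by rewrite mulr_ge0 ?pn_ge0// ltW.
have a1 : 0 < modulus a + 1 by have := modulus_ge0 a; lra.
have d1 : 0 < d / (modulus a + 1) by rewrite divr_gt0.
have [x hx] := hP _ d1; have [x' hx'] := h'P _ d1.
exists (a *: x + x'); apply: approx_le (approx_comb a hx hx').
by rewrite -[X in _ + X]mul1r -mulrDl mulrC divfK// gt_eqF.
Qed.

HB.instance Definition _ := GRing.isSubmodClosed.Build _ _ compl_pred compl_submod.

Record compl := Compl {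
  compl_fun :> X -> K^o;
  _ : compl_fun \in compl_pred }.

HB.instance Definition _ := [isSub for compl_fun].
HB.instance Definition _ := [Choice of compl by <:].
HB.instance Definition _ := [SubChoice_isSubLmodule of compl by <:].

Implicit Types h g : compl.

Lemma compl_approx h d : 0 < d -> exists x, approx h x d.
Proof. by case: h => h /= /asboolP; exact. Qed.

Fact embed_subproof x : (G x : X -> K^o) \in compl_pred.
Proof.
apply/asboolP => d d0; exists x => y; rewrite subrr modulus0.
by rewrite mulr_ge0 ?pn_ge0// ltW.
Qed.

Definition embed x : compl := Compl (embed_subproof x).

Lemma embed_linear : linear embed.
Proof.
move=> a x y; apply: val_inj; apply/funext => z /=.
by rewrite (sipDl GP) (sipZl GP).
Qed.

Lemma approx_embed x d : 0 <= d -> approx (embed x) x d.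
Proof. by move=> d0 y; rewrite subrr modulus0 mulr_ge0 ?pn_ge0. Qed.

(** The distance of two approximants is computed by testing both forms on their
    difference. *)
Lemma approx_dist (h : X -> K^o) x x' d d' : 0 <= d -> 0 <= d' ->
  approx h x d -> approx h x' d' -> px (x - x') <= d + d'.
Proof.
move=> d0 d'0 hx hx'; set u := x - x'.
have [->|u0] := eqVneq (px u) 0; first exact: addr_ge0.
have up : 0 < px u by rewrite lt_def u0 pn_ge0.
rewrite -(ler_pM2r up) -expr2 mulrDl.
have -> : px u ^+ 2 = modulus ((h u - G x' u) - (h u - G x u)).
  rewrite opprB addrC addrA subrK -(sipBl GP) (sip_pn GP) modulus_emb.
  by rewrite ger0_norm ?sqr_ge0.
by rewrite (le_trans (modulusD _ _))// modulusN addrC lerD.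
Qed.

Lemma approx_embed_dist x x' d : 0 <= d -> approx (embed x) x' d -> px (x - x') <= d.
Proof.
move=> d0 h; rewrite -[leRHS]add0r.
exact: (approx_dist (lexx 0) d0 (approx_embed x (lexx 0)) h).
Qed.

(** Extension by density of a map from X to a complete space. It is used twice:
    to extend the form itself, and to extend a map that is bounded for the
    seminorm of the form. *)
Section Extension.
Variables (Y : seminormed R F) (f : X -> Y).

Definition is_ext h (l : Y) :=
  exists2 B, 0 <= B & forall x d, 0 < d -> approx h x d -> snorm (f x - l) <= B * d.

Definition ext h : Y := xget 0 [set l | is_ext h l].

Variable C : R.
Hypotheses (cY : seq_complete Y) (sY : separated Y) (lf : linear f).
Hypotheses (C0 : 0 <= C) (fC : forall x, snorm (f x) <= C * px x).

Lemma is_ext_ext h : is_ext h (ext h).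
Proof.
apply: (@xgetPex Y 0 [set l | is_ext h l]).
have /choice[x xP] : forall n, exists x, approx h x (invS R n).
  by move=> n; apply: compl_approx; exact: invS_gt0.
have fdist u v : snorm (f u - f v) <= C * px (u - v) by rewrite -(linB lf).
have [|l lP] := cY (a := fun n => f (x n)) C0.
  move=> n m; rewrite (le_trans (fdist _ _))// ler_wpM2l//.
  by apply: (approx_dist _ _ (xP n) (xP m)); exact/ltW/invS_gt0.
exists l => /=; exists (4 * C); first by rewrite mulr_ge0.
move=> u d d0 hu; have [n nd] := invS_le d0.
have -> : f u - l = (f u - f (x n)) + (f (x n) - l) by rewrite addrA subrK.
rewrite (le_trans (ler_snormD _ _))//.
have h1 : snorm (f u - f (x n)) <= C * (d + invS R n).
  rewrite (le_trans (fdist _ _))// ler_wpM2l//.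
  by apply: (approx_dist _ _ hu (xP n)); apply: ltW => //; exact: invS_gt0.
have h2 : C * invS R n <= C * d by rewrite ler_wpM2l.
have := lP n; rewrite mulrDr in h1; lra.
Qed.

Lemma ext_unique h l : is_ext h l -> l = ext h.
Proof.
move=> [B B0 hl]; have [B' B'0 hl'] := is_ext_ext h.
apply: (@separated_eq _ _ _ _ _ (B + B') sY) => d d0.
have [x hx] := compl_approx h d0.
have -> : l - ext h = (l - f x) + (f x - ext h) by rewrite addrA subrK.
rewrite (le_trans (ler_snormD _ _))// mulrDl lerD//.
  by rewrite snormB hl.
exact: hl'.
Qed.

Lemma ext_linear : linear ext.
Proof.
move=> a h h'; symmetry; apply: ext_unique.
have [B B0 hB] := is_ext_ext h; have [B' B'0 hB'] := is_ext_ext h'.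
have a0 := modulus_ge0 a.
exists (C * (modulus a + 2) + (modulus a * B + B')).
  by rewrite addr_ge0// ?addr_ge0 ?mulr_ge0// addr_ge0.
move=> u d d0 hu; have [x hx] := compl_approx h d0; have [x' hx'] := compl_approx h' d0.
have du : px (u - (a *: x + x')) <= d + (modulus a * d + d).
  apply: (approx_dist _ _ hu (approx_comb a hx hx')); first exact: ltW.
  by rewrite addr_ge0 ?mulr_ge0// ltW.
have -> : f u - (a *: ext h + ext h') = f (u - (a *: x + x')) +
    (a *: (f x - ext h) + (f x' - ext h')).
  rewrite (linB lf) lf scalerBr [a *: f x - _ + _]addrACA -opprD addrA subrK//.
rewrite (le_trans (ler_snormD _ _))// [leRHS]mulrDl lerD//.
  rewrite (le_trans (fC _))// -mulrA ler_wpM2l//; apply: (le_trans du); lra.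
rewrite (le_trans (ler_snormD _ _))// [leRHS]mulrDl lerD//; last exact: hB'.
by rewrite snormZ -mulrA ler_wpM2l// hB.
Qed.

Lemma ext_embed x : ext (embed x) = f x.
Proof.
symmetry; apply: ext_unique; exists C => // u d d0 hu.
by rewrite -(linB lf) (le_trans (fC _))// ler_wpM2l// (pnBC GP) (approx_embed_dist (ltW d0)).
Qed.

End Extension.

Lemma compl_antilinear h : linear (fun x => conjs (h x) : K^o).
Proof.
move=> a x y; apply: (@separated_eq R F (scalar_seminormed R F) _ _
  (px (a *: x + y) + (modulus a * px x + px y)) (@scalar_separated R F)) => d d0.
have [z hz] := compl_approx h d0.
rewrite [snorm _](_ : _ = modulus (conjs (h (a *: x + y)) -
  (a * conjs (h x) + conjs (h y))))//.
have -> : conjs (h (a *: x + y)) - (a * conjs (h x) + conjs (h y)) =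
  conjs (h (a *: x + y) - G z (a *: x + y)) -
   (a * conjs (h x - G z x) + conjs (h y - G z y)).
  rewrite (sipDr GP) (sipZr GP) !rmorphB !rmorphD !rmorphM /= conjsK; ring.
rewrite (le_trans (modulusD _ _))// modulusN mulrDl lerD//.
  by rewrite modulus_conjs mulrC hz.
rewrite (le_trans (modulusD _ _))// mulrDl lerD//.
  by rewrite modulusM modulus_conjs -mulrA ler_wpM2l ?modulus_ge0// mulrC hz.
by rewrite modulus_conjs mulrC hz.
Qed.

Lemma compl_bounded h : exists2 B, 0 <= B & forall y, modulus (h y) <= B * px y.
Proof.
have [x hx] := compl_approx h ltr01.
exists (1 + px x) => [|y]; first by rewrite addr_ge0 ?pn_ge0.
have -> : h y = (h y - G x y) + G x y by rewrite subrK.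
by rewrite (le_trans (modulusD _ _))// mulrDl lerD ?hx// (sip_cauchy GP).
Qed.

(** For fixed g the map x |-> conj (g x) extends G (x, g) linearly in x. *)
Definition cip h g : K :=
  @ext (scalar_seminormed R F) (fun x => conjs (g x)) h.

Lemma cipP h g : exists2 B, 0 <= B & forall x d, 0 < d -> approx h x d ->
  modulus (conjs (g x) - cip h g) <= B * d.
Proof.
have [B B0 gB] := compl_bounded g.
apply: (is_ext_ext (@scalar_seq_complete R F) (compl_antilinear g) B0).
by move=> x; rewrite /= modulus_conjs.
Qed.

Lemma cip_linear g : linear (cip^~ g : compl -> K^o).
Proof.
have [B B0 gB] := compl_bounded g.
apply: (ext_linear (@scalar_seq_complete R F) (@scalar_separated R F)
  (compl_antilinear g) B0).
by move=> x; rewrite /= modulus_conjs.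
Qed.

Lemma cip_embedl x g : cip (embed x) g = conjs (g x).
Proof.
have [B B0 gB] := compl_bounded g.
apply: (ext_embed (@scalar_seq_complete R F) (@scalar_separated R F)
  (compl_antilinear g) B0).
by move=> y; rewrite /= modulus_conjs.
Qed.

(** Approximating the second argument costs d times the seminorm of x, which stays
    bounded. Through this joint limit the symmetry and the positivity of G pass
    to [cip]. *)
Lemma cip_limit h g : exists2 B, 0 <= B & forall x y d, 0 < d -> d <= 1 ->
  approx h x d -> approx g y d -> modulus (G x y - cip h g) <= B * d.
Proof.
have [B B0 hB] := cipP h g; have [x0 hx0] := compl_approx h ltr01.
exists (B + (px x0 + 2)); first by rewrite !addr_ge0 ?pn_ge0.
move=> x y d d0 d1 hx gy.
have -> : G x y - cip h g = (conjs (g x) - cip h g) - conjs (g x - G y x).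
  by rewrite rmorphB /= -(sipC GP); ring.
rewrite (le_trans (modulusD _ _))// modulusN mulrDl lerD ?hB// modulus_conjs.
rewrite (le_trans (gy x))// mulrC ler_wpM2r ?(ltW d0)//.
have := approx_dist (ltW d0) ler01 hx hx0.
have := pnD GP (x - x0) x0; rewrite subrK; lra.
Qed.

Lemma cip_semi_inner : semi_inner cip.
Proof.
split=> [g|h g|h]; first exact: cip_linear.
- have [B B0 hB] := cip_limit h g; have [B' B'0 hB'] := cip_limit g h.
  apply/eqP; rewrite -subr_eq0; apply/eqP/modulus0_eq0/le_anti.
  rewrite modulus_ge0 andbT; apply: (@le0_of_small R _ (B + B')) => d d0.
  pose e := Num.min d 1.
  have e0 : 0 < e by rewrite lt_min d0 ltr01.
  have e1 : e <= 1 by rewrite ge_min lexx orbT.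
  have [x hx] := compl_approx h e0; have [y gy] := compl_approx g e0.
  have -> : cip g h - conjs (cip h g) =
     conjs (G x y - cip h g) - (G y x - cip g h).
    by rewrite rmorphB /= -(sipC GP); ring.
  apply: (@le_trans _ _ ((B + B') * e)).
    rewrite (le_trans (modulusD _ _))// modulusN modulus_conjs mulrDl.
    by rewrite lerD ?hB ?hB'.
  by rewrite ler_wpM2l ?addr_ge0// ge_min lexx.
have [B B0 hB] := cip_limit h h.
have key d : 0 < d -> exists x, modulus (G x x - cip h h) <= B * d.
  move=> d0; pose e := Num.min d 1.
  have e0 : 0 < e by rewrite lt_min d0 ltr01.
  have e1 : e <= 1 by rewrite ge_min lexx orbT.
  have [x hx] := compl_approx h e0; exists x.
  by rewrite (le_trans (hB x x e e0 e1 hx hx))// ler_wpM2l// ge_min lexx.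
rewrite ge0_scalar; apply/andP; split.
  apply/eqP/normr0_eq0/le_anti; rewrite normr_ge0 andbT.
  apply: (@le0_of_small R _ B) => d /key[x]; apply: le_trans.
  apply: le_trans (im_le_modulus _); rewrite raddfB (sip_pn GP) /= im_emb.
  by rewrite sub0r normrN.
rewrite -oppr_le0; apply: (@le0_of_small R _ B) => d /key[x]; apply: le_trans.
apply: le_trans (re_le_modulus _); apply: le_trans (ler_norm _).
by rewrite raddfB /= lerDr (re_sip_ge0 GP).
Qed.

Let cP := cip_semi_inner.

Local Notation cn := (pn cip).

Lemma cip_embed x y : cip (embed x) (embed y) = G x y.
Proof. by rewrite cip_embedl /= -(sipC GP). Qed.

Lemma cn_embed x : cn (embed x) = px x.
Proof. by rewrite /pn cip_embed. Qed.

Lemma compl_le h y : modulus (h y) <= cn h * px y.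
Proof.
by rewrite -modulus_conjs -cip_embedl mulrC -cn_embed (sip_cauchy cP).
Qed.

(** The norm of [h - embed x] is the limit of the seminorms of its approximants,
    which are at most d in the limit since 0 is itself an approximant of rate d. *)
Lemma approx_cn h x d : 0 <= d -> approx h x d -> cn (h - embed x) <= d.
Proof.
move=> d0 hx; set g := h - embed x.
have gE y : g y = h y - G x y by [].
have [B B0 gB] := cip_limit g g.
apply/ler_addgt0Pr => e e0.
suff : cn g ^+ 2 <= (d + e) ^+ 2.
  by rewrite ler_sqr ?nnegrE ?pn_ge0 ?addr_ge0// ltW.
apply/ler_addgt0Pr => e' e'0.
pose t := Num.min (Num.min e 1) (e' / (B + 1)).
have B1 : 0 < B + 1 by lra.
have t0 : 0 < t by rewrite !lt_min e0 ltr01 divr_gt0.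
have t1 : t <= 1 by rewrite !ge_min lexx orbT.
have te : t <= e by rewrite !ge_min lexx.
have te' : (B + 1) * t <= e' by rewrite mulrC -ler_pdivlMr// !ge_min lexx orbT.
have [u gu] := compl_approx g t0.
have pu : px u <= d + t.
  have gd : approx g 0 d by move=> y; rewrite gE (sip0l GP) subr0 hx.
  by have := approx_dist (ltW t0) d0 gu gd; rewrite subr0 addrC.
have := gB u u t t0 t1 gu gu; rewrite modulusB => h1.
have : cn g ^+ 2 <= px u ^+ 2 + B * t.
  rewrite (pn_sqr cP) (pn_sqr GP) -lerBlDl -raddfB.
  exact: le_trans (ler_norm _) (le_trans (re_le_modulus _) h1).
have : px u ^+ 2 <= (d + e) ^+ 2.
  by rewrite ler_sqr ?nnegrE ?pn_ge0 ?addr_ge0 ?(ltW e0)// (le_trans pu)// lerD2l.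
lra.
Qed.

Lemma cn_le h M : 0 <= M -> (forall y, modulus (h y) <= M * px y) -> cn h <= M.
Proof.
move=> M0 hM; have := @approx_cn h 0 M M0.
have -> : embed 0 = 0 by rewrite (lin0 embed_linear).
by rewrite subr0; apply=> y; rewrite (sip0l GP) subr0.
Qed.

Lemma cn_eq0 h : cn h = 0 -> h = 0.
Proof.
move=> h0; apply: val_inj; apply/funext => y; apply: modulus0_eq0.
by apply/le_anti; rewrite modulus_ge0 andbT (le_trans (compl_le _ _))// h0 mul0r.
Qed.

Let cnK h : K := emb (cn h).

Fact cnK_D h g : cnK (h + g) <= cnK h + cnK g.
Proof. by rewrite /cnK -raddfD ler_emb (pnD cP). Qed.

Fact cnK_Z a h : cnK (a *: h) = `|a| * cnK h.
Proof. by rewrite /cnK normE -rmorphM (pnZ cP). Qed.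

Fact cnK_eq0 h : cnK h = 0 -> h = 0.
Proof. by move=> h0; apply: cn_eq0; rewrite -[cn h](re_emb F) -/(cnK h) h0 re0. Qed.

HB.instance Definition _ := Lmodule_isNormed.Build K compl cnK_D cnK_Z cnK_eq0.

Lemma compl_normE h : `|h| = emb (cn h). Proof. by []. Qed.

(** The centres h_n of small balls of the filter converge uniformly on the unit
    ball; their limit is again approximated by forms [G x], with three times the
    error of h_n. *)
Fact compl_complete (Fi : set_system compl) : ProperFilter Fi -> cauchy Fi -> cvg Fi.
Proof.
move=> FF /cauchyP cF.
have emb_gt0 (d : R) : 0 < d -> 0 < emb d :> K.
  move=> d0; rewrite lt_neqAle -(rmorph0 (@emb R F)) ler_emb (ltW d0) andbT.
  by rewrite (inj_eq (fmorph_inj _)) eq_sym gt_eqF.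
have lt_embE (x y : R) : emb x < emb y :> K -> x < y.
  by rewrite !lt_neqAle ler_emb (inj_eq (fmorph_inj (@emb R F))).
have /choice[h hP] : forall n, exists h, Fi (ball h (emb (invS R n) : K)).
  by move=> n; apply: cF; apply: emb_gt0; exact: invS_gt0.
have near n : Fi [set g | cn (h n - g) < invS R n].
  by apply: filterS (hP n) => g; rewrite -ball_normE => /lt_embE.
have hdist n m : cn (h n - h m) <= invS R n + invS R m.
  have [g [/= gn gm]] := filter_ex (filterI (near n) (near m)).
  have -> : h n - h m = (h n - g) - (h m - g) by rewrite opprB addrA subrK.
  by rewrite (le_trans (pnD cP _ _))// (pnN cP) lerD// ltW.
have /choice[l lP] : forall y, exists l : K, forall n,
    modulus (h n y - l) <= 2 * px y * invS R n.
  move=> y; have [] := @scalar_seq_complete R F (fun n => h n y) (px y) (pn_ge0 _ _).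
    move=> n m; have := compl_le (h n - h m) y => /le_trans; apply.
    by rewrite mulrC ler_wpM2l ?pn_ge0.
  by move=> l lP; exists l.
have lc : (l : X -> K^o) \in compl_pred.
  apply/asboolP => d d0; have [n nd] := invS_le (divr_gt0 d0 (ltr0n R 3)).
  have [x hx] := compl_approx (h n) (invS_gt0 R n).
  exists x => y; have -> : l y - G x y = (h n y - G x y) - (h n y - l y) by ring.
  rewrite (le_trans (modulusD _ _))// modulusN.
  have h1 := hx y; have h2 := lP y n.
  have : 3 * invS R n * px y <= d * px y.
    by rewrite ler_wpM2r ?pn_ge0// mulrC -ler_pdivlMr.
  lra.
pose L := Compl lc.
have hL n : cn (h n - L) <= 2 * invS R n.
  apply: cn_le; first by rewrite mulr_ge0// ltW// invS_gt0.
  by move=> y; rewrite mulrAC; exact: lP.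
apply/cvg_ex; exists L; apply/fcvgrPdist_lt => e e0.
have eE : e = emb (re e).
  by have := ltW e0; rewrite ge0_scalar => /andP[/eqP i0 _];
    apply: scalar_ext; rewrite ?re_emb ?im_emb.
have re0 : 0 < re e by apply: lt_embE; rewrite -eE rmorph0.
have [n nd] := invS_le (divr_gt0 re0 (ltr0n R 4)).
apply: filterS (near n) => g /= hg.
rewrite compl_normE eE lt_neqAle ler_emb (inj_eq (fmorph_inj _)) -lt_neqAle.
have -> : L - g = (h n - g) - (h n - L) by rewrite opprB [RHS]addrC addrA subrK.
apply: le_lt_trans (pnD cP _ _) _; rewrite (pnN cP).
have := hL n; have : invS R n * 4 <= re e by rewrite -ler_pdivlMr.
have := invS_gt0 R n; lra.
Qed.

HB.instance Definition _ := Uniform_isComplete.Build compl compl_complete.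

Definition hilbert_completion : completeNormedModType K := compl.

Lemma snorm_completion (h : of_normed hilbert_completion) : snorm h = cn h.
Proof. exact: re_emb. Qed.

Lemma hilbert_completionP : hilbert hilbert_completion.
Proof.
have zl y : zmod_morphism (cip^~ y) by move=> h g; exact: sipBl.
have zr h : zmod_morphism (cip h) by move=> g g'; exact: sipBr.
have sl y : scalable_for *%R (cip^~ y) by move=> a h; exact: sipZl.
have sr h : scalable_for (@conjs R F \; *%R) (cip h) by move=> a g; exact: sipZr.
pose b := isBilinear.Build K compl compl K *%R (@conjs R F \; *%R) cip zl zr sl sr.
have hs h g : cip h g = (-1) ^+ false * conjs (cip g h).
  by rewrite expr0 mul1r; exact: sipC.
pose s := isHermitianSesquilinear.Build K compl false (@conjs R F) cip hs.
have dp h : h != 0 -> 0 < cip h h.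
  move=> h0; rewrite lt_neqAle; case: cP => _ _ ->; rewrite andbT eq_sym.
  apply: contra_neq h0 => h0; apply: cn_eq0.
  by rewrite /pn h0 raddf0 sqrtr0.
pose d := isDotProduct.Build K compl cip dp.
pose D : {dot hilbert_completion for @conjs R F} := HB.pack cip b s d.
exists D => h; rewrite /= compl_normE -rmorphXn (sip_pn cP).
by [].
Qed.

End Completion.
(** * Finitely additive means and the forms they induce *)

Section BoundedFunctions.
Variables (R : realType) (D : Type).

Definition bounded_fun (h : D -> R) := exists M, forall d, `|h d| <= M.

Definition bfun_pred : {pred D -> R^o} := [pred h : D -> R^o | `[< bounded_fun h >]].

Fact bfun_submod : submod_closed bfun_pred.
Proof.
split=> [|a h h' /asboolP[M hM] /asboolP[M' hM']]; apply/asboolP.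
  by exists 0 => d; rewrite normr0.
exists (`|a| * M + M') => d; rewrite (le_trans (ler_normD _ _))// lerD//.
by rewrite normrM ler_wpM2l.
Qed.

HB.instance Definition _ := GRing.isSubmodClosed.Build _ _ bfun_pred bfun_submod.
Record bfun := BFun { bfun_fun :> D -> R^o; _ : bfun_fun \in bfun_pred }.
HB.instance Definition _ := [isSub for bfun_fun].
HB.instance Definition _ := [Choice of bfun by <:].
HB.instance Definition _ := [SubChoice_isSubLmodule of bfun by <:].

Lemma bfunP (h : bfun) : bounded_fun h.
Proof. by case: h => h /= /asboolP. Qed.

(** Hahn-Banach for the sublinear functional inf over W of sup (h + w), which is
    finite because no member of W has a negative supremum. The mean is finitely
    additive, which is enough for it to induce a Hilbertian seminorm. *)
Lemma mean_nonneg_on_cone (W : set (D -> R)) :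
  (forall w, W w -> bounded_fun w) -> W (fun=> 0) ->
  (forall w w', W w -> W w' -> W (fun d => w d + w' d)) ->
  (forall t w, 0 < t -> W w -> W (fun d => t * w d)) ->
  (forall w M, W w -> (forall d, w d <= M) -> 0 <= M) ->
  exists l : (D -> R) -> R, [/\
    forall h h', bounded_fun h -> bounded_fun h' ->
      l (fun d => h d + h' d) = l h + l h',
    forall t h, bounded_fun h -> l (fun d => t * h d) = t * l h,
    forall h M, bounded_fun h -> (forall d, h d <= M) -> l h <= M &
    forall w, W w -> 0 <= l w].
Proof.
move=> Wb W0 WD WZ WM.
pose S (h : bfun) := [set M | exists2 w, W w & forall d, h d + w d <= M].
have iS h : has_inf (S h).
  have [B hB] := bfunP h; split.
    exists B; exists (fun=> 0) => // d.
    by rewrite addr0 (le_trans (ler_norm _)).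
  exists (- B) => M [w Ww hM].
  have : 0 <= M + B; last by lra.
  apply: (WM w) => // d; have := hM d; have := hB d.
  by rewrite ler_norml => /andP[]; lra.
have leS h M : S h M -> inf (S h) <= M.
  by move=> hM; apply: ge_inf => //; case: (iS h).
have sS : sublinear (fun h : bfun => inf (S h)).
  split=> [h h'|t h t0].
    rewrite -lerBlDr; apply: lb_le_inf; first by case: (iS h).
    move=> M [w Ww hM]; rewrite lerBlDr -lerBlDl.
    apply: lb_le_inf; first by case: (iS h').
    move=> M' [w' Ww' hM']; rewrite lerBlDl; apply: leS.
    exists (fun d => w d + w' d); first exact: WD.
    by move=> d; have := hM d; have := hM' d; have -> : (h + h') d = h d + h' d by []; lra.
  rewrite -ler_pdivrMl//; apply: lb_le_inf; first by case: (iS h).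
  move=> M [w Ww hM]; rewrite ler_pdivrMl//; apply: leS.
  exists (fun d => t * w d); first exact: WZ.
  move=> d; have -> : (t *: h) d = t * h d by [].
  by rewrite -mulrDr ler_wpM2l// ltW.
have [l [lS _]] := hahn_banach 0 sS.
have bP (h : D -> R) : bounded_fun h -> (h : D -> R^o) \in bfun_pred.
  by move=> hb; apply/asboolP.
pose L (h : D -> R) : R :=
  if pselect (bounded_fun h) is left hb then l (BFun (bP h hb)) else 0.
have LE (h : bfun) : L h = l h.
  rewrite /L; case: pselect => [hb|]; last by have := bfunP h.
  by congr (l _); exact: val_inj.
have LB (h : D -> R) (hb : bounded_fun h) : L h = l (BFun (bP h hb)) by rewrite -LE.
have Lle h M : bounded_fun h -> (forall d, h d <= M) -> L h <= M.
  move=> hb hM; rewrite (LB h hb); apply: le_trans (lS _) _; apply: leS.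
  by exists (fun=> 0) => // d; rewrite addr0; exact: hM.
have LD h h' : bounded_fun h -> bounded_fun h' ->
    L (fun d => h d + h' d) = L h + L h'.
  move=> hb hb'; rewrite (LB h hb) (LB h' hb'); set b := BFun _; set b' := BFun _.
  have <- : l (b + b') = l b + l b' by exact: raddfD.
  rewrite -LE.
  by congr L; apply/funext.
have LZ t h : bounded_fun h -> L (fun d => t * h d) = t * L h.
  move=> hb; rewrite (LB h hb); set b := BFun _.
  have <- : l (t *: b) = t * l b by exact: linearZ.
  by rewrite -LE; congr L; apply/funext.
exists L; split=> // w Ww; have wb := Wb _ Ww.
rewrite (LB w wb); set b := BFun _.
have : l (- b) <= 0.
  apply: le_trans (lS _) _; apply: leS; exists w => // d.
  have -> : (- b) d + w d = 0 by exact: addNr.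
  by [].
by rewrite raddfN; lra.
Qed.

End BoundedFunctions.

Section Mean.
Variables (R : realType) (F : base_field) (D : Type) (l : (D -> R) -> R).
Local Notation K := (scalar_field R F).
Hypothesis lD : forall h h', bounded_fun h -> bounded_fun h' ->
  l (fun d => h d + h' d) = l h + l h'.
Hypothesis lZ : forall t h, bounded_fun h -> l (fun d => t * h d) = t * l h.
Hypothesis lle : forall h M, bounded_fun h -> (forall d, h d <= M) -> l h <= M.

Lemma mean0 : l (fun=> 0) = 0.
Proof.
have b0 : bounded_fun ((fun=> 0) : D -> R) by exists 0 => d; rewrite normr0.
rewrite -[RHS](mul0r (l (fun=> 0))) -lZ//; congr l.
by apply/funext => d; rewrite mul0r.
Qed.

Lemma mean_ge0 h : bounded_fun h -> (forall d, 0 <= h d) -> 0 <= l h.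
Proof.
move=> hb h0; have [M hM] := hb.
have : l (fun d => -1 * h d) <= 0.
  apply: lle => [|d]; last by rewrite mulN1r oppr_le0.
  by exists M => d; rewrite mulN1r normrN.
by rewrite lZ// mulN1r oppr_le0.
Qed.

Definition boundedK (h : D -> K) := exists M, forall d, modulus (h d) <= M.

Lemma boundedK_re h : boundedK h -> bounded_fun (fun d => re (h d)).
Proof. by move=> [M hM]; exists M => d; rewrite (le_trans (re_le_modulus _)). Qed.
Lemma boundedK_im h : boundedK h -> bounded_fun (fun d => im (h d)).
Proof. by move=> [M hM]; exists M => d; rewrite (le_trans (im_le_modulus _)). Qed.

Definition meanK (h : D -> K) : K := mk (l (fun d => re (h d))) (l (fun d => im (h d))).

Lemma re_meanK h : re (meanK h) = l (fun d => re (h d)).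
Proof. exact: re_mk. Qed.

Lemma im_meanK h : im (meanK h) = l (fun d => im (h d)).
Proof.
rewrite im_mk// => FR; rewrite -[RHS]mean0; congr l.
by apply/funext => d; rewrite im_Reals.
Qed.

Lemma bounded_funD (h h' : D -> R) : bounded_fun h -> bounded_fun h' ->
  bounded_fun (fun d => h d + h' d).
Proof.
move=> [M hM] [M' hM']; exists (M + M') => d.
by rewrite (le_trans (ler_normD _ _))// lerD.
Qed.

Lemma bounded_funZ t (h : D -> R) : bounded_fun h -> bounded_fun (fun d => t * h d).
Proof. by move=> [M hM]; exists (`|t| * M) => d; rewrite normrM ler_wpM2l. Qed.

Lemma meanK_linear a h h' : boundedK h -> boundedK h' ->
  meanK (fun d => a * h d + h' d) = a * meanK h + meanK h'.
Proof.
move=> hb hb'.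
have rb := boundedK_re hb; have ib := boundedK_im hb.
have rb' := boundedK_re hb'; have ib' := boundedK_im hb'.
apply: scalar_ext; rewrite ?[re (_ + _)]reD ?[im (_ + _)]raddfD /= ?reMul ?imMul
  !re_meanK !im_meanK.
  rewrite (_ : (fun d => re (a * h d + h' d)) = fun d =>
    (re a * re (h d) + (- im a) * im (h d)) + re (h' d)); last first.
    by apply/funext => d; rewrite reD reMul mulNr.
  rewrite lD//; last by apply: bounded_funD; exact: bounded_funZ.
  by rewrite lD ?lZ ?mulNr//; exact: bounded_funZ.
rewrite (_ : (fun d => im (a * h d + h' d)) = fun d =>
  (re a * im (h d) + im a * re (h d)) + im (h' d)); last first.
  by apply/funext => d; rewrite [LHS]raddfD /= imMul.
rewrite lD//; last by apply: bounded_funD; exact: bounded_funZ.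
by rewrite lD ?lZ//; exact: bounded_funZ.
Qed.

Lemma meanK_conjs h : boundedK h -> meanK (fun d => conjs (h d)) = conjs (meanK h).
Proof.
move=> hb; apply: scalar_ext; rewrite ?re_conjs ?im_conjs !(re_meanK, im_meanK).
  by congr l; apply/funext => d; rewrite re_conjs.
rewrite -mulN1r -lZ; last exact: boundedK_im.
by congr l; apply/funext => d; rewrite im_conjs mulN1r.
Qed.

Variables (Z : seminormed R F) (v : Z -> D -> K).
Hypothesis vl : forall d a x y, v (a *: x + y) d = a * v x d + v y d.
Hypothesis vb : forall x d, modulus (v x d) <= snorm x.

Definition mean_form (x y : Z) : K := meanK (fun d => v x d * conjs (v y d)).

Lemma boundedK_vv x y : boundedK (fun d => v x d * conjs (v y d)).
Proof.
exists (snorm x * snorm y) => d.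
by rewrite modulusM modulus_conjs ler_pM ?modulus_ge0.
Qed.

Lemma mean_form_semi_inner : semi_inner mean_form.
Proof.
split=> [y a x x'|x y|x].
- rewrite -[RHS](meanK_linear a (boundedK_vv x y) (boundedK_vv x' y)).
  by congr meanK; apply/funext => d; rewrite vl; ring.
- rewrite -[RHS](meanK_conjs (boundedK_vv x y)).
  by congr meanK; apply/funext => d; rewrite rmorphM /= conjsK mulrC.
- rewrite ge0_scalar im_meanK re_meanK; apply/andP; split.
    apply/eqP; rewrite -[RHS]mean0; congr l; apply/funext => d.
    by rewrite mul_conjs im_emb.
  apply: mean_ge0; first exact/boundedK_re/boundedK_vv.
  by move=> d; rewrite mul_conjs re_emb sqr_ge0.
Qed.

Lemma bounded_vsqr x : bounded_fun (fun d => modulus (v x d) ^+ 2).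
Proof.
exists (snorm x ^+ 2) => d.
by rewrite ger0_norm ?sqr_ge0// lerXn2r ?nnegrE ?modulus_ge0 ?snorm_ge0.
Qed.

Lemma mean_form_pn x : pn mean_form x ^+ 2 = l (fun d => modulus (v x d) ^+ 2).
Proof.
rewrite (pn_sqr mean_form_semi_inner) re_meanK; congr l; apply/funext => d.
by rewrite mul_conjs re_emb.
Qed.

(** Averaging a pointwise bound: this is what makes the induced seminorm
    2-summing with constant 1. *)
Lemma mean_form_summing (s : seq Z) M :
  (forall d, \sum_(x <- s) modulus (v x d) ^+ 2 <= M) ->
  \sum_(x <- s) pn mean_form x ^+ 2 <= M.
Proof.
suff [b ->] : bounded_fun (fun d => \sum_(x <- s) modulus (v x d) ^+ 2) /\
   \sum_(x <- s) pn mean_form x ^+ 2 = l (fun d => \sum_(x <- s) modulus (v x d) ^+ 2).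
  exact: lle.
elim: s => [|x s [b ih]].
  have -> : (fun d => \sum_(x <- [::]) modulus (v x d) ^+ 2) = fun=> 0.
    by apply/funext => d; rewrite big_nil.
  by split; [exists 0 => d; rewrite normr0|rewrite big_nil mean0].
have -> : (fun d => \sum_(x0 <- x :: s) modulus (v x0 d) ^+ 2) =
  fun d => modulus (v x d) ^+ 2 + \sum_(x0 <- s) modulus (v x0 d) ^+ 2.
  by apply/funext => d; rewrite big_cons.
split; first by apply: bounded_funD => //; exact: bounded_vsqr.
by rewrite big_cons ih lD// ?mean_form_pn//; exact: bounded_vsqr.
Qed.

End Mean.
(** * The factorization theorem *)

Section Pietsch.
Variables (R : realType) (F : base_field).
Local Notation K := (scalar_field R F).

Section Domination.
Variables (X Y : seminormed R F) (phi : X -> Y) (C : R).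
Hypothesis C0 : 0 <= C.
Hypothesis lphi : linear phi.
Hypothesis phiC : forall s : seq (X * dual Y),
  modulus (\sum_(p <- s) p.2 (phi p.1)) <=
    C * (weak_l2 [seq p.1 | p <- s] * weak_l2 [seq p.2 | p <- s]).

(** The means live on the product of the unit balls of X^* and of Y^**, and
    [wt s] is the weight whose mean must be nonnegative. *)
Let D := {d : dual X * dual (dual Y) | unit_ball d.1 /\ unit_ball d.2}.
Let vX (x : X) (d : D) : K := (sval d).1 x.
Let vY (y : dual Y) (d : D) : K := (sval d).2 y.

Let wt (s : seq (X * dual Y)) (d : D) : R :=
  \sum_(p <- s) (C * (modulus (vX p.1 d) ^+ 2 + modulus (vY p.2 d) ^+ 2)
                 - 2 * re (p.2 (phi p.1))).

Let vX_le x d : modulus (vX x d) <= snorm x.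
Proof.
have [f1 _] := svalP d.
by rewrite (le_trans (ler_dual _ x))// ler_piMl ?snorm_ge0.
Qed.

Let vY_le y d : modulus (vY y d) <= snorm y.
Proof.
have [_ g1] := svalP d.
by rewrite (le_trans (ler_dual _ y))// ler_piMl ?snorm_ge0.
Qed.

Let wt_bounded s : bounded_fun (wt s).
Proof.
elim: s => [|p s ih].
  by exists 0 => d; rewrite /wt big_nil normr0.
rewrite (_ : wt (p :: s) = fun d =>
  ((C * modulus (vX p.1 d) ^+ 2 + C * modulus (vY p.2 d) ^+ 2)
   + (- (2 * re (p.2 (phi p.1)))) * 1) + wt s d); last first.
  by apply/funext => d; rewrite /wt big_cons mulrDr mulr1.
apply: bounded_funD => //; apply: bounded_funD.
  by apply: bounded_funD; apply: bounded_funZ; apply: bounded_vsqr.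
by apply: bounded_funZ; exists 1 => d; rewrite normr1.
Qed.

(** The supremum of [wt s] is nonnegative: by hypothesis its linear part is at
    most 2 C times the product of the weak norms, and the quadratic part comes
    as close as desired to C times the sum of their squares. *)
Let wt_sup s M : (forall d, wt s d <= M) -> 0 <= M.
Proof.
move=> wM; set x := [seq p.1 | p <- s]; set y := [seq p.2 | p <- s].
pose T := \sum_(p <- s) 2 * re (p.2 (phi p.1)).
have TC : T <= 2 * (C * (weak_l2 x * weak_l2 y)).
  rewrite /T -mulr_sumr ler_wpM2l// -raddf_sum.
  by apply: le_trans (phiC s); rewrite (le_trans (ler_norm _))// re_le_modulus.
have [C00|Cn0] := eqVneq C 0.
  have d0 : D by exists (0, 0); split; exact: unit_ball0.
  have := wM d0; rewrite /wt sumrB big1 => [|p _]; last by rewrite C00 mul0r.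
  by move: TC; rewrite C00 mul0r mulr0 -/T; lra.
have Cp : 0 < C by rewrite lt_def Cn0.
have key (f : dual X) (g : dual (dual Y)) : unit_ball f -> unit_ball g ->
    (\sum_(z <- x) modulus (f z) ^+ 2) + (\sum_(z <- y) modulus (g z) ^+ 2)
      <= (M + T) / C.
  move=> f1 g1; pose d : D := exist _ (f, g) (conj f1 g1).
  have := wM d; rewrite /wt sumrB -mulr_sumr -/T big_split /= !big_map.
  rewrite ler_pdivlMr// [X in _ -> X <= _]mulrC => h.
  by rewrite -lerBlDr.
set A := weak_l2 x in TC *; set B := weak_l2 y in TC *.
have A0 : 0 <= A by exact: weak_l2_ge0.
have B0 : 0 <= B by exact: weak_l2_ge0.
have sq_le (a b : R) : 0 <= a -> 0 <= b -> a <= Num.sqrt b -> a ^+ 2 <= b.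
  by move=> a0 b0 ab; rewrite -[b]sqr_sqrtr// lerXn2r ?nnegrE ?sqrtr_ge0.
have s0 (Z : seminormed R F) (z : seq Z) (f : dual Z) :
    0 <= \sum_(u <- z) modulus (f u) ^+ 2.
  by apply: sumr_ge0 => u _; rewrite sqr_ge0.
have step1 (g : dual (dual Y)) : unit_ball g ->
    A ^+ 2 <= (M + T) / C - \sum_(z <- y) modulus (g z) ^+ 2.
  move=> g1; apply: sq_le => //.
    rewrite subr_ge0; apply: le_trans (key 0 g (unit_ball0 _) g1).
    by rewrite lerDr s0.
  apply: weak_l2_le => f f1; rewrite ler_wsqrtr//.
  by have := key f g f1 g1; lra.
have step2 : B ^+ 2 <= (M + T) / C - A ^+ 2.
  apply: sq_le => //.
    by have := step1 0 (unit_ball0 _); have := s0 _ y 0; lra.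
  apply: weak_l2_le => g g1; rewrite ler_wsqrtr//.
  by have := step1 g g1; lra.
have : (A ^+ 2 + B ^+ 2) * C <= M + T by rewrite -ler_pdivlMr//; lra.
have : 0 <= C * (A - B) ^+ 2 by rewrite mulr_ge0 ?sqr_ge0.
nra.
Qed.

(** Averaging the evaluations against a mean that is nonnegative on all [wt s]
    gives two Hilbertian seminorms p on X and q on Y^*, 2-summing with constant 1,
    that dominate the bilinear form. *)
Lemma hilbertian_domination :
  exists (p : X -> X -> K) (q : dual Y -> dual Y -> K),
  [/\ semi_inner p, semi_inner q,
      forall s : seq X, \sum_(x <- s) pn p x ^+ 2 <= weak_l2 s ^+ 2,
      forall s : seq (dual Y), \sum_(y <- s) pn q y ^+ 2 <= weak_l2 s ^+ 2 &
      forall x (y : dual Y), modulus (y (phi x)) <= C * pn p x * pn q y].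
Proof.
have [|||||l [lD lZ lle lW]] := @mean_nonneg_on_cone R D [set wt s | s in setT].
- by move=> _ [s _ <-]; exact: wt_bounded.
- by exists [::] => //; apply/funext => d; rewrite /wt big_nil.
- move=> _ _ [s _ <-] [s' _ <-]; exists (s ++ s') => //.
  by apply/funext => d; rewrite /wt big_cat.
- move=> t _ t0 [s _ <-].
  exists [seq (emb (Num.sqrt t) *: p.1, emb (Num.sqrt t) *: p.2) | p <- s] => //.
  set r : K := emb (Num.sqrt t).
  have rX x d : vX (r *: x) d = r * vX x d.
    exact: (linZ (@dual_linear _ _ _ (sval d).1)).
  have rY y d : vY (r *: y) d = r * vY y d.
    exact: (linZ (@dual_linear _ _ _ (sval d).2)).
  have rXY (y : dual Y) (x : X) : (r *: y) (phi (r *: x)) = r * (r * y (phi x)).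
    rewrite (linZ lphi); transitivity (r * y (r *: phi x)) => //.
    by rewrite (linZ (@dual_linear _ _ _ y)).
  have tt : Num.sqrt t ^+ 2 = t by rewrite sqr_sqrtr// ltW.
  have rT (x : X) (y : dual Y) d :
      C * (modulus (vX (r *: x) d) ^+ 2 + modulus (vY (r *: y) d) ^+ 2)
        - 2 * re ((r *: y) (phi (r *: x))) =
      t * (C * (modulus (vX x d) ^+ 2 + modulus (vY y d) ^+ 2)
        - 2 * re (y (phi x))).
    rewrite rX rY rXY !re_embM !modulusM modulus_emb ger0_norm ?sqrtr_ge0//.
    by rewrite !exprMn [Num.sqrt t * (_ * _)]mulrA -expr2 tt; ring.
  apply/funext => d; rewrite /wt big_map mulr_sumr; apply: eq_bigr => -[x y] _.
  exact: rT.
- by move=> _ M [s _ <-]; exact: wt_sup.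
have vXl d a x y : vX (a *: x + y) d = a * vX x d + vX y d.
  exact: (@dual_linear _ _ _ (sval d).1).
have vYl d a x y : vY (a *: x + y) d = a * vY x d + vY y d.
  exact: (@dual_linear _ _ _ (sval d).2).
have pP := mean_form_semi_inner lD lZ lle vXl vX_le.
have qP := mean_form_semi_inner lD lZ lle vYl vY_le.
have pE := mean_form_pn lD lZ lle vXl vX_le.
have qE := mean_form_pn lD lZ lle vYl vY_le.
set p := mean_form l vX in pP pE *; set q := mean_form l vY in qP qE *.
have sqrt_le (a M : R) : 0 <= a -> 0 <= M -> Num.sqrt a <= M -> a <= M ^+ 2.
  by move=> a0 M0 aM; rewrite -[a]sqr_sqrtr// lerXn2r ?nnegrE ?sqrtr_ge0.
have main x (y : dual Y) : 2 * re (y (phi x)) <= C * (pn p x ^+ 2 + pn q y ^+ 2).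
  have := lW _ (ex_intro2 _ _ [:: (x, y)] I erefl).
  have bX := bounded_vsqr vX_le x; have bY := bounded_vsqr vY_le y.
  have b1 : bounded_fun ((fun=> 1) : D -> R) by exists 1 => d; rewrite normr1.
  rewrite (_ : wt _ = fun d => (C * modulus (vX x d) ^+ 2 + C * modulus (vY y d) ^+ 2)
     + (- (2 * re (y (phi x)))) * 1); last first.
    by apply/funext => d; rewrite /wt big_seq1 mulrDr mulr1.
  rewrite lD; [|by apply: bounded_funD; exact: bounded_funZ|exact: bounded_funZ].
  rewrite lD; [|exact: bounded_funZ|exact: bounded_funZ].
  rewrite !lZ// -pE -qE.
  (* l 1 = 1, because l lies below the supremum at 1 and at -1. *)
  have l1 : l (fun=> 1) = 1.
    apply/le_anti; rewrite lle//=.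
    have : l (fun d => -1 * 1) <= -1.
      by apply: lle => [|d]; [exact: bounded_funZ|rewrite mulr1].
    by rewrite lZ// mulN1r lerN2.
  by rewrite l1; lra.
exists p, q; split=> //.
- move=> s; apply: (mean_form_summing lD lZ lle vXl vX_le) => d.
  apply: sqrt_le; [by apply: sumr_ge0 => x _; rewrite sqr_ge0|exact: weak_l2_ge0|].
  by have [f1 g1] := svalP d; exact: weak_l2_ge.
- move=> s; apply: (mean_form_summing lD lZ lle vYl vY_le) => d.
  apply: sqrt_le; [by apply: sumr_ge0 => x _; rewrite sqr_ge0|exact: weak_l2_ge0|].
  by have [f1 g1] := svalP d; exact: weak_l2_ge.
move=> x y.
have -> : C * pn p x * pn q y = Num.sqrt (C * pn p x ^+ 2) * Num.sqrt (C * pn q y ^+ 2).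
  have sC a : 0 <= a -> Num.sqrt (C * a ^+ 2) = Num.sqrt C * a.
    by move=> a0; rewrite sqrtrM// sqrtr_sqr ger0_norm.
  by rewrite !sC ?pn_ge0// mulrACA -expr2 sqr_sqrtr// mulrA.
apply: amgm_le => [||t t0]; try by apply: mulr_ge0 => //; exact: sqr_ge0.
(* Rescaling x by sqrt t and y by its inverse makes the additive bound
   homogeneous, and the phase turns the real part into the modulus. *)
have [u u1 uE] := phase (y (phi x)).
have r0 : 0 < Num.sqrt t by rewrite sqrtr_gt0.
have tt : Num.sqrt t ^+ 2 = t by rewrite sqr_sqrtr// ltW.
have := main ((emb (Num.sqrt t) * u) *: x) (emb (Num.sqrt t)^-1 *: y).
rewrite (pnZ pP) (pnZ qP) modulusM u1 mulr1 !modulus_emb.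
rewrite !ger0_norm ?invr_ge0 ?(ltW r0)// !exprMn exprVn tt.
have -> : (emb (Num.sqrt t)^-1 *: y : dual Y) (phi ((emb (Num.sqrt t) * u) *: x)) =
    emb (modulus (y (phi x))).
  rewrite (linZ lphi).
  have -> : (emb (Num.sqrt t)^-1 *: y : dual Y)
      ((emb (Num.sqrt t) * u) *: phi x) =
    emb (Num.sqrt t)^-1 * ((emb (Num.sqrt t) * u) * y (phi x)).
    transitivity (emb (Num.sqrt t)^-1 * y ((emb (Num.sqrt t) * u) *: phi x)) => //.
    by rewrite (linZ (@dual_linear _ _ _ y)).
  by rewrite -[_ * u * _]mulrA uE mulrA -rmorphM mulVf ?gt_eqF// rmorph1 mul1r.
rewrite re_emb; lra.
Qed.

End Domination.

Local Notation Banach := (completeNormedModType K).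

(** The factorization goes through the completion H of X for the seminorm p: the
    canonical map X -> H is 2-summing because p is, and the extension of phi to H
    has a 2-summing adjoint because y o phi2 has norm at most C q(y). *)
Lemma pietsch_factorization (X Y : Banach) (phi : {linear X -> Y}) (C : R) : 0 <= C ->
  (forall s : seq (of_normed X * dual (of_normed Y)),
    modulus (\sum_(p <- s) p.2 (phi p.1)) <=
      C * (weak_l2 [seq p.1 | p <- s] * weak_l2 [seq p.2 | p <- s])) ->
  exists (H : Banach) (phi1 : {linear of_normed X -> of_normed H})
         (phi2 : {linear of_normed H -> of_normed Y}) (bphi2 : bounded_op phi2),
    [/\ dominated_factorization phi phi1 bphi2, summing_bound phi1 1 &
        summing_bound (adjoint bphi2) C].
Proof.
move=> C0 phiC.
have lphi : linear (phi : of_normed X -> of_normed Y) by exact: linearP.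
have [p [q [pP qP pS qS pq]]] := hilbertian_domination C0 lphi phiC.
have q1 y : pn q y <= snorm y.
  rewrite -ler_sqr ?nnegrE ?pn_ge0 ?snorm_ge0//.
  have := qS [:: y]; rewrite big_seq1 => /le_trans; apply.
  rewrite lerXn2r ?nnegrE ?weak_l2_ge0 ?snorm_ge0//.
  apply: weak_l2_le => g g1; rewrite big_seq1 sqrtr_sqr ger0_norm ?modulus_ge0//.
  by rewrite (le_trans (ler_dual g y))// ler_piMl ?snorm_ge0.
have p1 x : pn p x <= snorm x.
  rewrite -ler_sqr ?nnegrE ?pn_ge0 ?snorm_ge0//.
  have := pS [:: x]; rewrite big_seq1 => /le_trans; apply.
  rewrite lerXn2r ?nnegrE ?weak_l2_ge0 ?snorm_ge0//.
  apply: weak_l2_le => g g1; rewrite big_seq1 sqrtr_sqr ger0_norm ?modulus_ge0//.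
  by rewrite (le_trans (ler_dual g x))// ler_piMl ?snorm_ge0.
have phip (x : of_normed X) : snorm (phi x : of_normed Y) <= C * pn p x.
  have [y [y1 <-]] := norming_functional (phi x : of_normed Y).
  rewrite (le_trans (ler_norm _))// (le_trans (re_le_modulus _))//.
  rewrite (le_trans (pq x y))// ler_piMr ?mulr_ge0 ?pn_ge0//.
  exact: le_trans (q1 y) y1.
pose P := IPSpace pP.
pose H : Banach := hilbert_completion P.
pose phi1 : {linear of_normed X -> of_normed H} :=
  HB.pack (@embed _ _ P : of_normed X -> of_normed H)
    (GRing.isLinear.Build _ _ _ _ (@embed _ _ P : of_normed X -> of_normed H)
      (@embed_linear _ _ P)).
have cY := @banach_seq_complete _ _ Y; have sY := @banach_separated _ _ Y.
pose e2 : of_normed H -> of_normed Y := @ext _ _ P (of_normed Y) phi.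
have le2 : linear e2 := @ext_linear _ _ P (of_normed Y) phi C cY sY lphi C0 phip.
pose phi2 : {linear of_normed H -> of_normed Y} :=
  HB.pack e2 (GRing.isLinear.Build _ _ _ _ e2 le2).
have key (h : of_normed H) (y : dual (of_normed Y)) :
    modulus (y (phi2 h)) <= C * pn q y * snorm h.
  have [B B0 hB] : is_ext (X:=P) (phi : P -> of_normed Y) h (e2 h) :=
    @is_ext_ext _ _ P (of_normed Y) phi C cY lphi C0 phip h.
  rewrite -subr_le0; apply: (@le0_of_small R _ (snorm y * B + C * pn q y)) => d d0.
  have [x hx] := compl_approx (X:=P) h d0.
  have px : pn p x <= snorm h + d.
    have hd := approx_cn (X:=P) (ltW d0) hx.
    rewrite snorm_completion -[pn p x](@cn_embed _ _ P).
    have := pn_dist (cip_semi_inner P) (embed (X:=P) x) h.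
    rewrite (pnBC (cip_semi_inner P)) ler_norml => /andP[_]; lra.
  have -> : y (phi2 h) = y (phi x) - y (phi x - e2 h : of_normed Y).
    by rewrite (linB (@dual_linear _ _ _ y)) opprB addrC subrK.
  rewrite lerBlDr (le_trans (modulusD _ _))// modulusN.
  have h1 : modulus (y (phi x - e2 h : of_normed Y)) <= snorm y * (B * d).
    by rewrite (le_trans (ler_dual y _))// ler_wpM2l ?snorm_ge0// hB.
  have h2 := pq x y.
  have h3 : C * pn q y * pn p x <= C * pn q y * (snorm h + d).
    by rewrite ler_wpM2l// mulr_ge0 ?pn_ge0.
  rewrite mulrAC in h2; rewrite mulrDr in h3; rewrite mulrDl -[snorm y * B * d]mulrA.
  lra.
have bphi2 : bounded_op phi2.
  exists C => h; have [y [y1 <-]] := norming_functional (phi2 h).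
  rewrite (le_trans (ler_norm _))// (le_trans (re_le_modulus _))//.
  rewrite (le_trans (key h y))// ler_wpM2r ?snorm_ge0// ler_piMr//.
  exact: le_trans (q1 y) y1.
have s1 : summing_bound phi1 1.
  split=> // s; rewrite mul1r /strong_l2 -[leRHS]ger0_norm ?weak_l2_ge0//.
  rewrite -sqrtr_sqr ler_wsqrtr// (le_trans _ (pS s))// big_map.
  apply: ler_sum => x _; rewrite [snorm _]snorm_completion.
  by rewrite [pn _ _](@cn_embed _ _ P).
have s2 : summing_bound (adjoint bphi2) C.
  split=> // s; rewrite /strong_l2 big_map.
  have -> : C * weak_l2 s = Num.sqrt ((C * weak_l2 s) ^+ 2).
    by rewrite sqrtr_sqr ger0_norm// mulr_ge0// weak_l2_ge0.
  rewrite ler_wsqrtr// exprMn.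
  apply: (@le_trans _ _ (C ^+ 2 * \sum_(y <- s) pn q y ^+ 2)); last first.
    by rewrite ler_wpM2l ?sqr_ge0.
  rewrite mulr_sumr; apply: ler_sum => y _; rewrite -exprMn.
  rewrite lerXn2r ?nnegrE ?snorm_ge0 ?mulr_ge0 ?pn_ge0//.
  apply: dual_norm_le => h h1; rewrite (le_trans (key h y))//.
  by rewrite ler_piMr// mulr_ge0 ?pn_ge0.
exists H, phi1, phi2, bphi2; split=> //; split=> //.
- exact: hilbert_completionP.
- exists 1 => x; rewrite mul1r snorm_completion [pn _ _](@cn_embed _ _ P).
  exact: p1.
- move=> x; symmetry.
  exact: (@ext_embed _ _ P (of_normed Y) phi C cY sY lphi C0 phip x).
- by exists 1.
- by exists C.
Qed.

End Pietsch.
(** * The limit *)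

Section OperatorNorm.
Variables (R : realType) (F : base_field).
Variables (X Y : seminormed R F) (f : X -> Y).

Lemma opnorm_ge0 : linear f -> (0 <= opnorm f)%E.
Proof.
move=> lf; apply: ereal_sup_ubound; exists 0; first exact: unit_ball0.
by rewrite (lin0 lf) snorm0.
Qed.

Lemma opnorm_le N : 0 <= N -> (forall x, snorm (f x) <= N * snorm x) ->
  (opnorm f <= N%:E)%E.
Proof.
move=> N0 fN; apply: ge_ereal_sup => _ [x x1 <-]; rewrite lee_fin.
by rewrite (le_trans (fN x))// ler_piMr.
Qed.

(** Scaling by snorm x + d rather than by snorm x also covers the vectors of
    seminorm zero. *)
Lemma le_opnorm N : linear f -> opnorm f = N%:E -> forall x, snorm (f x) <= N * snorm x.
Proof.
move=> lf fN x; rewrite -subr_le0; apply: (@le0_of_small R _ N) => d d0.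
have s0 := snorm_ge0 x; have sd : 0 < snorm x + d by lra.
have : ((snorm (f (emb (snorm x + d)^-1 *: x)))%:E <= opnorm f)%E.
  apply: ereal_sup_ubound; exists (emb (snorm x + d)^-1 *: x) => //.
  rewrite /unit_ball /= snormZ modulus_emb ger0_norm ?invr_ge0 ?(ltW sd)//.
  by rewrite ler_pdivrMl// mulr1; lra.
rewrite fN lee_fin (linZ lf) snormZ modulus_emb ger0_norm ?invr_ge0 ?(ltW sd)//.
by rewrite ler_pdivrMl// mulrDl [d * N]mulrC; lra.
Qed.

End OperatorNorm.

Section Limit.
Variables (R : realType) (F : base_field).
Local Notation K := (scalar_field R F).
Variables (X Y : completeNormedModType K) (phi : {linear X -> Y}).

Let u (k : nat) : \bar R := (eps_pi_norm phi k `^ (k%:R)^-1)%E.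

Let lphi : linear (phi : of_normed X -> of_normed Y).
Proof. exact: linearP. Qed.

Lemma root_powR (c : R) k : 0 <= c -> (c ^+ k.+1) `^ (k.+1%:R)^-1 = c.
Proof.
by move=> c0; rewrite -powR_mulrn// -powRrM mulfV ?pnatr_eq0// powRr1.
Qed.

Lemma gamma2_starE (t : \bar R) :
  (exists (H : completeNormedModType K) (phi1 : {linear of_normed X -> of_normed H})
     (phi2 : {linear of_normed H -> of_normed Y}) (bphi2 : bounded_op phi2),
     dominated_factorization phi phi1 bphi2 /\
     t = (pi2 phi1 * pi2 (adjoint bphi2))%E) ->
  exists c : R, [/\ 0 <= c, t = c%:E &
    forall m (z : inj_pow (of_normed X) m),
      snorm (op_pow (phi : of_normed X -> of_normed Y) z) <= c ^+ m.+1 * snorm z].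
Proof.
move=> [H [phi1 [phi2 [bphi2 [dom ->]]]]].
have [_ _ _ s1 s2] := dom.
have [C1 C1P ->] := pi2_attained s1; have [C2 C2P ->] := pi2_attained s2.
exists (C1 * C2); split=> //; first by rewrite mulr_ge0 ?C1P.1 ?C2P.1.
move=> m z; exact: dominated_op_pow_le dom C1P C2P.
Qed.

Lemma gamma2_star_ge0 : (0 <= gamma2_star phi)%E.
Proof.
by apply: le_ereal_inf_tmp => t /gamma2_starE[c [c0 -> _]]; rewrite lee_fin.
Qed.

Lemma root_le_gamma2_star k : (u k.+1 <= gamma2_star phi)%E.
Proof.
apply: le_ereal_inf_tmp => t /gamma2_starE[c [c0 -> phic]].
have e0 : (0 <= eps_pi_norm phi k.+1)%E by apply: opnorm_ge0; exact: op_pow_linear.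
have ec : (eps_pi_norm phi k.+1 <= (c ^+ k.+1)%:E)%E.
  by apply: opnorm_le; [exact: exprn_ge0|exact: phic].
rewrite -[c in leRHS](root_powR k c0) -poweR_EFin.
apply: gt0_ler_poweR => //; rewrite ?invr_ge0// in_itv /= leey andbT//.
by rewrite lee_fin exprn_ge0.
Qed.

(** For C strictly between D and [gamma2_star], the conclusion of the
    factorization theorem fails for C. Hence so does its hypothesis, and the
    finite families that witness this make the norms of the tensor powers grow
    at any rate below C. *)
Lemma lt_gamma2_star_root (D : R) : 0 <= D -> (D%:E < gamma2_star phi)%E ->
  \forall k \near \oo, (D%:E <= u k)%E.
Proof.
move=> D0 Dg.
have [C DC Cg] : exists2 C, D < C & (C%:E < gamma2_star phi)%E.
  move: Dg; case: (gamma2_star phi) => [g|_|//].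
    by rewrite lte_fin => Dg; exists ((D + g) / 2); rewrite ?lte_fin; lra.
  by exists (D + 1); [lra|exact: ltry].
have C0 : 0 < C by lra.
have [s sC] : exists s : seq (of_normed X * dual (of_normed Y)),
    C * (weak_l2 [seq p.1 | p <- s] * weak_l2 [seq p.2 | p <- s]) <
    modulus (\sum_(p <- s) p.2 (phi p.1)).
  apply/not_existsP => h.
  have [|H [phi1 [phi2 [bphi2 [dom s1 s2]]]]] := @pietsch_factorization R F X Y phi C (ltW C0).
    by move=> s; rewrite leNgt; apply/negP; exact: h.
  move: Cg; rewrite ltNge => /negP; apply.
  apply: (@le_trans _ _ (pi2 phi1 * pi2 (adjoint bphi2))%E).
    by apply: ereal_inf_lbound; exists H, phi1, phi2, bphi2.
  have [C1 C1P p1] := pi2_attained (ex_intro _ _ s1).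
  have [C2 C2P p2] := pi2_attained (ex_intro _ _ s2).
  have := pi2_le s1; have := pi2_le s2; rewrite p1 p2 !lee_fin => h2 h1.
  by rewrite -[C]mul1r ler_pM ?C1P.1 ?C2P.1.
pose x (i : 'I_(size s)) := (tnth (in_tuple s) i).1.
pose y (i : 'I_(size s)) := (tnth (in_tuple s) i).2.
have xE : [seq p.1 | p <- s] = fam x.
  by rewrite -{1}[s](map_tnth_enum (in_tuple s)) -map_comp.
have yE : [seq p.2 | p <- s] = fam y.
  by rewrite -{1}[s](map_tnth_enum (in_tuple s)) -map_comp.
rewrite big_tnth xE yE in sC.
set W := weak_l2 (fam x) * weak_l2 (fam y) in sC.
set t := modulus _ in sC.
have W0 : 0 <= W by rewrite mulr_ge0 ?weak_l2_ge0.
have t0 : 0 < t by apply: le_lt_trans sC; rewrite mulr_ge0// ltW.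
(* Of the gap between C and D, the random tensors may use up C / E, and the
   remaining ratio E / D absorbs the constant c for large exponents. *)
pose E := (C + D) / 2.
have E0 : 0 < E by rewrite /E; lra.
have rho1 : 1 < C / E by rewrite ltr_pdivlMr// mul1r /E; lra.
have [c c0 cP] := trace_le_op_pow 'I_(size s) lphi rho1.
have [n0 n0P] : exists n0, forall n, (n0 <= n)%N -> D ^+ n.+1 * c <= E ^+ n.+1.
  have [->|Dn0] := eqVneq D 0.
    by exists 0 => n _; rewrite expr0n mul0r exprn_ge0// ltW.
  have Dp : 0 < D by rewrite lt_def Dn0.
  have [|n0 n0P] := @power_unbounded R c (E / D).
    by rewrite ltr_pdivlMr// mul1r /E; lra.
  exists n0 => n /leqW /n0P.
  by rewrite expr_div_n ler_pdivlMr ?exprn_gt0// mulrC.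
exists n0.+1 => // -[//|m] /= n0m.
have e0 : (0 <= eps_pi_norm phi m.+1)%E by apply: opnorm_ge0; exact: op_pow_linear.
rewrite /u; case eE : (eps_pi_norm phi m.+1) e0 => [N||] // N0; last first.
  by rewrite poweRyr ?leey// invr_eq0 pnatr_eq0.
rewrite lee_fin in N0.
have phiN := le_opnorm (op_pow_linear (n := m) lphi) eE.
have tN : t ^+ m.+1 <= N * W ^+ m.+1 * (c * (C / E) ^+ m.+1).
  exact: cP N0 phiN.
have Wp : 0 < W.
  rewrite lt_def W0 andbT; apply: contraTneq tN => ->.
  by rewrite expr0n /= mulr0 mul0r -ltNge exprn_gt0.
have CN : C ^+ m.+1 <= N * (c * (C / E) ^+ m.+1).
  rewrite -(@ler_pM2r _ (W ^+ m.+1)) ?exprn_gt0// -exprMn.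
  rewrite mulrAC; apply: le_trans tN.
  by rewrite lerXn2r ?nnegrE ?(ltW sC)//; [apply: mulr_ge0|]; exact: ltW.
have EN : E ^+ m.+1 <= N * c.
  have CE0 : 0 < (C / E) ^+ m.+1 by apply: exprn_gt0; exact: divr_gt0.
  by rewrite -(ler_pM2r CE0) -[leRHS]mulrA -exprMn [E * _]mulrC divfK ?gt_eqF.
have DN : D ^+ m.+1 <= N.
  rewrite -(@ler_pM2r _ c)//; apply: le_trans EN; apply: n0P.
  by rewrite -ltnS.
rewrite -[D in leLHS](root_powR m D0) -poweR_EFin.
by apply: gt0_ler_poweR; rewrite ?invr_ge0// ?in_itv /= ?leey ?andbT ?lee_fin ?exprn_ge0.
Qed.

Lemma cvg_root_gamma2_star : u @ \oo --> gamma2_star phi.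
Proof.
have ule : \forall k \near \oo, (u k <= gamma2_star phi)%E.
  by exists 1%N => // -[//|k] _; exact: root_le_gamma2_star.
have u0 k : (0 <= u k)%E by exact: poweR_ge0.
have ulo := @lt_gamma2_star_root.
have := gamma2_star_ge0.
case: (gamma2_star phi) ule ulo => [g||] ule ulo g0 //; last first.
  apply/cvgeyPge => A.
  have A0 : 0 <= Num.max A 0 by rewrite le_max lexx orbT.
  apply: filterS (ulo _ A0 (ltry _)) => k; apply: le_trans.
  by rewrite lee_fin le_max lexx.
rewrite lee_fin in g0.
apply/fine_cvgP; split.
  apply: filterS ule => k kg; rewrite ge0_fin_numE//.
  exact: le_lt_trans kg (ltry _).
apply/cvgrPdist_le => e e0.
have near_lo : \forall k \near \oo, ((g - e)%:E <= u k)%E.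
  have [ge|ge] := leP 0 (g - e).
    by apply: ulo => //; rewrite lte_fin; lra.
  by exists 0%N => // k _; rewrite (le_trans _ (u0 k))// lee_fin ltW.
apply: filterS2 ule near_lo => k /=; have := u0 k.
case: (u k) => [r| |] //=; rewrite !lee_fin => _ rg gr.
by rewrite ger0_norm; lra.
Qed.

Lemma gamma2_star_fin : gamma2_star phi \is a fin_num <-> two_dominated phi.
Proof.
rewrite ge0_fin_numE; last exact: gamma2_star_ge0.
split=> [gfin|[H [phi1 [phi2 [bphi2 dom]]]]].
  apply: contrapT => nd; move: gfin; rewrite /gamma2_star.
  rewrite (_ : [set t | _] = set0) ?ereal_inf0 ?ltxx//.
  apply/seteqP; split=> // t [H [phi1 [phi2 [bphi2 [dom _]]]]]; apply: nd.
  by exists H, phi1, phi2, bphi2.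
have [c [_ cE _]] := gamma2_starE (ex_intro _ H (ex_intro _ phi1
  (ex_intro _ phi2 (ex_intro _ bphi2 (conj dom erefl))))).
apply: (@le_lt_trans _ _ c%:E); last exact: ltry.
by rewrite -cE; apply: ereal_inf_lbound; exists H, phi1, phi2, bphi2.
Qed.

End Limit.

Theorem theorem4p5 (R : realType) (F : base_field)
    (X Y : completeNormedModType (scalar_field R F)) (phi : {linear X -> Y})
    (bphi : bounded_op (phi : of_normed X -> of_normed Y)) :
  ((fun k : nat => eps_pi_norm phi k `^ (k%:R)^-1)%E @ \oo --> gamma2_star phi)
  /\ (limn (fun k : nat => eps_pi_norm phi k `^ (k%:R)^-1)%E \is a fin_num
      <-> two_dominated phi).
Proof.
have cv := @cvg_root_gamma2_star R F X Y phi.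
split; first exact: cv.
by rewrite (cvg_lim _ cv)//; exact: gamma2_star_fin.
Qed.
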